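(* Consider the initial-boundary value problem of linear (Cauchy) elastodynamics for $U=(u,v,E,W)$, with $u,v$ $\mathbb{R}^3$-valued, $E$ symmetric and $W$ antisymmetric $3\times 3$ tensor-valued fields on $\Omega\times(0,T)$: $$\begin{aligned} &\partial_t u_i - v_i = 0,\quad \rho\,\partial_t v_i - \partial_j(C_{ijkl}E_{kl}) - b_i = 0,\quad \partial_l u_k - E_{kl}-W_{kl}=0 \quad\text{on }\Omega\times(0,T),\\ &u_i=u_i^{(b)}\ \text{on }\partial\Omega_u\times(0,T),\qquad C_{ijkl}E_{kl}n_j=t_i\ \text{on }\partial\Omega_s\times(0,T),\\ &u_i=u_i^{(0)}\ \text{on }\Omega\times\{0\},\qquad v_i=v_i^{(0)}\ \text{on }\Omega\times\{0\}. \end{aligned}\qquad (P)$$ Let $S$ be the dual functional, and $D\mapsto\hat U=(\hat u,\hat v,\hat E,\hat W)$ the dual-to-primal map, defined in the context in terms of $C,\rho$, the problem data, arbitrarily chosen base states $\bar U=(\bar u,\bar v,\bar E,\bar W)$, and chosen fields $A$ and $\mathsf{r}$. The functional $S$ is considered on dual fields $D=(\gamma,\lambda,\mu)$ satisfying $$\gamma=0\ \text{and}\ \lambda=0\ \text{on }\Omega\times\{T\},\qquad \lambda=0\ \text{on }\partial\Omega_u\times(0,T),\qquad \mu n=0\ \text{on }\partial\Omega_s\times(0,T).\qquad (B)$$ (i) Suppose $\mathsf{r}\neq 0$ and $A$ is invertible on the space of symmetric second-order tensors. Then, for every choice of $A,\mathsf{r},\bar U$, the Euler-Lagrange equations and natural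 boundary (and initial) conditions of $S$, i.e. the conditions that the first variation of $S$ at $D$ vanishes for all variations satisfying (B), are exactly the system (P) with $U$ replaced by $\hat U$. (ii) Suppose $\mathsf{r}>0$ and $A$ is positive-definite on the space of symmetric second-order tensors. Then $S[D]=\sup_U\widehat S[U,D]$, where $\widehat S$ is the pre-dual functional defined in the context and the supremum is over all fields $U$ without differential constraints or boundary conditions, and $S$ is a convex functional of $D$. No symmetry $C_{ijkl}=C_{klij}$, no positivity of $C$ and no positivity of $\rho$ is required. (iii) Suppose $\mathsf{r}>0$ and $A$ is positive-definite on the space of symmetric second-order tensors. Then the Euler-Lagrange system of $S$ is at worst degenerate elliptic on the space-time domain, in the sense that the quadratic form associated with its highest-order derivatives, $$\frac12\int_0^T\!\!\int_\Omega\Big(|\partial_t\gamma+\operatorname{div}\mu|^2+\frac{\rho^2}{\mathsf{r}}|\partial_t\lambda|^2+\nabla\lambda:(CA^{-1}C^T)\nabla\lambda\Big)\,dx\,dt,$$ is positive semi-definite, regardless of whether $C$ is positive-definite and $\rho$ is positive.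
   Context: $\Omega\subset\mathbb{R}^3$ is a domain with boundary $\partial\Omega=\overline{\partial\Omega_s\cup\partial\Omega_u}$, $\partial\Omega_s,\partial\Omega_u$ disjoint, $n$ is the outward unit normal, and $T>0$. Summation over repeated indices is used. The moduli $C=C(x)$ have minor symmetries ($C_{ijkl}=C_{jikl}=C_{ijlk}$) and may or may not have major symmetry; $(C^T)_{ijkl}:=C_{klij}$; $(C^T\nabla\lambda)_{mn}=C_{ijmn}\partial_j\lambda_i$; $(AB)_{ijkl}=A_{ijrm}B_{rmkl}$ for fourth-order tensors; $(\operatorname{div}\mu)_i=\partial_j\mu_{ij}$; $(\nabla\lambda)_{ij}=\partial_j\lambda_i$. $\rho=\rho(x)$ is the density. The symbols '':'' and ''$\cdot$'' denote inner products of second-order tensors and of vectors. $\mu_{(mn)}=\frac12(\mu_{mn}+\mu_{nm})$ and $\mu_{[mn]}=\frac12(\mu_{mn}-\mu_{nm})$. The data $b,u^{(b)},t,u^{(0)},v^{(0)}$ are given. All fields and domains are assumed sufficiently regular for the expressions and integrations by parts to make sense (the setting is formal). Dual fields: $D=(\gamma,\lambda,\mu)$ with $\gamma,\lambda$ $\mathbb{R}^3$-valued and $\mu$ $\mathbb{R}^{3\times3}$-valued on $\Omega\times[0,T]$. Chosen fields: base states $(x,t)\mapsto\bar U(x,t)=(\bar u,\bar v,\bar E,\bar W)$ with $\bar E$ symmetric and $\bar W$ antisymmetric; a scalar field $\mathsf{r}(x)$; a fourth-order tensor field $A(x,t)$, acting on symmetric second-order tensors, with major symmetry $A_{ijkl}=A_{klij}$.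 Auxiliary potential: $$H(U,\bar U)=\tfrac12\Big((E_{ij}-\bar E_{ij})A_{ijkl}(E_{kl}-\bar E_{kl})+(W_{kl}-\bar W_{kl})(W_{kl}-\bar W_{kl})+|u-\bar u|^2+\mathsf{r}\,|v-\bar v|^2\Big).$$ Pre-dual functional: $$\begin{aligned}\widehat S[U,D]=&\int_0^T\!\!\int_\Omega\Big(-u_i\partial_t\gamma_i-\gamma_iv_i-v_i\partial_t(\rho\lambda_i)+E_{kl}C_{ijkl}\partial_j\lambda_i-u_k\partial_l\mu_{kl}-\mu_{kl}(E_{kl}+W_{kl})-H(U,\bar U)\Big)dx\,dt\\ &-\int_0^T\!\!\int_\Omega\lambda_ib_i\,dx\,dt-\int_\Omega\big(\gamma_i(x,0)u^{(0)}_i(x)+\rho(x)\lambda_i(x,0)v^{(0)}_i(x)\big)dx\\ &-\int_0^T\!\!\int_{\partial\Omega_s}\lambda_it_i\,da\,dt+\int_0^T\!\!\int_{\partial\Omega_u}\mu_{kl}u^{(b)}_kn_l\,da\,dt.\end{aligned}$$ Dual-to-primal (DtP) map, obtained by setting to zero the derivative with respect to $U$ of the first space-time bulk integrand above: $$\hat u_m=\bar u_m-\partial_t\gamma_m-\partial_l\mu_{ml},\quad \hat v_m=\bar v_m-\tfrac1{\mathsf{r}}(\gamma_m+\rho\,\partial_t\lambda_m),$$ $$\hat E_{rs}=\bar E_{rs}+(A^{-1})_{rsmn}\big(C_{ijmn}\partial_j\lambda_i-\mu_{(mn)}\big),\quad \hat W_{mn}=\bar W_{mn}-\mu_{[mn]},$$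 where $A^{-1}$ is the inverse of $A$ on symmetric second-order tensors. Dual functional: $S[D]:=\widehat S[\hat U,D]$, i.e. $\hat U$ is substituted for $U$ in $\widehat S$.
   Formalization: In (i), equivalence with (P) exactly as written is stated when the set where ρ is nonzero is dense in Ω; for general ρ the initial condition on the velocity is ρ(v − v^(0)) = 0, since if ρ vanishes on an open set S does not depend on v^(0) there. *)

(* Defs.v *)
From HB Require Import structures.
From mathcomp Require Import all_boot all_order all_algebra.
From mathcomp Require Import all_classical all_reals all_analysis.

Set Implicit Arguments.
Unset Strict Implicit.
Unset Printing Implicit Defensive.

Import Order.TTheory GRing.Theory Num.Theory.
Import numFieldNormedType.Exports.

Local Open Scope classical_set_scope.
Local Open Scope ring_scope.

(* R^3 is an iterated product, so that the product topology, sigma-algebra and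
   Lebesgue measure of the library apply; a space-time point is [(x, t)]. *)
Notation space R := (R * R * R)%type.
Notation spacetime R := (R * R * R * R)%type.
Notation vec R := 'rV[R]_3.
Notation ten R := 'M[R]_3.
Notation ten4 R := ('I_3 -> 'I_3 -> 'I_3 -> 'I_3 -> R).

Notation mspace R :=
  (measurableTypeR R * measurableTypeR R * measurableTypeR R)%type.
Notation mspacetime R := (mspace R * measurableTypeR R)%type.

Definition basis (R : realType) (j : 'I_3) : space R :=
  (((j == 0%N :> nat)%:R, (j == 1%N :> nat)%:R), (j == 2%N :> nat)%:R).

Definition ddx (R : realType) (W : normedModType R) (j : 'I_3)
  (f : spacetime R -> W) : spacetime R -> W := 'D_(basis R j, 0) f.

Definition ddt (R : realType) (W : normedModType R)
  (f : spacetime R -> W) : spacetime R -> W := 'D_(0, 1) f.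

Lemma product_sigma_finite d1 d2 (T1 : measurableType d1)
    (T2 : measurableType d2) (R : realType)
    (m1 : {sigma_finite_measure set T1 -> \bar R})
    (m2 : {sigma_finite_measure set T2 -> \bar R}) :
  sigma_finite setT (m1 \x m2)%E.
Proof.
have /sigma_finiteP[F [TF ndF Foo]] := sigma_finiteT m1.
have /sigma_finiteP[G [TG ndG Goo]] := sigma_finiteT m2.
exists (fun n => F n `*` G n).
  rewrite -setXTT TF TG predeqE => -[x y]; split.
    move=> [/= [n _ Fnx] [k _ Gky]]; exists (maxn n k) => //; split.
    - by move: x Fnx; exact/subsetPset/ndF/leq_maxl.
    - by move: y Gky; exact/subsetPset/ndG/leq_maxr.
  by move=> [n _ []/= ? ?]; split; exists n.
move=> k; have [? ?] := Foo k; have [? ?] := Goo k.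
split; first exact: measurableX.
by rewrite product_measure1E// lte_mul_pinfty// ge0_fin_numE.
Qed.

Definition leb2 (R : realType) :
    set (measurableTypeR R * measurableTypeR R) -> \bar R :=
  (@lebesgue_measure R \x @lebesgue_measure R)%E.
HB.instance Definition _ (R : realType) := Measure.on (@leb2 R).
HB.instance Definition _ (R : realType) :=
  Measure_isSigmaFinite.Build _ _ _ (@leb2 R)
    (product_sigma_finite (@lebesgue_measure R) (@lebesgue_measure R)).

Definition leb3 (R : realType) : set (mspace R) -> \bar R :=
  (@leb2 R \x @lebesgue_measure R)%E.
HB.instance Definition _ (R : realType) := Measure.on (@leb3 R).
HB.instance Definition _ (R : realType) :=
  Measure_isSigmaFinite.Build _ _ _ (@leb3 R)
    (product_sigma_finite (@leb2 R) (@lebesgue_measure R)).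

(* dx dt *)
Definition leb4 (R : realType) : set (mspacetime R) -> \bar R :=
  (@leb3 R \x @lebesgue_measure R)%E.
HB.instance Definition _ (R : realType) := Measure.on (@leb4 R).
HB.instance Definition _ (R : realType) :=
  Measure_isSigmaFinite.Build _ _ _ (@leb4 R)
    (product_sigma_finite (@leb3 R) (@lebesgue_measure R)).

(* da dt, for a surface measure [sigma] *)
Definition sigma_dt (R : realType)
    (sigma : {sigma_finite_measure set (mspace R) -> \bar R}) :
    set (mspacetime R) -> \bar R :=
  (sigma \x @lebesgue_measure R)%E.
HB.instance Definition _ (R : realType)
    (sigma : {sigma_finite_measure set (mspace R) -> \bar R}) :=
  Measure.on (sigma_dt sigma).
HB.instance Definition _ (R : realType)
    (sigma : {sigma_finite_measure set (mspace R) -> \bar R}) :=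
  Measure_isSigmaFinite.Build _ _ _ (sigma_dt sigma)
    (product_sigma_finite sigma (@lebesgue_measure R)).

(* [f] is k times continuously differentiable on the open set [U].  In finite
   dimension it is enough to iterate directional derivatives. *)
Fixpoint Ck (R : realType) (V W : normedModType R) (k : nat) (U : set V)
    (f : V -> W) : Prop :=
  (forall x, U x -> {for x, continuous f}) /\
  (if k is k'.+1 then
     forall v, (forall x, U x -> derivable f x v) /\ Ck k' U ('D_v f)
   else True).

(* C^k up to the boundary on the closed set [K]: C^k on a neighbourhood *)
Definition Ck_near (R : realType) (V W : normedModType R) (k : nat)
    (K : set V) (f : V -> W) : Prop :=
  exists U : set V, [/\ open U, K `<=` U & Ck k U f].

Definition bdry (R : realType) (Omega : set (space R)) : set (space R) :=
  closure Omega `\` interior Omega.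

(* A domain on which integration by parts makes sense.  [sigma] is the area
   element and [n] the outward unit normal: the Gauss-Green identity, together
   with [|n| = 1] and [sigma >= 0], determines both (it says that [- n sigma]
   is the distributional gradient of the indicator of [Omega]).  The normal
   exists and is continuous on the relatively open parts [Gs], [Gu]; edges and
   the interface between the parts make up the null rest of the boundary. *)
Record regular_domain (R : realType) (Omega Gs Gu : set (space R))
    (sigma : {sigma_finite_measure set (mspace R) -> \bar R})
    (n : space R -> vec R) : Prop := RegularDomain {
  dom_open : open Omega;
  dom_connected : connected Omega;
  dom_nonempty : Omega !=set0;
  dom_parts_disjoint : Gs `&` Gu = set0;
  dom_parts_cover : bdry Omega = closure (Gs `|` Gu);
  dom_Gs_open : exists V : set (space R), open V /\ Gs = V `&` bdry Omega;
  dom_Gu_open : exists V : set (space R), open V /\ Gu = V `&` bdry Omega;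
  dom_area_null : sigma (bdry Omega `\` (Gs `|` Gu)) = 0%E;
  dom_area_finite : forall M : R,
    (sigma (bdry Omega `&` [set x : space R | (`|x| <= M)%R]) < +oo)%E;
  dom_area_pos : forall V : set (space R), open V -> V `&` bdry Omega !=set0 ->
    (0 < sigma (V `&` bdry Omega))%E;
  dom_normal_unit : forall x, (Gs `|` Gu) x -> \sum_(i < 3) n x 0 i ^+ 2 = 1;
  dom_normal_continuous : {within Gs `|` Gu, continuous n};
  dom_gauss_green : forall (f : space R -> R) (j : 'I_3),
    Ck_near 1 (closure Omega) f ->
    (exists M : R, forall x, closure Omega x -> M < `|x| -> f x = 0) ->
    \int[@leb3 R]_(x in Omega) 'D_(basis R j) f x =
    \int[sigma]_(x in Gs `|` Gu) (f x * n x 0 j) }.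

(* pointwise values (u, v, E, W) of the primal fields *)
Record primal_val (R : realType) := Primal {
  pu : vec R; pv : vec R; pE : ten R; pW : ten R }.

Record problem (R : realType) := Problem {
  Omega : set (space R);
  Gs : set (space R);
  Gu : set (space R);
  sigma : {sigma_finite_measure set (mspace R) -> \bar R};
  normal : space R -> vec R;
  horizon : R;
  moduli : space R -> ten4 R;
  rho : space R -> R;
  force : spacetime R -> vec R;
  disp_bdry : spacetime R -> vec R;
  traction : spacetime R -> vec R;
  disp_init : space R -> vec R;
  vel_init : space R -> vec R }.

Definition cyl (R : realType) (p : problem R) (G : set (space R)) :
    set (spacetime R) :=
  G `*` `[0, horizon p]%classic.

Definition ocyl (R : realType) (p : problem R) (G : set (space R)) :
    set (spacetime R) :=
  G `*` `]0, horizon p[%classic.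

Definition loc_bounded (R : realType) (K : set (spacetime R))
    (f : spacetime R -> vec R) : Prop :=
  forall M : R, exists N : R, forall z, K z -> `|z.1| <= M -> `|f z| <= N.

Definition minor_symmetric (R : realType) (B : ten4 R) : Prop :=
  forall i j k l, B i j k l = B j i k l /\ B i j k l = B i j l k.

Definition major_symmetric (R : realType) (B : ten4 R) : Prop :=
  forall i j k l, B i j k l = B k l i j.

Record regular_problem (R : realType) (p : problem R) : Prop :=
  RegularProblem {
  prb_domain : regular_domain (Omega p) (Gs p) (Gu p) (sigma p) (normal p);
  prb_horizon : 0 < horizon p;
  prb_moduli : forall i j k l,
    Ck_near 1 (closure (Omega p)) (fun x => moduli p x i j k l);
  prb_moduli_sym : forall x, closure (Omega p) x ->
    minor_symmetric (moduli p x);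
  prb_rho : Ck_near 1 (closure (Omega p)) (rho p);
  prb_force : {within cyl p (closure (Omega p)), continuous (force p)};
  prb_disp_bdry : {within cyl p (Gu p), continuous (disp_bdry p)};
  prb_disp_bdry_bounded : loc_bounded (cyl p (Gu p)) (disp_bdry p);
  prb_traction : {within cyl p (Gs p), continuous (traction p)};
  prb_traction_bounded : loc_bounded (cyl p (Gs p)) (traction p);
  prb_disp_init : {within closure (Omega p), continuous (disp_init p)};
  prb_vel_init : {within closure (Omega p), continuous (vel_init p)} }.

(* The initial condition on the velocity is set apart: its natural form in the
   Euler-Lagrange system carries the factor [rho], which may vanish. *)
Record elastodynamics_but_initial_velocity (R : realType) (p : problem R)
    (U : spacetime R -> primal_val R) : Prop := ElastodynamicsBut {
  eq_velocity : forall z i, ocyl p (Omega p) z ->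
    ddt (fun y => pu (U y) 0 i) z - pv (U z) 0 i = 0;
  eq_momentum : forall z i, ocyl p (Omega p) z ->
    rho p z.1 * ddt (fun y => pv (U y) 0 i) z
    - \sum_(j < 3) ddx j (fun y =>
        \sum_(k < 3) \sum_(l < 3) moduli p y.1 i j k l * pE (U y) k l) z
    - force p z 0 i = 0;
  eq_kinematic : forall z k l, ocyl p (Omega p) z ->
    ddx l (fun y => pu (U y) 0 k) z - pE (U z) k l - pW (U z) k l = 0;
  bc_displacement : forall z i, ocyl p (Gu p) z ->
    pu (U z) 0 i = disp_bdry p z 0 i;
  bc_traction : forall z i, ocyl p (Gs p) z ->
    \sum_(j < 3) \sum_(k < 3) \sum_(l < 3)
      moduli p z.1 i j k l * pE (U z) k l * normal p z.1 0 j
    = traction p z 0 i;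
  ic_displacement : forall x i, Omega p x ->
    pu (U (x, 0)) 0 i = disp_init p x 0 i;
  strain_sym : forall z, ocyl p (Omega p) z -> (pE (U z))^T = pE (U z);
  spin_skew : forall z, ocyl p (Omega p) z -> (pW (U z))^T = - pW (U z) }.

Definition elastodynamics (R : realType) (p : problem R)
    (U : spacetime R -> primal_val R) : Prop :=
  elastodynamics_but_initial_velocity p U /\
  (forall x i, Omega p x -> pv (U (x, 0)) 0 i = vel_init p x 0 i).

Definition sym (R : realType) (M : ten R) : ten R := 2^-1 *: (M + M^T).
Definition skew (R : realType) (M : ten R) : ten R := 2^-1 *: (M - M^T).

Definition act4 (R : realType) (B : ten4 R) (M : ten R) : ten R :=
  \matrix_(i < 3, j < 3) \sum_(k < 3) \sum_(l < 3) B i j k l * M k l.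

Definition mul4 (R : realType) (A B : ten4 R) : ten4 R :=
  fun i j k l => \sum_(r < 3) \sum_(m < 3) A i j r m * B r m k l.

Definition tr4 (R : realType) (B : ten4 R) : ten4 R := fun i j k l => B k l i j.

Definition invertible_on_sym (R : realType) (B : ten4 R) : Prop :=
  forall M : ten R, M^T = M -> exists! E : ten R, E^T = E /\ act4 B E = M.

Definition posdef_on_sym (R : realType) (B : ten4 R) : Prop :=
  forall E : ten R, E^T = E -> E != 0 ->
    0 < \sum_(i < 3) \sum_(j < 3) \sum_(k < 3) \sum_(l < 3)
          E i j * B i j k l * E k l.

(* components of the inverse of [B] on symmetric tensors: the slice [.., m, n]
   is the symmetric preimage of the symmetric part of e_m (x) e_n *)
Definition inv4 (R : realType) (B : ten4 R) : ten4 R := fun r s m n =>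
  (xget 0 [set E : ten R | E^T = E /\ act4 B E = sym (delta_mx m n)]) r s.

(* pointwise values (gamma, lambda, mu) of the dual fields *)
Notation dual_val R := (vec R * vec R * ten R)%type.

Definition gam (R : realType) (d : dual_val R) (i : 'I_3) : R := d.1.1 0 i.
Definition lam (R : realType) (d : dual_val R) (i : 'I_3) : R := d.1.2 0 i.
Definition mu (R : realType) (d : dual_val R) (k l : 'I_3) : R := d.2 k l.

(* a first-order jet: value, time derivative, spatial partial derivatives *)
Notation gradient R := (dual_val R * ('I_3 -> dual_val R))%type.
Notation jet R := (dual_val R * gradient R)%type.

Definition grad (R : realType) (D : spacetime R -> dual_val R) (z : spacetime R) :
  gradient R := (ddt D z, fun j => ddx j D z).

Definition jet_of (R : realType) (D : spacetime R -> dual_val R)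
  (z : spacetime R) : jet R := (D z, grad D z).

Record chosen (R : realType) := Chosen {
  base_state : spacetime R -> primal_val R;
  Afield : spacetime R -> ten4 R;
  rfield : space R -> R }.

Record regular_choice (R : realType) (p : problem R) (c : chosen R) : Prop :=
  RegularChoice {
  cho_u : Ck_near 1 (cyl p (closure (Omega p))) (fun z => pu (base_state c z));
  cho_v : Ck_near 1 (cyl p (closure (Omega p))) (fun z => pv (base_state c z));
  cho_E : Ck_near 1 (cyl p (closure (Omega p))) (fun z => pE (base_state c z));
  cho_W : Ck_near 1 (cyl p (closure (Omega p))) (fun z => pW (base_state c z));
  cho_E_sym : forall z, cyl p (closure (Omega p)) z ->
    (pE (base_state c z))^T = pE (base_state c z);
  cho_W_skew : forall z, cyl p (closure (Omega p)) z ->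
    (pW (base_state c z))^T = - pW (base_state c z);
  cho_A : forall i j k l,
    Ck_near 1 (cyl p (closure (Omega p))) (fun z => Afield c z i j k l);
  cho_A_minor : forall z, cyl p (closure (Omega p)) z ->
    minor_symmetric (Afield c z);
  cho_A_major : forall z, cyl p (closure (Omega p)) z ->
    major_symmetric (Afield c z);
  cho_r : Ck_near 1 (closure (Omega p)) (rfield c) }.

Definition nondegenerate_choice (R : realType) (p : problem R)
    (c : chosen R) : Prop :=
  (forall x, closure (Omega p) x -> rfield c x != 0) /\
  (forall z, cyl p (closure (Omega p)) z -> invertible_on_sym (Afield c z)).

Definition positive_choice (R : realType) (p : problem R)
    (c : chosen R) : Prop :=
  (forall x, closure (Omega p) x -> 0 < rfield c x) /\
  (forall z, cyl p (closure (Omega p)) z -> posdef_on_sym (Afield c z)).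

Definition potential (R : realType) (c : chosen R) (z : spacetime R)
    (U : primal_val R) : R :=
  let Ub := base_state c z in
  2^-1 * (
    \sum_(i < 3) \sum_(j < 3) \sum_(k < 3) \sum_(l < 3)
      (pE U i j - pE Ub i j) * Afield c z i j k l * (pE U k l - pE Ub k l)
    + \sum_(k < 3) \sum_(l < 3) (pW U k l - pW Ub k l) ^+ 2
    + \sum_(i < 3) (pu U 0 i - pu Ub 0 i) ^+ 2
    + rfield c z.1 * \sum_(i < 3) (pv U 0 i - pv Ub 0 i) ^+ 2).

(* first space-time bulk integrand of the pre-dual functional, as a function of
   the point, the value of U and the first-order jet of D; the term in
   d_t (rho lambda_i) is rho d_t lambda_i, as rho does not depend on time *)
Definition bulk (R : realType) (p : problem R) (c : chosen R)
    (z : spacetime R) (U : primal_val R) (J : jet R) : R :=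
  let: (D, (Dt, Dx)) := J in
  \sum_(i < 3) (- pu U 0 i * gam Dt i - gam D i * pv U 0 i
                - pv U 0 i * (rho p z.1 * lam Dt i))
  + \sum_(i < 3) \sum_(j < 3) \sum_(k < 3) \sum_(l < 3)
      pE U k l * moduli p z.1 i j k l * lam (Dx j) i
  - \sum_(k < 3) \sum_(l < 3) pu U 0 k * mu (Dx l) k l
  - \sum_(k < 3) \sum_(l < 3) mu D k l * (pE U k l + pW U k l)
  - potential c z U.

Definition predual (R : realType) (p : problem R) (c : chosen R)
    (U : spacetime R -> primal_val R) (D : spacetime R -> dual_val R) : R :=
  \int[@leb4 R]_(z in cyl p (Omega p)) bulk p c z (U z) (jet_of D z)
  - \int[@leb4 R]_(z in cyl p (Omega p))
      \sum_(i < 3) lam (D z) i * force p z 0 i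
  - \int[@leb3 R]_(x in Omega p)
      \sum_(i < 3) (gam (D (x, 0)) i * disp_init p x 0 i
                    + rho p x * lam (D (x, 0)) i * vel_init p x 0 i)
  - \int[sigma_dt (sigma p)]_(z in cyl p (Gs p))
      \sum_(i < 3) lam (D z) i * traction p z 0 i
  + \int[sigma_dt (sigma p)]_(z in cyl p (Gu p))
      \sum_(k < 3) \sum_(l < 3)
        mu (D z) k l * disp_bdry p z 0 k * normal p z.1 0 l.

Definition dtp (R : realType) (p : problem R) (c : chosen R)
    (z : spacetime R) (J : jet R) : primal_val R :=
  let: (D, (Dt, Dx)) := J in
  let Ub := base_state c z in
  let X : ten R := \matrix_(m < 3, n < 3)
    (\sum_(i < 3) \sum_(j < 3) moduli p z.1 i j m n * lam (Dx j) i
     - sym D.2 m n) in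
  Primal
    (\row_(m < 3) (pu Ub 0 m - gam Dt m - \sum_(l < 3) mu (Dx l) m l))
    (\row_(m < 3) (pv Ub 0 m
                   - (rfield c z.1)^-1 * (gam D m + rho p z.1 * lam Dt m)))
    (pE Ub + act4 (inv4 (Afield c z)) X)
    (pW Ub - skew D.2).

Definition dtp_field (R : realType) (p : problem R) (c : chosen R)
    (D : spacetime R -> dual_val R) : spacetime R -> primal_val R :=
  fun z => dtp p c z (jet_of D z).

Definition dual_functional (R : realType) (p : problem R) (c : chosen R)
    (D : spacetime R -> dual_val R) : R :=
  predual p c (dtp_field p c D) D.

(* C^2 up to the boundary and, in case Omega is unbounded, with bounded spatial
   support, so that all the integrals are finite *)
Definition regular_dual (R : realType) (p : problem R)
    (D : spacetime R -> dual_val R) : Prop :=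
  Ck_near 2 (cyl p (closure (Omega p))) D /\
  (exists M : R, forall z, cyl p (closure (Omega p)) z ->
     M < `|z.1| -> D z = 0).

Definition dual_fields (R : realType) (p : problem R) :
    set (spacetime R -> dual_val R) :=
  [set D | [/\ regular_dual p D,
    (forall x i, Omega p x ->
       gam (D (x, horizon p)) i = 0 /\ lam (D (x, horizon p)) i = 0),
    (forall z i, ocyl p (Gu p) z -> lam (D z) i = 0) &
    (forall z k, ocyl p (Gs p) z ->
       \sum_(l < 3) mu (D z) k l * normal p z.1 0 l = 0)]].

Definition stationary (R : realType) (p : problem R)
    (S : (spacetime R -> dual_val R) -> R) (D : spacetime R -> dual_val R) : Prop :=
  forall dD, dual_fields p dD ->
    is_derive (0 : R) (1 : R) (fun e : R => S (D + e *: dD)) 0.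

(* the fields U over which the pre-dual functional is maximized: measurable,
   no constraint besides the algebraic symmetries of E and W, and such that the
   bulk integral makes sense *)
Definition primal_fields (R : realType) (p : problem R) (c : chosen R)
    (D : spacetime R -> dual_val R) : set (spacetime R -> primal_val R) :=
  [set U | [/\
    (forall z, cyl p (Omega p) z ->
       (pE (U z))^T = pE (U z) /\ (pW (U z))^T = - pW (U z)),
    (forall i,
       measurable_fun (cyl p (Omega p) : set (mspacetime R))
         (fun z => pu (U z) 0 i) /\
       measurable_fun (cyl p (Omega p) : set (mspacetime R))
         (fun z => pv (U z) 0 i)),
    (forall i j,
       measurable_fun (cyl p (Omega p) : set (mspacetime R))
         (fun z => pE (U z) i j) /\
       measurable_fun (cyl p (Omega p) : set (mspacetime R))
         (fun z => pW (U z) i j)) &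
    (@leb4 R).-integrable (cyl p (Omega p))
      (fun z => (bulk p c z (U z) (jet_of D z))%:E)]].

Definition dual_density (R : realType) (p : problem R) (c : chosen R)
    (z : spacetime R) (J : jet R) : R :=
  bulk p c z (dtp p c z J) J.

(* one half of the second derivative of the density with respect to the
   gradient slots, in the direction [g]: its polarization gives the
   coefficients of the second derivatives in the Euler-Lagrange system *)
Definition principal_form (R : realType) (p : problem R) (c : chosen R)
    (z : spacetime R) (J : jet R) (g : gradient R) : R :=
  2^-1 * derive1n 2 (fun e : R => dual_density p c z (J.1, J.2 + e *: g)) 0.

Definition elliptic_form (R : realType) (p : problem R) (c : chosen R)
    (D : spacetime R -> dual_val R) : R :=
  2^-1 * \int[@leb4 R]_(z in cyl p (Omega p))
    (let: (Dt, Dx) := grad D z in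
     \sum_(i < 3) (gam Dt i + \sum_(j < 3) mu (Dx j) i j) ^+ 2
     + rho p z.1 ^+ 2 / rfield c z.1 * \sum_(i < 3) lam Dt i ^+ 2
     + \sum_(i < 3) \sum_(j < 3) \sum_(k < 3) \sum_(l < 3)
         lam (Dx j) i
         * mul4 (mul4 (moduli p z.1) (inv4 (Afield c z)))
                (tr4 (moduli p z.1)) i j k l
         * lam (Dx l) k).

(* Main.v *)
Require Import Defs.
From HB Require Import structures.
From mathcomp Require Import all_boot all_order all_algebra.
From mathcomp Require Import all_classical all_reals all_analysis.
From mathcomp Require Import measurable_realfun ring lra.
Require Import Defs.

Set Implicit Arguments.
Unset Strict Implicit.
Unset Printing Implicit Defensive.

Import Order.TTheory GRing.Theory Num.Theory.
Import numFieldNormedType.Exports.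

Local Open Scope classical_set_scope.
Local Open Scope ring_scope.

(** For fixed dual fields [D] the integrand of the pre-dual functional is, at every
    point, a linear form in the value of [U] minus the quadratic potential.  The
    coefficients of the linear form, called loads here, are linear in the jet of
    [D].  The DtP state is the base state plus the loads divided by the Hessian of
    the potential, and completing the square ([bulk_defect]) shows that the
    integrand is its value at the DtP state minus half a quadratic form in the
    distance to that state.  The value at the DtP state is itself a quadratic
    polynomial in the jet of [D], whose quadratic part [dform] is the inverse
    Hessian applied to the loads.  Everything follows from these two facts.
    The moduli and the density occur in the loads only, so the sign of [dform] is
    that of the potential alone.

    If [A] and [r] are positive, so are the Hessian and its inverse.  The DtP
    fields then maximize the integrand pointwise ([dual_functional_sup]), the dual
    functional has a nonnegative quadratic part along every line
    ([dual_functional_convex]), and that quadratic form, restricted to the gradient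
    slots of the jet, is the form claimed to be degenerate elliptic
    ([principal_form_integral], [elliptic_form_ge0]).

    For the Euler-Lagrange system, [dual_functional_expansion] gives the first
    variation: it pairs the DtP fields with the loads of the test field, and the
    variation of the DtP fields themselves does not contribute.  Integration by
    parts, with Gauss-Green in space and the fundamental theorem of calculus in
    time, turns it into the sum of the pairings of the test field with the
    residuals of the equations, of the initial conditions and of the two boundary
    conditions ([first_variationE]); the constraints on the test fields remove
    exactly the boundary fluxes for which there is no datum.  So the primal system
    implies stationarity.  Conversely, test fields that are a bump times a constant
    isolate each residual in turn ([bulk_res_eq0_ocyl], [init_res_eq0],
    [traction_res_eq0], [disp_res_eq0]).  The displacement residual comes multiplied
    by the unit normal, which can be removed, and the one of the initial velocity
    by the density, which can be removed where it is not zero and, by continuity,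
    on the closure of that set ([weighted_velocity]).

    Two technical points shape the development.  Integrating by parts requires the
    DtP fields to be C^1 up to the boundary, hence regularity of the inverse of
    [A]; it comes from Cramer's rule for a 9 x 9 matrix that extends [A] by the
    identity on skew tensors ([Ck_near_inv4]).  And the domain may be unbounded:
    all integrands have bounded spatial support, and are integrable because they
    are bounded and measurable on a set of finite measure. *)

(** * Calculus of C^k maps *)

Section CkTheory.
Variables (R : realType) (V : normedModType R).
Implicit Types (U : set V).

Lemma Ck_continuous (W : normedModType R) k U (f : V -> W) :
  Ck k U f -> forall x, U x -> {for x, continuous f}.
Proof. by case: k => [|k] [] . Qed.

Lemma Ck_derivable (W : normedModType R) k U (f : V -> W) :
  Ck k.+1 U f -> forall v x, U x -> derivable f x v.
Proof. by move=> [_ h] v x Ux; exact: (h v).1. Qed.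

Lemma Ck_derive (W : normedModType R) k U (f : V -> W) :
  Ck k.+1 U f -> forall v, Ck k U ('D_v f).
Proof. by move=> [_ h] v; exact: (h v).2. Qed.

Lemma eq_on_near (W : normedModType R) U (f g : V -> W) :
  open U -> (forall x, U x -> f x = g x) ->
  forall x, U x -> \near x, f x = g x.
Proof. by move=> oU fg x Ux; apply: filterS fg _; exact: open_nbhs_nbhs. Qed.

Lemma eq_on_continuous (W : normedModType R) U (f g : V -> W) :
  open U -> (forall x, U x -> f x = g x) ->
  forall x, U x -> {for x, continuous f} -> {for x, continuous g}.
Proof.
move=> oU fg x Ux cf.
have h := eq_on_near oU fg Ux.
rewrite /prop_for /continuous_at -(fg _ Ux).
apply: cvg_trans cf; apply: near_eq_cvg.
by apply: filterS h => y ->.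
Qed.

Lemma eq_on_derivable (W : normedModType R) U (f g : V -> W) v :
  open U -> (forall x, U x -> f x = g x) ->
  forall x, U x -> derivable f x v -> derivable g x v.
Proof.
by move=> oU fg x Ux; apply: near_eq_derivable; exact: eq_on_near fg x Ux.
Qed.

(** Openness of the set turns pointwise equality into equality near each point,
    so that it passes to all derivatives. *)
Lemma eq_Ck (W : normedModType R) k U (f g : V -> W) :
  open U -> (forall x, U x -> f x = g x) -> Ck k U f -> Ck k U g.
Proof.
move=> oU; elim: k f g => [|k IH] f g fg [cf hf].
  by split=> // x Ux; exact: (eq_on_continuous oU fg Ux (cf x Ux)).
split=> [x Ux|v]; first exact: (eq_on_continuous oU fg Ux (cf x Ux)).
split=> [x Ux|]; first exact: (eq_on_derivable oU fg Ux ((hf v).1 x Ux)).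
apply: (IH ('D_v f)); last exact: (hf v).2.
by move=> x Ux; apply: near_eq_derive; exact: eq_on_near fg x Ux.
Qed.

Lemma sub_Ck (W : normedModType R) k U U' (f : V -> W) :
  U' `<=` U -> Ck k U f -> Ck k U' f.
Proof.
move=> UU; elim: k f => [|k IH] f [cf hf].
  by split=> // x /UU; exact: cf.
split=> [x /UU|v]; first exact: cf.
by split=> [x /UU|]; [exact: (hf v).1|exact: IH (hf v).2].
Qed.

Lemma CkW (W : normedModType R) k U (f : V -> W) : Ck k.+1 U f -> Ck k U f.
Proof.
elim: k f => [|k IH] f [cf hf]; first by split.
by split=> // v; split; [exact: (hf v).1|exact: IH (hf v).2].
Qed.

Lemma Ck_cst (W : normedModType R) k U (a : W) : Ck k U (fun _ => a).
Proof.
elim: k a => [|k IH] a; first by split=> // x _; exact: cst_continuous.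
split=> [x _|v]; first exact: cst_continuous.
split=> [x _|]; first exact: derivable_cst.
rewrite (_ : 'D_v _ = fun=> 0)//.
by apply/funext => x; exact: derive_cst.
Qed.

Lemma CkD (W : normedModType R) k U (f g : V -> W) : open U ->
  Ck k U f -> Ck k U g -> Ck k U (fun x => f x + g x).
Proof.
move=> oU; elim: k f g => [|k IH] f g [cf hf] [cg hg].
  by split=> // x Ux; apply: cvgD; [exact: cf|exact: cg].
split=> [x Ux|v]; first by apply: cvgD; [exact: cf|exact: cg].
have [df Df] := hf v; have [dg Dg] := hg v.
split=> [x Ux|]; first by apply: derivableD; [exact: df|exact: dg].
apply: (eq_Ck oU _ (IH _ _ Df Dg)) => x Ux.
by rewrite (deriveD (df x Ux) (dg x Ux)).
Qed.

Lemma CkM k U (f g : V -> R) : open U ->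
  Ck k U f -> Ck k U g -> Ck k U (fun x => f x * g x).
Proof.
move=> oU; elim: k f g => [|k IH] f g Cf Cg.
  have [cf _] := Cf; have [cg _] := Cg.
  by split=> // x Ux; apply: cvgM; [exact: cf|exact: cg].
have [cf hf] := Cf; have [cg hg] := Cg.
split=> [x Ux|v]; first by apply: cvgM; [exact: cf|exact: cg].
have [df Df] := hf v; have [dg Dg] := hg v.
split=> [x Ux|]; first by apply: derivableM; [exact: df|exact: dg].
apply: (eq_Ck oU _ (CkD oU (IH _ _ (CkW Cf) Dg) (IH _ _ (CkW Cg) Df))) => x Ux.
by rewrite (deriveM (df x Ux) (dg x Ux)).
Qed.

Lemma is_derive_lin (W W' : normedModType R) (L : {linear W -> W'}) (f : V -> W) v x :
  continuous L -> derivable f x v ->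
  is_derive x v (fun x => L (f x)) (L ('D_v f x)).
Proof.
move=> cL df.
have H : (fun h : R => h^-1 *: (((fun x => L (f x)) \o shift x) (h *: v)
    - L (f x))) @ 0^' --> L ('D_v f x).
  rewrite (_ : (fun h : R => _) = L \o
      (fun h : R => h^-1 *: ((f \o shift x) (h *: v) - f x))); last first.
    by apply/funext => h /=; rewrite linearZ_LR (linearB L).
  exact: (cvg_comp _ _ df (cL _)).
by apply: DeriveDef; [apply/cvg_ex; exists (L ('D_v f x))|exact: cvg_lim H].
Qed.

Lemma Ck_lin (W W' : normedModType R) (L : {linear W -> W'}) k U (f : V -> W) :
  open U -> continuous L -> Ck k U f -> Ck k U (fun x => L (f x)).
Proof.
move=> oU cL; elim: k f => [|k IH] f [cf hf].
  by split=> // x Ux; exact: (@continuous_comp _ _ _ f L x (cf x Ux) (cL _)).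
split=> [x Ux|v].
  exact: (@continuous_comp _ _ _ f L x (cf x Ux) (cL _)).
have [df Df] := hf v; have E x Ux := is_derive_lin cL (df x Ux).
split=> [x Ux|]; first by have [] := E x Ux.
apply: (eq_Ck oU _ (IH _ Df)) => x Ux.
by have [_ ->] := E x Ux.
Qed.

Lemma CkZ k U (c : R) (f : V -> R) : open U ->
  Ck k U f -> Ck k U (fun x => c * f x).
Proof. by move=> oU; apply: CkM => //; exact: Ck_cst. Qed.

Lemma CkN k U (f : V -> R) : open U -> Ck k U f -> Ck k U (fun x => - f x).
Proof.
move=> oU Cf; apply: (eq_Ck oU _ (CkZ (-1) oU Cf)) => x _.
by rewrite mulN1r.
Qed.

Lemma CkB k U (f g : V -> R) : open U ->
  Ck k U f -> Ck k U g -> Ck k U (fun x => f x - g x).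
Proof. by move=> oU Cf Cg; apply: CkD => //; exact: CkN. Qed.

Lemma Ck_sum I (r : seq I) (P : pred I) k U (f : I -> V -> R) : open U ->
  (forall i, Ck k U (f i)) -> Ck k U (fun x => \sum_(i <- r | P i) f i x).
Proof.
move=> oU Cf; rewrite (_ : (fun x => _) = \sum_(i <- r | P i) f i); last first.
  by apply/funext => x; rewrite fct_sumE.
elim/big_rec: _ => [|i g _ Cg]; first exact: Ck_cst.
exact: CkD.
Qed.

Lemma Ck_prod I (r : seq I) (P : pred I) k U (f : I -> V -> R) : open U ->
  (forall i, Ck k U (f i)) -> Ck k U (fun x => \prod_(i <- r | P i) f i x).
Proof.
move=> oU Cf; elim: r => [|i r IH].
  by apply: (eq_Ck oU _ (@Ck_cst _ k U (1 : R))) => x _; rewrite big_nil.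
case: (boolP (P i)) => Pi.
  by apply: (eq_Ck oU _ (CkM oU (Cf i) IH)) => x _; rewrite big_cons Pi.
by apply: (eq_Ck oU _ IH) => x _; rewrite big_cons (negPf Pi).
Qed.

(** By induction on the order: the derivative of [1 / f] is again polynomial in
    [1 / f] and the derivative of [f]. *)
Lemma CkV k U (f : V -> R) : open U -> (forall x, U x -> f x != 0) ->
  Ck k U f -> Ck k U (fun x => (f x)^-1).
Proof.
move=> oU f0; elim: k f f0 => [|k IH] f f0 Cf.
  have [cf _] := Cf.
  by split=> // x Ux; apply: cvgV; [exact: f0|exact: cf].
have [cf hf] := Cf.
split=> [x Ux|v]; first by apply: cvgV; [exact: f0|exact: cf].
have [df Df] := hf v.
split=> [x Ux|]; first by apply: derivableV; [exact: f0|exact: df].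
have Vf := IH f f0 (CkW Cf).
apply: (eq_Ck oU _ (CkM oU (CkN oU (CkM oU Vf Vf)) Df)) => x Ux.
by rewrite (deriveV (f0 x Ux) (df x Ux)) expr2 invfM.
Qed.

(** Determinants and adjugates are polynomials in the entries; by Cramer's rule
    matrix inversion inherits the regularity of the matrix. *)
Lemma Ck_det n k U (M : V -> 'M[R]_n) : open U ->
  (forall i j, Ck k U (fun x => M x i j)) -> Ck k U (fun x => \det (M x)).
Proof.
move=> oU CM; rewrite /determinant; apply: Ck_sum => // s.
by apply: CkM => //; [exact: Ck_cst|exact: Ck_prod].
Qed.

Lemma Ck_adj n k U (M : V -> 'M[R]_n) : open U ->
  (forall i j, Ck k U (fun x => M x i j)) ->
  forall i j, Ck k U (fun x => \adj (M x) i j).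
Proof.
move=> oU CM i j.
apply: (eq_Ck oU (f := fun x => cofactor (M x) j i)).
  by move=> x _; rewrite mxE.
apply: CkM => //; first exact: Ck_cst.
apply: Ck_det => // i' j'.
by apply: (eq_Ck oU _ (CM (lift j i') (lift i j'))) => x _; rewrite !mxE.
Qed.

End CkTheory.

Section CkNear.
Variables (R : realType) (V : normedModType R) (K : set V).

Lemma Ck_near_derive (W : normedModType R) k (f : V -> W) v :
  Ck_near k.+1 K f -> Ck_near k K ('D_v f).
Proof. by move=> [U [oU KU Cf]]; exists U; split=> //; exact: Ck_derive Cf _. Qed.

Lemma Ck_near_W (W : normedModType R) k (f : V -> W) :
  Ck_near k.+1 K f -> Ck_near k K f.
Proof. by move=> [U [oU KU CU]]; exists U; split=> //; exact: CkW. Qed.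

Lemma Ck_near_cst (W : normedModType R) k (a : W) : Ck_near k K (fun _ : V => a).
Proof. by exists setT; split=> //; [exact: openT|exact: Ck_cst]. Qed.

Lemma Ck_near_lin (W W' : normedModType R) (L : {linear W -> W'}) k (f : V -> W) :
  continuous L -> Ck_near k K f -> Ck_near k K (fun z => L (f z)).
Proof. by move=> cL [U [oU KU CU]]; exists U; split=> //; exact: Ck_lin. Qed.

Lemma Ck_near_N k (f : V -> R) : Ck_near k K f -> Ck_near k K (fun z => - f z).
Proof. by move=> [U [oU KU Cf]]; exists U; split=> //; exact: CkN. Qed.

Lemma Ck_near_binop (W W' W2 : normedModType R) k (f : V -> W) (g : V -> W')
    (h : V -> W2) :
  (forall U, open U -> Ck k U f -> Ck k U g -> Ck k U h) ->
  Ck_near k K f -> Ck_near k K g -> Ck_near k K h.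
Proof.
move=> fgh [U [oU KU Cf]] [U' [oU' KU' Cg]]; exists (U `&` U').
have oI : open (U `&` U') by exact: openI.
split=> //; first by move=> z Kz; split; [exact: KU|exact: KU'].
by apply: fgh => //; [apply: sub_Ck Cf => z []|apply: sub_Ck Cg => z []].
Qed.

Lemma Ck_near_D (W : normedModType R) k (f g : V -> W) : Ck_near k K f ->
  Ck_near k K g -> Ck_near k K (fun z => f z + g z).
Proof. by apply: Ck_near_binop => U; exact: CkD. Qed.

Lemma Ck_near_M k (f g : V -> R) : Ck_near k K f -> Ck_near k K g ->
  Ck_near k K (fun z => f z * g z).
Proof. by apply: Ck_near_binop => U; exact: CkM. Qed.

Lemma Ck_near_V k (f : V -> R) : (forall z, K z -> f z != 0) ->
  Ck_near k K f -> Ck_near k K (fun z => (f z)^-1).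
Proof.
move=> f0 [U [oU KU Cf]]; exists (U `&` [set z | f z != 0]).
have oU' : open (U `&` [set z | f z != 0]).
  rewrite openE => z [Uz dz]; rewrite /interior.
  have n0 : nbhs (f z) [set y : R | y != 0].
    by apply: open_nbhs_nbhs; split => //; exact: open_neq.
  apply: filterI; first exact: open_nbhs_nbhs.
  exact: (Ck_continuous Cf Uz n0).
split=> //; first by move=> z Kz; split; [exact: KU|exact: f0].
by apply: CkV => //; [move=> z []|apply: sub_Ck Cf => z []].
Qed.

Lemma Ck_near_common (I : finType) k (f : I -> V -> R) : (forall i, Ck_near k K (f i)) ->
  exists U, [/\ open U, K `<=` U & forall i, Ck k U (f i)].
Proof.
move=> Cf.
have [U [oU KU CU]] : exists U, [/\ open U, K `<=` U &
    forall i, i \in enum I -> Ck k U (f i)].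
  elim: (enum I) => [|i s [U [oU KU CU]]].
    by exists setT; split => //; exact: openT.
  have [V' [oV KV CV]] := Cf i; exists (U `&` V'); split.
  - exact: openI.
  - by move=> z Kz; split; [exact: KU|exact: KV].
  - move=> j; rewrite inE => /predU1P[->|/CU CU'].
      by apply: sub_Ck CV => z [].
    by apply: sub_Ck CU' => z [].
by exists U; split => // i; apply: CU; rewrite mem_enum.
Qed.

Lemma Ck_near_sum (I : finType) k (f : I -> V -> R) :
  (forall i, Ck_near k K (f i)) -> Ck_near k K (fun z => \sum_i f i z).
Proof.
move=> Cf; have [U [oU KU CU]] := Ck_near_common Cf.
by exists U; split=> //; exact: Ck_sum.
Qed.

End CkNear.

(** * Bump functions on space-time *)

Section Slices.
Variable R : realType.

Lemma fst_continuous (V W : normedModType R) : continuous (@fst V W).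
Proof. by move=> z; exact: cvg_fst. Qed.

Lemma snd_continuous (V W : normedModType R) : continuous (@snd V W).
Proof. by move=> z; exact: cvg_snd. Qed.

Lemma Ck_id (V : normedModType R) k (U : set V) : Ck k U id.
Proof.
case: k => [|k]; first by split=> // x _; exact: cvg_id.
split=> [x _|v]; first exact: cvg_id.
split=> [x _|]; first exact: derivable_id.
rewrite (_ : 'D_v _ = fun=> v); first exact: Ck_cst.
by apply/funext => x; exact: derive_id.
Qed.

Lemma Ck_fst (V W : normedModType R) k (U : set (V * W)) : open U ->
  Ck k U fst.
Proof.
move=> oU; exact: (@Ck_lin R (V * W)%type (V * W)%type V fst k U id oU
  (@fst_continuous V W) (Ck_id k U)).
Qed.

Lemma Ck_snd (V W : normedModType R) k (U : set (V * W)) : open U ->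
  Ck k U snd.
Proof.
move=> oU; exact: (@Ck_lin R (V * W)%type (V * W)%type W snd k U id oU
  (@snd_continuous V W) (Ck_id k U)).
Qed.

End Slices.

Section Bump.
Variable R : realType.

(** A power of the positive part is a polynomial substitute for the usual
    exponential cut-off: [pospow n] is of class C^k for all [k < n], and C^2 is
    all that a dual field needs. *)
Definition pospow (n : nat) (s : R) : R := (Num.max s 0) ^+ n.

Lemma pospow_ge0 n s : 0 <= pospow n s.
Proof. by rewrite exprn_ge0// le_max lexx orbT. Qed.

Lemma pospow_gt0 n s : 0 < s -> 0 < pospow n s.
Proof. by move=> s0; rewrite exprn_gt0// lt_max s0. Qed.

Lemma pospow_eq0 n s : s <= 0 -> pospow n.+1 s = 0.
Proof. by move=> s0; rewrite /pospow max_r// expr0n. Qed.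

Lemma pospow_continuous n : continuous (pospow n).
Proof.
move=> s; have cm : {for s, continuous (fun s : R => Num.max s 0)}.
  by apply: (continuous_max (f := id) (g := cst 0)) => //; exact: cvg_cst.
exact: (@continuous_comp _ _ _ _ (fun x : R => x ^+ n) s cm (@exprn_continuous _ n _)).
Qed.

Lemma is_derive_pospow n (s : R) :
  is_derive s (1 : R) (pospow n.+2) (n.+2%:R * pospow n.+1 s).
Proof.
have [s0|s0|s0] := ltgtP 0 s.
- have -> : n.+2%:R * pospow n.+1 s = n.+2%:R *: s ^+ n.+2.-1.
    by rewrite /pospow max_l ?ltW.
  apply: (near_eq_is_derive _ (f := @GRing.exp R ^~ n.+2)).
    have : (\near s, 0 < s) by exact: lt_nbhsr.
    by apply: filterS => y y0; rewrite /pospow max_l ?ltW.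
  apply: DeriveDef; first exact: exprn_derivable.
  by rewrite exp_derive scaler1.
- rewrite pospow_eq0 ?ltW// mulr0.
  have H : is_derive s (1 : R) (fun=> 0 : R) 0.
    by apply: DeriveDef; [exact: derivable_cst|exact: derive_cst].
  apply: near_eq_is_derive H.
  have : (\near s, s < 0) by exact: lt_nbhsl.
  by apply: filterS => y y0; rewrite pospow_eq0 ?ltW.
(* at the origin the difference quotient is itself a power of positive part *)
rewrite -s0 pospow_eq0// mulr0.
have H : (fun h : R => h^-1 *: ((pospow n.+2 \o shift 0) (h *: 1)
      - pospow n.+2 0)) @ 0^' --> (0 : R).
  have c := @pospow_continuous n.+1 0.
  rewrite /continuous_at pospow_eq0// in c.
  have c' : (fun h : R => pospow n.+1 h) @ 0^' --> (0 : R).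
    by move=> A /c; exact: nbhs_dnbhs.
  apply: cvg_trans c'; apply: near_eq_cvg.
  near=> h; rewrite /= addr0 (pospow_eq0 _ (lexx 0)) subr0 [h *: 1]mulr1.
  have h0 : h != 0 by near: h; exact: nbhs_dnbhs_neq.
  have [hp|hn] := ltP 0 h.
    by rewrite /pospow max_l ?ltW// [h ^+ n.+2]exprS [_ *: _]mulrA mulVf// mul1r.
  by rewrite !pospow_eq0// scaler0.
by apply: DeriveDef; [apply/cvg_ex; exists 0|exact: cvg_lim H].
Unshelve. all: by end_near. Qed.

Lemma derive_line (V : normedModType R) (q : V -> R) x v :
  'D_(1 : R) (fun h : R => q (h *: v + x)) 0 = 'D_v q x.
Proof.
rewrite /derive; set g1 := fun h => h^-1 *: _; set g2 := fun h => h^-1 *: _.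
suff -> : g1 = g2 by [].
by rewrite funeqE /g1 /g2 => h /=; rewrite addr0 scale0r add0r [h *: 1]mulr1.
Qed.

Lemma Ck_pospow (V : normedModType R) k n (U : set V) (q : V -> R) :
  open U -> (k < n)%N -> Ck k U q -> Ck k U (fun x => pospow n (q x)).
Proof.
move=> oU; elim: k n => [|k IH] n kn Cq.
  by split=> // x Ux; exact: (@continuous_comp _ _ _ q _ x (Ck_continuous Cq Ux)
    (@pospow_continuous n _)).
split=> [x Ux|v].
  exact: (@continuous_comp _ _ _ q _ x (Ck_continuous Cq Ux)
    (@pospow_continuous n _)).
case: n kn => [//|[//|n]] kn.
have D x : U x ->
    is_derive x v (fun x => pospow n.+2 (q x))
      (n.+2%:R * pospow n.+1 (q x) * 'D_v q x).
  move=> Ux.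
  have dq := Ck_derivable Cq (v := v) Ux.
  have dq' : is_derive (0 : R) (1 : R) (fun h : R => q (h *: v + x)) ('D_v q x).
    apply: DeriveDef; first exact: ((derivable1P q x v).1 dq).
    exact: derive_line.
  have dc : is_derive (0 : R) (1 : R) (pospow n.+2 \o (fun h : R => q (h *: v + x)))
      (n.+2%:R * pospow n.+1 (q x) * 'D_v q x).
    apply: is_derive1_comp; rewrite scale0r add0r.
    exact: is_derive_pospow.
  have [d1 d2] := dc.
  apply: DeriveDef; first exact: ((derivable1P _ x v).2 d1).
  by rewrite -d2 -derive_line.
split=> [x Ux|]; first by have [] := D x Ux.
apply: (eq_Ck oU _ (CkM oU (CkZ n.+2%:R oU (IH n.+1 _ (CkW Cq)))
  (Ck_derive Cq v))) => //.
by move=> x Ux; have [_ ->] := D x Ux.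
Qed.

Definition coord (c : 'I_4) (z : spacetime R) : R :=
  [:: z.1.1.1; z.1.1.2; z.1.2; z.2]`_c.

Lemma Ck_coord c k (U : set (spacetime R)) : open U -> Ck k U (coord c).
Proof.
move=> oU; have F : Ck k U (fun z : spacetime R => z.1) by exact: Ck_fst.
have FF : Ck k U (fun z : spacetime R => z.1.1).
  by apply: (Ck_lin oU _ F); exact: fst_continuous.
case: c => [[|[|[|[|//]]]] ?]; rewrite /coord/=.
- by apply: (Ck_lin oU _ FF); exact: fst_continuous.
- by apply: (Ck_lin oU _ FF); exact: snd_continuous.
- by apply: (Ck_lin oU _ F); exact: snd_continuous.
- exact: Ck_snd.
Qed.

(** Exponent 3 is the least that makes the product C^2; the support is a cube of
    space-time. *)
Definition bump (a : spacetime R) (d : R) (z : spacetime R) : R :=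
  \prod_(c < 4) pospow 3 (d ^+ 2 - (coord c z - coord c a) ^+ 2).

Lemma Ck_bump a d (U : set (spacetime R)) : open U -> Ck 2 U (bump a d).
Proof.
move=> oU; apply: Ck_prod => // c; apply: Ck_pospow => //.
apply: CkB => //; first exact: Ck_cst.
have H : Ck 2 U (fun z => coord c z - coord c a).
  by apply: CkB => //; [exact: Ck_coord|exact: Ck_cst].
by apply: (eq_Ck oU _ (CkM oU H H)) => x _; rewrite expr2.
Qed.

Lemma bump_ge0 a d z : 0 <= bump a d z.
Proof. by apply: prodr_ge0 => c _; exact: pospow_ge0. Qed.

Definition box (a : spacetime R) (d : R) : set (spacetime R) :=
  [set z | forall c, `|coord c z - coord c a| < d].

Lemma bump_gt0 a d z : box a d z -> 0 < bump a d z.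
Proof.
move=> h; apply: prodr_gt0 => c _; apply: pospow_gt0.
have hc := h c; have d0 : 0 <= d by exact: le_trans (ltW hc).
rewrite subr_gt0 -(real_normK (num_real (coord c z - coord c a))).
by rewrite ltr_sqr ?nnegrE.
Qed.

Lemma bump_eq0 a d z : 0 <= d -> ~ box a d z -> bump a d z = 0.
Proof.
move=> d0 /existsNP[c /negP]; rewrite -leNgt => hc.
rewrite /bump (bigD1 c)//= pospow_eq0 ?mul0r//.
rewrite subr_le0 -(real_normK (num_real (coord c z - coord c a))).
by rewrite ler_sqr ?nnegrE.
Qed.

Lemma nbhs_box (a : spacetime R) (U : set (spacetime R)) :
  nbhs a U -> exists2 d, 0 < d & box a d `<=` U.
Proof.
move=> /nbhs_ballP[d /= d0 dU]; exists d => // z bz; apply: dU.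
have := bz ord0; have := bz (inord 1); have := bz (inord 2).
have := bz (inord 3); rewrite /coord !inordK//= => b3 b2 b1 b0.
by do 3 (split; last by rewrite /ball/= distrC); rewrite /ball/= distrC.
Qed.

Lemma boxE (a : spacetime R) d : box a d =
  (((ball a.1.1.1 d `*` ball a.1.1.2 d) `*` ball a.1.2 d) `*` ball a.2 d).
Proof.
apply/seteqP; split=> z.
  move=> bz; have := bz ord0; have := bz (inord 1); have := bz (inord 2).
  have := bz (inord 3); rewrite /coord !inordK//= => b3 b2 b1 b0.
  by do 3 (split; last by rewrite /ball/= distrC); rewrite /ball/= distrC.
rewrite /ball/= => -[[[b0 b1] b2] b3] [[|[|[|[|//]]]] ?];
  by rewrite /coord/= distrC.
Qed.

End Bump.

(** * Measurability and integrability of continuous functions *)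

Section Measurability.
Variable R : realType.

Lemma measurable_box (a : spacetime R) d :
  measurable (box a d : set (mspacetime R)).
Proof.
rewrite boxE; apply: measurableX; last exact: measurable_ball.
apply: measurableX; last exact: measurable_ball.
by apply: measurableX; exact: measurable_ball.
Qed.

(** Open sets of space-time are countable unions of rational boxes, hence
    belong to the product sigma-algebra. *)
Lemma open_measurable_spacetime (U : set (spacetime R)) :
  open U -> measurable (U : set (mspacetime R)).
Proof.
move=> oU.
pose rbox (q : (rat * rat * rat * rat) * rat) : set (spacetime R) :=
  box (ratr q.1.1.1.1 : R, ratr q.1.1.1.2 : R, ratr q.1.1.2 : R,
       ratr q.1.2 : R) (ratr q.2).
pose F q : set (spacetime R) := if `[< rbox q `<=` U >] then rbox q else set0.
have -> : U = \bigcup_q F q.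
  apply/seteqP; split=> [a Ua|a [q _]]; last first.
    by rewrite /F; case: asboolP => // h; exact: h.
  have [d d0 dU] := nbhs_box (open_nbhs_nbhs (conj oU Ua)).
  have d2 : 0 < d / 2 by rewrite divr_gt0.
  have [r] := rat_in_itvoo d2; rewrite in_itv/= => /andP[r0 rd].
  have P (x : R) : exists q : rat, `|x - ratr q| < ratr r :> R.
    have xr : x - ratr r < x + ratr r by rewrite ltrD2l gtrN.
    have [q] := rat_in_itvoo xr; rewrite in_itv/= => hq.
    by exists q; rewrite distrC ltr_distl.
  have [q0 h0] := P a.1.1.1; have [q1 h1] := P a.1.1.2.
  have [q2 h2] := P a.1.2; have [q3 h3] := P a.2.
  exists (q0, q1, q2, q3, r) => //.
  rewrite /F; case: asboolP => [_|h].
    by rewrite /rbox boxE/ball/= ![`|ratr _ - _|]distrC.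
  exfalso; apply: h => z; rewrite /= /rbox boxE/ball/= => -[[[z0 z1] z2] z3].
  apply: dU; rewrite boxE /ball/=.
  have T (x y c : R) : `|x - c| < ratr r -> `|c - y| < ratr r -> `|x - y| < d.
    move=> xc cy; rewrite -(subrKA c) (le_lt_trans (ler_normD _ _))//.
    by rewrite (lt_trans (ltrD xc cy))// (splitr d) ltrD.
  by split; [split; [split|]|]; apply: T; eassumption.
apply: countable_bigcupT_measurable; first exact: countableP.
by move=> q; rewrite /F; case: ifP => _; [exact: measurable_box|].
Qed.

Lemma open_measurable_space (U : set (space R)) :
  open U -> measurable (U : set (mspace R)).
Proof.
move=> oU.
have oU4 : open ((@fst (space R) R) @^-1` U).
  by apply: open_comp => // z _; exact: fst_continuous.
have := measurable_ysection (0 : R) (open_measurable_spacetime oU4).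
rewrite (_ : ysection _ _ = U)//.
by apply/seteqP; split=> x /=; rewrite /ysection/= inE.
Qed.

Lemma closed_measurable_space (U : set (space R)) :
  closed U -> measurable (U : set (mspace R)).
Proof.
by move=> /closed_openC/open_measurable_space/measurableC; rewrite setCK.
Qed.

(** The measurable and the topological space-time are different structures on one
    carrier, so the statement keeps [T] and [S] apart; [g] is the identity in
    both applications. *)
Lemma within_continuous_measurable d (T : measurableType d)
    (S : topologicalType) (g : T -> S) (D : set S) (f : S -> R) :
  (forall U, open U -> measurable (g @^-1` U)) -> measurable (g @^-1` D) ->
  {within D, continuous f} -> measurable_fun (g @^-1` D) (f \o g).
Proof.
move=> mo mD /continuousP cf.
apply: (measurability _ (RGenOpens.measurableE R)).
move=> _ [_ [a [b ->] <-]].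
have /open_subspaceP[V oV VD] := cf _ (interval_open (a := BRight a) (b := BLeft b) isT isT).
rewrite (_ : _ `&` _ = g @^-1` V `&` g @^-1` D).
  by apply: measurableI => //; exact: mo.
have E x : (V x /\ D x) <-> ((f @^-1` `]a, b[) x /\ D x).
  by have := congr1 (fun A => A x) VD; rewrite /setI/= => ->.
apply/seteqP; split=> x /=.
  by move=> [Dx fx]; have [] := (E (g x)).2 (conj fx Dx).
by move=> [Vx Dx]; have [] := (E (g x)).1 (conj Vx Dx).
Qed.

Lemma within_measurable_space (D : set (space R)) (f : space R -> R) :
  measurable (D : set (mspace R)) -> {within D, continuous f} ->
  measurable_fun (D : set (mspace R)) f.
Proof.
by move=> mD cf; exact: (@within_continuous_measurable _ (mspace R) (space R)
  id D f open_measurable_space mD cf).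
Qed.

Lemma within_measurable_spacetime (D : set (spacetime R))
    (f : spacetime R -> R) :
  measurable (D : set (mspacetime R)) -> {within D, continuous f} ->
  measurable_fun (D : set (mspacetime R)) f.
Proof.
by move=> mD cf; exact: (@within_continuous_measurable _ (mspacetime R)
  (spacetime R) id D f open_measurable_spacetime mD cf).
Qed.

End Measurability.

Section Integrability.
Variable R : realType.

(** The only integrability criterion of the proof: all integrands are bounded
    and live on a set of finite measure. *)
Lemma bounded_support_integrable d (T : measurableType d)
    (m : {measure set T -> \bar R}) (A B : set T) (f : T -> R) (N : R) :
  measurable A -> measurable B -> (m (A `&` B) < +oo)%E ->
  measurable_fun A f ->
  (forall x, A x -> B x -> `|f x| <= N) ->
  (forall x, A x -> ~ B x -> f x = 0) ->
  m.-integrable A (EFin \o f).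
Proof.
move=> mA mB fin mf fN f0.
have mAB : measurable (A `&` B) by exact: measurableI.
have : m.-integrable (A `&` B) (EFin \o f).
  apply: measurable_bounded_integrable => //.
    by apply: measurable_funS mf => //; exact: subIsetl.
  exists N; split; first exact: num_real.
  by move=> x Nx y [Ay By] /=; exact: (le_trans (fN y Ay By) (ltW Nx)).
move=> /(integrable_mkcond _ mAB) h.
apply/(integrable_mkcond _ mA); rewrite (_ : _ \_ _ = (EFin \o f) \_ (A `&` B))//.
apply/funext => x; rewrite /patch in_setI.
case: (boolP (x \in A)) => //= /set_mem Ax.
by case: (boolP (x \in B)) => //= /negP xB; rewrite f0// => Bx; apply: xB; rewrite inE.
Qed.

Definition cube (M : R) : set (space R) := [set x | `|x| <= M].

Lemma cubeE M : cube M =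
  ((`[- M, M]%classic `*` `[- M, M]%classic) `*` `[- M, M]%classic).
Proof.
apply/seteqP; split=> [[[x y] z]|[[x y] z]] /=;
  rewrite /cube/= !prod_normE/= !ge_max/= !ler_norml !in_itv/=.
  by move=> /andP[/andP[-> ->] ->].
by move=> [[-> ->] ->].
Qed.

Lemma measurable_cube M : measurable (cube M : set (mspace R)).
Proof.
rewrite cubeE; apply: measurableX; last exact: measurable_itv.
by apply: measurableX; exact: measurable_itv.
Qed.

Lemma leb3_cube M : (@leb3 R (cube M) < +oo)%E.
Proof.
have I : (@lebesgue_measure R `[(- M)%R, M%R]%classic < +oo)%E.
  by rewrite lebesgue_measure_itv/=; case: ifP => // _; rewrite -EFinB ltry.
have m1 : measurable (`[- M, M]%classic : set (measurableTypeR R)).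
  exact: measurable_itv.
have I2 : (@leb2 R (`[(- M)%R, M%R]%classic `*` `[(- M)%R, M%R]%classic) < +oo)%E.
  by rewrite /leb2 product_measure1E// lte_mul_pinfty// ge0_fin_numE.
rewrite cubeE /leb3 product_measure1E//; last exact: measurableX.
by rewrite lte_mul_pinfty// ge0_fin_numE.
Qed.

Lemma closed_cube M : closed (cube M).
Proof.
apply: (preimage_closed _ (@closed_le _ M)) => y _; exact: norm_continuous.
Qed.

Lemma compact_cube M : compact (cube M).
Proof.
rewrite cubeE; apply: compact_setX; last exact: segment_compact.
by apply: compact_setX; exact: segment_compact.
Qed.

Lemma compact_within_bounded (T : topologicalType) (K : set T) (f : T -> R) :
  compact K -> {within K, continuous f} -> exists N, forall x, K x -> `|f x| <= N.
Proof.
move=> cK cf.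
have [M [_ hM]] := compact_bounded (continuous_compact cf cK).
exists (M + 1) => x Kx; apply: (hM (M + 1)); first by rewrite ltrDl.
by exists x.
Qed.

Section Within.
Variables (X : topologicalType) (A : set X).
Implicit Types f g : X -> R.

Lemma withinD f g : {within A, continuous f} -> {within A, continuous g} ->
  {within A, continuous (fun z => f z + g z)}.
Proof.
move=> /subspace_continuousP cf /subspace_continuousP cg.
by apply/subspace_continuousP => z Kz; apply: cvgD; [exact: cf|exact: cg].
Qed.

Lemma withinM f g : {within A, continuous f} -> {within A, continuous g} ->
  {within A, continuous (fun z => f z * g z)}.
Proof.
move=> /subspace_continuousP cf /subspace_continuousP cg.
by apply/subspace_continuousP => z Kz; apply: cvgM; [exact: cf|exact: cg].
Qed.

Lemma within_cst (a : R) : {within A, continuous (fun=> a)}.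
Proof. by move=> z; exact: cvg_cst. Qed.

Lemma withinB f g : {within A, continuous f} -> {within A, continuous g} ->
  {within A, continuous (fun z => f z - g z)}.
Proof.
move=> /subspace_continuousP cf /subspace_continuousP cg.
by apply/subspace_continuousP => z Kz; apply: cvgB; [exact: cf|exact: cg].
Qed.

Lemma within_sum I (r : seq I) (P : pred I) (f : I -> X -> R) :
  (forall i, {within A, continuous (f i)}) ->
  {within A, continuous (fun z => \sum_(i <- r | P i) f i z)}.
Proof.
move=> cf; rewrite (_ : (fun z => _) = \sum_(i <- r | P i) f i); last first.
  by apply/funext => x; rewrite fct_sumE.
elim/big_rec: _ => [|i g _ cg]; first exact: within_cst.
exact: withinD.
Qed.

Lemma within_entry (f : X -> vec R) i :
  {within A, continuous f} -> {within A, continuous (fun z => f z 0 i)}.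
Proof.
move=> cf z; apply: (@continuous_comp _ _ _ (f : subspace _ -> _) (fun v : vec R => v 0 i)).
  exact: cf.
exact: coord_continuous.
Qed.

End Within.

(** Lets conditions imposed on open cylinders reach the closed ones, where the
    integrals are taken. *)
Lemma within_closure_eq0 (T : topologicalType) (K S : set T) (f : T -> R) z :
  {within K, continuous f} -> K z -> S `<=` K -> closure S z ->
  (forall y, S y -> f y = 0) -> f z = 0.
Proof.
move=> /subspace_continuousP cf Kz SK Sz f0.
apply/eqP/negPn/negP => fz0.
have h : nbhs (f z) [set y : R | y != 0].
  apply: open_nbhs_nbhs; split=> //; exact: open_neq.
have := cf z Kz _ h; rewrite /fmap/= /within/= => hz.
have [y [Sy /= hy]] := Sz _ hz.
by move/eqP: (hy (SK _ Sy) : f y != 0); rewrite f0.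
Qed.

End Integrability.

(** * Fubini, and the geometry of the space-time cylinder *)

Section IteratedIntegrals.
Context d1 d2 (T1 : measurableType d1) (T2 : measurableType d2) (R : realType).
Variables (m1 : {sigma_finite_measure set T1 -> \bar R})
  (m2 : {sigma_finite_measure set T2 -> \bar R}).
Variables (A : set T1) (I : set T2) (F : T1 * T2 -> R).
Hypotheses (mA : measurable A) (mI : measurable I).
Hypothesis iF : (m1 \x m2)%E.-integrable (A `*` I) (EFin \o F).

(* Fubini's theorem is stated on the whole product space *)
Let iF' : (m1 \x m2)%E.-integrable setT ((EFin \o F) \_ (A `*` I)).
Proof. exact: ((integrable_mkcond _ (measurableX mA mI)).1 iF). Qed.

(** Fubini for real-valued integrals: integrability of the slices keeps the inner
    integrals finite, so that taking real parts loses nothing. *)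
Lemma Rintegral_prod21 :
  (forall t, I t -> m1.-integrable A (EFin \o (fun x => F (x, t)))) ->
  \int[(m1 \x m2)%E]_(z in A `*` I) F z =
  \int[m2]_(t in I) \int[m1]_(x in A) F (x, t).
Proof.
move=> iA; rewrite /Rintegral; congr fine.
rewrite integral_mkcond -integral21_prod_meas1// [RHS]integral_mkcond.
apply: eq_integral => t _; rewrite /fubini_G /patch.
case: ifPn => tI.
  rewrite fineK; last exact: (integrable_fin_num mA (iA t (set_mem tI))).
  by rewrite [RHS]integral_mkcond; apply: eq_integral => x _;
    rewrite /patch in_setX/= tI andbT.
by apply: integral0_eq => x _; rewrite in_setX/= (negPf tI) andbF.
Qed.

Lemma Rintegral_prod12 :
  (forall x, A x -> m2.-integrable I (EFin \o (fun t => F (x, t)))) ->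
  \int[(m1 \x m2)%E]_(z in A `*` I) F z =
  \int[m1]_(x in A) \int[m2]_(t in I) F (x, t).
Proof.
move=> iI; rewrite /Rintegral; congr fine.
rewrite integral_mkcond -integral12_prod_meas1// [RHS]integral_mkcond.
apply: eq_integral => x _; rewrite /fubini_F /patch.
case: ifPn => xA.
  rewrite fineK; last exact: (integrable_fin_num mI (iI x (set_mem xA))).
  by rewrite [RHS]integral_mkcond; apply: eq_integral => t _;
    rewrite /patch in_setX/= xA.
by apply: integral0_eq => t _; rewrite in_setX/= (negPf xA).
Qed.

End IteratedIntegrals.

Section Geometry.
Variables (R : realType) (p : problem R).
Hypothesis hp : regular_problem p.

Local Notation T := (horizon p).
Local Notation K := (cyl p (closure (Omega p))).
Local Notation dom := (prb_domain hp).

Let T0 : 0 < T. Proof. exact: prb_horizon. Qed.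

Lemma closed_bdry : closed (bdry (Omega p)).
Proof.
rewrite /bdry setDE; apply: closedI; first exact: closed_closure.
exact/open_closedC/open_interior.
Qed.

Lemma bdry_closure : bdry (Omega p) `<=` closure (Omega p).
Proof. exact: subDsetl. Qed.

Lemma Gs_bdry : Gs p `<=` bdry (Omega p).
Proof. by have [V [_ ->]] := dom_Gs_open dom; exact: subIsetr. Qed.

Lemma Gu_bdry : Gu p `<=` bdry (Omega p).
Proof. by have [V [_ ->]] := dom_Gu_open dom; exact: subIsetr. Qed.

Lemma measurable_Omega : measurable (Omega p : set (mspace R)).
Proof. exact: (open_measurable_space (dom_open dom)). Qed.

Lemma measurable_bdry : measurable (bdry (Omega p) : set (mspace R)).
Proof. exact: (closed_measurable_space closed_bdry). Qed.

Lemma measurable_Gs : measurable (Gs p : set (mspace R)).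
Proof.
have [V [oV ->]] := dom_Gs_open dom.
by apply: measurableI; [exact: open_measurable_space|exact: measurable_bdry].
Qed.

Lemma measurable_Gu : measurable (Gu p : set (mspace R)).
Proof.
have [V [oV ->]] := dom_Gu_open dom.
by apply: measurableI; [exact: open_measurable_space|exact: measurable_bdry].
Qed.

Lemma measurable_cyl (G : set (space R)) : measurable (G : set (mspace R)) ->
  measurable (cyl p G : set (mspacetime R)).
Proof. by move=> mG; apply: measurableX => //; exact: measurable_itv. Qed.

Lemma ocyl_cyl G : ocyl p G `<=` cyl p G.
Proof. by move=> [x t] [/= Gx tT]; split=> //=; exact: subset_itv_oo_cc. Qed.

Lemma cylS G G' : G `<=` G' -> cyl p G `<=` cyl p G'.
Proof. by move=> GG [x t] [/= /GG Gx tT]. Qed.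

Lemma cyl_Omega_K : cyl p (Omega p) `<=` K.
Proof. by apply: cylS; exact: subset_closure. Qed.

Lemma cyl_bdry_K G : G `<=` bdry (Omega p) -> cyl p G `<=` K.
Proof. by move=> h; apply: cylS => x /h/bdry_closure. Qed.

Lemma closed_K : closed K.
Proof.
have -> : K = (fst @^-1` closure (Omega p)) `&` (snd @^-1` `[0, T]%classic) by [].
apply: closedI.
  apply: (preimage_closed _ (@closed_closure _ (Omega p))) => y _.
  exact: fst_continuous.
apply: (preimage_closed _ (@interval_closed R (BLeft 0) (BRight T) isT isT)) => y _.
exact: snd_continuous.
Qed.

Lemma open_ocyl : open (ocyl p (Omega p)).
Proof.
have -> : ocyl p (Omega p) = (fst @^-1` Omega p) `&` (snd @^-1` `]0, T[%classic) by [].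
apply: openI.
  apply: open_comp (dom_open dom) => y _; exact: fst_continuous.
apply: open_comp (interval_open (a := BRight 0) (b := BLeft T) isT isT) => y _.
exact: snd_continuous.
Qed.

(** Any time in [[0, T]] is reached by shrinking towards the middle time [T / 2]. *)
Lemma closure_ocyl G z : cyl p G z -> closure (ocyl p G) z.
Proof.
case: z => x t [/= Gx]; rewrite in_itv/= => /andP[t0 tT] B /nbhs_box[d d0 dB].
(* the ratio of shrinking; it moves the time by less than [d] *)
pose s := Num.min 1 (d / T).
have s0 : 0 < s by rewrite lt_min ltr01/= divr_gt0.
have s1 : s <= 1 by rewrite ge_min lexx.
have sd : s * T <= d by rewrite -ler_pdivlMr// ge_min lexx orbT.
have sT : 0 < s * T by exact: mulr_gt0.
have st : 0 <= s * t by rewrite mulr_ge0// ltW.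
have sTt : 0 <= s * (T - t) by rewrite mulr_ge0 ?subr_ge0// ltW.
have st1 : 0 <= (1 - s) * t by rewrite mulr_ge0 ?subr_ge0.
have sT1 : 0 <= (1 - s) * (T - t) by rewrite mulr_ge0 ?subr_ge0.
exists (x, t + (T / 2 - t) * s); split; first split => //=.
  by rewrite in_itv/=; apply/andP; split; lra.
apply: dB; rewrite boxE /ball/= !subrr normr0; do !split => //=.
rewrite opprD addrA subrr sub0r normrN ltr_norml; apply/andP; split; lra.
Qed.

Lemma K_closure_ocyl z : K z -> closure (ocyl p (Omega p)) z.
Proof.
case: z => x t [/= Kx tT] B Bz.
have [[P Q] /= [Px Qt] PQ] : nbhs (x, t) (interior B) by exact: nbhs_interior.
have [x' [Ox' Px']] := Kx _ Px.
have B' : nbhs (x', t) B by apply: (PQ (x', t)); split=> //=; exact: nbhs_singleton.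
exact: (@closure_ocyl (Omega p) (x', t) (conj Ox' tT) B B').
Qed.

(** Together, [cts] and [van] make a function integrable over the cylinder even
    when the domain is unbounded. *)
Definition cts (f : spacetime R -> R) : Prop := {within K, continuous f}.

Definition van (f : spacetime R -> R) : Prop :=
  exists M : R, forall z, K z -> M < `|z.1| -> f z = 0.

Lemma ctsD f g : cts f -> cts g -> cts (fun z => f z + g z).
Proof. exact: withinD. Qed.

Lemma ctsM f g : cts f -> cts g -> cts (fun z => f z * g z).
Proof. exact: withinM. Qed.

Lemma cts_cst a : cts (fun=> a).
Proof. exact: within_cst. Qed.

Lemma ctsB f g : cts f -> cts g -> cts (fun z => f z - g z).
Proof. exact: withinB. Qed.

Lemma eq_cts f g : (forall z, K z -> f z = g z) -> cts f -> cts g.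
Proof. by move=> fg; apply: subspace_eq_continuous => z /set_mem; exact: fg. Qed.

Lemma cts_sum I (r : seq I) (P : pred I) (f : I -> spacetime R -> R) :
  (forall i, cts (f i)) -> cts (fun z => \sum_(i <- r | P i) f i z).
Proof. exact: within_sum. Qed.

Lemma Ck_near_cts k f : Ck_near k K f -> cts f.
Proof.
move=> [U [oU KU Cf]]; apply: continuous_in_subspaceT => z /set_mem /KU.
exact: Ck_continuous Cf _.
Qed.

Lemma vanD f g : van f -> van g -> van (fun z => f z + g z).
Proof.
move=> [M Mf] [N Ng]; exists (Num.max M N) => z Kz; rewrite gt_max => /andP[h k].
by rewrite Mf// Ng// addr0.
Qed.

Lemma vanMl f g : van f -> van (fun z => f z * g z).
Proof. by move=> [M Mf]; exists M => z Kz h; rewrite Mf// mul0r. Qed.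

Lemma vanMr f g : van g -> van (fun z => f z * g z).
Proof. by move=> [M Mf]; exists M => z Kz h; rewrite Mf// mulr0. Qed.

Lemma vanN f : van f -> van (fun z => - f z).
Proof. by move=> [M Mf]; exists M => z Kz h; rewrite Mf// oppr0. Qed.

Lemma van_sum I (r : seq I) (P : pred I) (f : I -> spacetime R -> R) :
  (forall i, van (f i)) -> van (fun z => \sum_(i <- r | P i) f i z).
Proof.
move=> vf; rewrite (_ : (fun z => _) = \sum_(i <- r | P i) f i); last first.
  by apply/funext => x; rewrite fct_sumE.
by elim/big_rec: _ => [|i g _ cg]; [exists 0|exact: vanD].
Qed.

Lemma eq_van f g : (forall z, K z -> f z = g z) -> van f -> van g.
Proof. by move=> fg [M Mf]; exists M => z Kz h; rewrite -fg// Mf. Qed.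

(** [K] is the closure of the open cylinder, and the open set [P] localizes the
    argument. *)
Lemma cts_eq0 (P : set (spacetime R)) f : open P -> cts f ->
  (forall z, ocyl p (Omega p) z -> P z -> f z = 0) ->
  forall z, K z -> P z -> f z = 0.
Proof.
move=> oP cf f0 z Kz Pz.
apply: (within_closure_eq0 (S := ocyl p (Omega p) `&` P) cf Kz).
- by move=> y [/ocyl_cyl/cyl_Omega_K].
- move=> B Bz; have BP : nbhs z (B `&` P) by apply: filterI => //; exact: open_nbhs_nbhs.
  by have [y [? [? ?]]] := K_closure_ocyl Kz BP; exists y.
- by move=> y [oy Py]; exact: f0.
Qed.

Lemma open_far (M : R) : open [set z : spacetime R | M < `|z.1|].
Proof.
apply: (@open_comp _ _ (fun z : spacetime R => `|z.1|) [set y | M < y]).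
  move=> z _; apply: (@continuous_comp _ _ _ fst (fun x : space R => `|x|)).
    exact: fst_continuous.
  exact: norm_continuous.
exact: open_gt.
Qed.

(** At a boundary point of [K] the function is known to vanish on one side only: the
    derivative is computed at interior points and extended by continuity. *)
Lemma van_derive f v : Ck_near 1 K f -> van f -> van ('D_v f).
Proof.
move=> [U [oU KU Cf]] [M Mf]; exists M.
apply: cts_eq0; first exact: open_far.
  by apply: (@Ck_near_cts 0); exists U; split=> //; exact: (Ck_derive Cf).
move=> z oz zM.
have -> : 'D_v f z = 'D_v (cst 0) z.
  apply: near_eq_derive.
  have oN : open (ocyl p (Omega p) `&` [set z | M < `|z.1|]).
    by apply: openI; [exact: open_ocyl|exact: open_far].
  apply: filterS (open_nbhs_nbhs (conj oN (conj oz zM))) => y [oy yM].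
  by apply: Mf => //; exact/cyl_Omega_K/ocyl_cyl.
exact: derive_cst.
Qed.

End Geometry.

(** * Integrable functions on the cylinder and on its boundary *)

Section Integration.
Variables (R : realType) (p : problem R).
Hypothesis hp : regular_problem p.

Local Notation T := (horizon p).
Local Notation K := (cyl p (closure (Omega p))).
Local Notation dom := (prb_domain hp).
Local Notation cts := (cts p).
Local Notation van := (van p).

Let T0 : 0 < T. Proof. exact: prb_horizon. Qed.
Let mI : measurable (`[0, T]%classic : set (measurableTypeR R)).
Proof. exact: measurable_itv. Qed.
Let mO := measurable_Omega hp.
Let mGs := measurable_Gs hp.
Let mGu := measurable_Gu hp.
Let mcyl := @measurable_cyl R p.

Lemma lebI : (@lebesgue_measure R `[0%R, T]%classic < +oo)%E.
Proof. by rewrite lebesgue_measure_itv/=; case: ifP => // _; rewrite -EFinB ltry. Qed.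

Lemma measure_cyl_cube (m : {sigma_finite_measure set (mspace R) -> \bar R})
    (G : set (space R)) M : measurable (G : set (mspace R)) ->
  (m (G `&` cube M) < +oo)%E ->
  ((m \x @lebesgue_measure R)%E
     ((cyl p G : set (mspacetime R)) `&` (cube M `*` setT)) < +oo)%E.
Proof.
move=> mG fin.
rewrite (_ : _ `&` _ = (G `&` cube M) `*` `[0, T]%classic); last first.
  by apply/seteqP; split=> -[x t] /=; rewrite /cyl/=; tauto.
have mGM : measurable (G `&` cube M : set (mspace R)).
  by apply: measurableI => //; exact: measurable_cube.
by rewrite product_measure1E// lte_mul_pinfty ?ge0_fin_numE// lebI.
Qed.

Lemma cube_bounded f M : cts f ->
  exists N, forall z, K z -> `|z.1| <= M -> `|f z| <= N.
Proof.
move=> cf.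
have cK : compact (K `&` (cube M `*` `[0, T]%classic)).
  apply: subclosed_compact (@subIsetr _ _ _).
    apply: closedI; first exact: closed_K.
    by apply: compact_closed; [exact: norm_hausdorff|];
      apply: compact_setX; [exact: compact_cube|exact: segment_compact].
  by apply: compact_setX; [exact: compact_cube|exact: segment_compact].
have [N hN] := compact_within_bounded cK (continuous_subspaceW (@subIsetl _ _ _) cf).
by exists N => z Kz zM; apply: hN; split=> //; split => //; case: Kz.
Qed.

Lemma cyl_integrable f : cts f -> van f ->
  (@leb4 R).-integrable (cyl p (Omega p)) (EFin \o f).
Proof.
move=> cf [M Mf]; have [N hN] := cube_bounded M cf.
apply: (@bounded_support_integrable R _ (mspacetime R) (@leb4 R)
  (cyl p (Omega p)) (cube M `*` setT) f N).
- exact: mcyl.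
- by apply: measurableX => //; exact: measurable_cube.
- apply: measure_cyl_cube => //; apply: le_lt_trans (leb3_cube M).
  by apply: le_measure; rewrite ?inE//; [apply: measurableI => //|];
    exact: measurable_cube.
- apply: within_measurable_spacetime; first exact: mcyl.
  by apply: continuous_subspaceW cf; exact: cyl_Omega_K.
- by move=> z /cyl_Omega_K Kz [zM _]; exact: hN.
- move=> z /cyl_Omega_K Kz zM; apply: Mf => //; rewrite ltNge.
  by apply/negP => h; apply: zM.
Qed.

Lemma slice_within f t G : G `<=` closure (Omega p) -> `[0, T]%classic t ->
  cts f -> {within G, continuous (fun x => f (x, t))}.
Proof.
move=> GO tT /subspace_continuousP cf; apply/subspace_continuousP => x Gx.
have ct : {for x, continuous (fun y : space R => (y, t))}.
  move=> B [[P Q] /= [Px Qt] PQ]; apply: filterS Px => y Py.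
  by apply: (PQ (y, t)); split=> //=; exact: nbhs_singleton.
move=> B hB; have h := cf (x, t) (conj (GO _ Gx) tT) B hB.
rewrite /fmap/= /within/= in h *.
have : nbhs x [set y : space R | K (y, t) -> B (f (y, t))] by exact: (ct _ h).
by apply: filterS => y hy Gy; apply: hy; split => //; exact: GO.
Qed.

Lemma init_integrable (f : space R -> R) :
  {within closure (Omega p), continuous f} ->
  (exists M : R, forall x, closure (Omega p) x -> M < `|x| -> f x = 0) ->
  (@leb3 R).-integrable (Omega p) (EFin \o f).
Proof.
move=> cf [M Mf].
have cK : compact (closure (Omega p) `&` cube M).
  apply: subclosed_compact (@subIsetr _ _ _); last exact: compact_cube.
  by apply: closedI; [exact: closed_closure|exact: closed_cube].
have [N hN] := compact_within_bounded cK (continuous_subspaceW (@subIsetl _ _ _) cf).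
apply: (@bounded_support_integrable R _ (mspace R) (@leb3 R)
  (Omega p) (cube M) f N) => //.
- exact: measurable_cube.
- apply: le_lt_trans (leb3_cube M).
  by apply: le_measure; rewrite ?inE//; [apply: measurableI => //|];
    exact: measurable_cube.
- apply: within_measurable_space => //.
  by apply: continuous_subspaceW cf; exact: subset_closure.
- by move=> x /subset_closure Kz zM; exact: hN.
- move=> x /subset_closure Kz zM; apply: Mf => //; rewrite ltNge.
  by apply/negP => h; apply: zM.
Qed.

(** The boundary data and the normal are continuous only along the relatively
    open parts, with no limit guaranteed at the interface; measurability and
    local bounds are what integration over the lateral boundary retains of them. *)
Definition bcoef (G : set (space R)) (f : spacetime R -> R) : Prop :=
  measurable_fun (cyl p G : set (mspacetime R)) f /\
  forall M, exists N, forall z, cyl p G z -> `|z.1| <= M -> `|f z| <= N.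

Lemma bcoefD G f g : bcoef G f -> bcoef G g -> bcoef G (fun z => f z + g z).
Proof.
move=> [mf bf] [mg bg]; split; first exact: measurable_funD.
move=> M; have [N hN] := bf M; have [N' hN'] := bg M; exists (N + N') => z Gz zM.
by rewrite (le_trans (ler_normD _ _))// lerD// ?hN ?hN'.
Qed.

Lemma bcoefM G f g : bcoef G f -> bcoef G g -> bcoef G (fun z => f z * g z).
Proof.
move=> [mf bf] [mg bg]; split; first exact: measurable_funM.
move=> M; have [N hN] := bf M; have [N' hN'] := bg M; exists (N * N') => z Gz zM.
by rewrite normrM ler_pM// ?hN ?hN'.
Qed.

Lemma bcoef_cst G a : bcoef G (fun=> a).
Proof. by split; [exact: measurable_cst|move=> M; exists `|a|]. Qed.

Lemma bcoef_sum G I (r : seq I) (f : I -> spacetime R -> R) :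
  (forall i, bcoef G (f i)) -> bcoef G (fun z => \sum_(i <- r) f i z).
Proof.
move=> cf; rewrite (_ : (fun z => _) = \sum_(i <- r) f i); last first.
  by apply/funext => x; rewrite fct_sumE.
elim/big_rec: _ => [|i g _ cg]; first exact: bcoef_cst.
exact: bcoefD.
Qed.

Lemma bcoef_cts G f : G `<=` bdry (Omega p) -> measurable (G : set (mspace R)) ->
  cts f -> bcoef G f.
Proof.
move=> Gb mG cf; split.
  apply: within_measurable_spacetime; first exact: mcyl.
  by apply: continuous_subspaceW cf; exact: cyl_bdry_K.
move=> M; have [N hN] := cube_bounded M cf; exists N => z Gz; apply: hN.
exact: cyl_bdry_K Gz.
Qed.

Lemma bcoef_data G (f : spacetime R -> vec R) i :
  measurable (G : set (mspace R)) ->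
  {within cyl p G, continuous f} -> loc_bounded (cyl p G) f ->
  bcoef G (fun z => f z 0 i).
Proof.
move=> mG cf bf; split.
  apply: within_measurable_spacetime; first exact: mcyl.
  exact: within_entry.
move=> M; have [N hN] := bf M; exists N => z Gz zM.
apply: le_trans (hN z Gz zM).
rewrite [leRHS]/Num.Def.normr/= mx_normrE.
exact: (le_bigmax _ (fun ij => `|f z ij.1 ij.2|) (0, i)).
Qed.

Lemma normal_within (G : set (space R)) j : G `<=` Gs p `|` Gu p ->
  {within cyl p G, continuous (fun z => normal p z.1 0 j)}.
Proof.
move=> GG.
have /subspace_continuousP cn : {within G, continuous (fun x => normal p x 0 j)}.
  exact: (within_entry (continuous_subspaceW GG (dom_normal_continuous dom))).
apply/subspace_continuousP => -[x t] [/= Gx tT] B hB.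
have := cn x Gx B hB; rewrite /fmap/= /within/= => h.
have h' : nbhs (x, t) (fst @^-1` [set y : space R | G y -> B (normal p y 0 j)]).
  exact: (@fst_continuous R _ _ (x, t) _ h).
by apply: filterS h' => -[y s] /= hy [/= Gy _]; exact: hy.
Qed.

Lemma bcoef_normal G j : G `<=` Gs p `|` Gu p -> measurable (G : set (mspace R)) ->
  bcoef G (fun z => normal p z.1 0 j).
Proof.
move=> GG mG.
have cn : {within G, continuous (fun x => normal p x 0 j)}.
  exact: (within_entry (continuous_subspaceW GG (dom_normal_continuous dom))).
split.
  have := within_measurable_space mG cn => mn.
  move=> mc B mB.
  rewrite (_ : _ `&` _ = (G `&` (fun x => normal p x 0 j) @^-1` B) `*` `[0, T]%classic).
    by apply: measurableX => //; exact: mn.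
  by apply/seteqP; split=> -[x t] /=; rewrite /cyl/=; tauto.
move=> M; exists 1 => -[x t] [/= /GG Gx tT] _.
have := dom_normal_unit dom Gx; rewrite (bigD1 j)//= => h.
rewrite -(expr_le1 (n := 2))// ?normr_ge0// real_normK ?num_real// -h lerDl.
by apply: sumr_ge0 => i _; exact: sqr_ge0.
Qed.

Lemma sigma_cube G M : G `<=` bdry (Omega p) -> measurable (G : set (mspace R)) ->
  (sigma p (G `&` cube M) < +oo)%E.
Proof.
move=> Gb mG; apply: le_lt_trans (dom_area_finite dom M).
apply: le_measure; rewrite ?inE//.
- by apply: measurableI => //; exact: measurable_cube.
- by apply: measurableI; [exact: measurable_bdry|exact: measurable_cube].
- by move=> x [/Gb].
Qed.

Lemma bdry_integrable G f : G `<=` bdry (Omega p) ->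
  measurable (G : set (mspace R)) -> bcoef G f ->
  (exists M : R, forall z, cyl p G z -> M < `|z.1| -> f z = 0) ->
  (sigma_dt (sigma p)).-integrable (cyl p G) (EFin \o f).
Proof.
move=> Gb mG [mf bf] [M Mf]; have [N hN] := bf M.
apply: (@bounded_support_integrable R _ (mspacetime R) (sigma_dt (sigma p))
  (cyl p G) (cube M `*` setT) f N).
- exact: mcyl.
- by apply: measurableX => //; exact: measurable_cube.
- by apply: measure_cyl_cube => //; exact: sigma_cube.
- exact: mf.
- by move=> z Gz [zM _]; exact: hN.
- move=> z Gz zM; apply: Mf => //; rewrite ltNge.
  by apply/negP => h; apply: zM.
Qed.

End Integration.

(** * Integration by parts on the cylinder *)

Section SliceDerivatives.
Variable R : realType.

Lemma derive_slice_space (W : normedModType R) (g : spacetime R -> W)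
    (v x : space R) t :
  'D_v (fun y => g (y, t)) x = 'D_(v, 0) g (x, t).
Proof.
rewrite /derive; set g1 := fun h => h^-1 *: _; set g2 := fun h => h^-1 *: _.
suff -> : g1 = g2 by [].
apply/funext => h; rewrite /g1 /g2 /=.
rewrite (_ : h *: (v, 0) + (x, t) = (h *: v + x, t))//.
by rewrite -[h *: (v, 0)]/(h *: v, h *: 0) scaler0 -[_ + _]/(_ + x, 0 + t) add0r.
Qed.

Lemma derivable_slice_space (W : normedModType R) (g : spacetime R -> W)
    (v x : space R) t :
  derivable g (x, t) (v, 0) -> derivable (fun y => g (y, t)) x v.
Proof.
rewrite /derivable; set g1 := fun h => h^-1 *: _; set g2 := fun h => h^-1 *: _.
suff -> : g1 = g2 by [].
apply/funext => h; rewrite /g1 /g2 /=.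
rewrite (_ : h *: (v, 0) + (x, t) = (h *: v + x, t))//.
by rewrite -[h *: (v, 0)]/(h *: v, h *: 0) scaler0 -[_ + _]/(_ + x, 0 + t) add0r.
Qed.

Lemma derive_slice_time (W : normedModType R) (g : spacetime R -> W)
    (x : space R) (t : R) :
  'D_(1 : R) (fun s => g (x, s)) t = 'D_(0, 1) g (x, t).
Proof.
rewrite /derive; set g1 := fun h => h^-1 *: _; set g2 := fun h => h^-1 *: _.
suff -> : g1 = g2 by [].
apply/funext => h; rewrite /g1 /g2 /=.
rewrite (_ : h *: (0, 1) + (x, t) = (x, h *: 1 + t))//.
by rewrite -[h *: (0, 1)]/(h *: 0, h *: 1) scaler0 -[_ + _]/(0 + x, _ + t) add0r.
Qed.

Lemma derivable_slice_time (W : normedModType R) (g : spacetime R -> W)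
    (x : space R) (t : R) :
  derivable g (x, t) (0, 1) -> derivable (fun s => g (x, s)) t (1 : R).
Proof.
rewrite /derivable; set g1 := fun h => h^-1 *: _; set g2 := fun h => h^-1 *: _.
suff -> : g1 = g2 by [].
apply/funext => h; rewrite /g1 /g2 /=.
rewrite (_ : h *: (0, 1) + (x, t) = (x, h *: 1 + t))//.
by rewrite -[h *: (0, 1)]/(h *: 0, h *: 1) scaler0 -[_ + _]/(0 + x, _ + t) add0r.
Qed.

Lemma pair_continuous_l (x : space R) (t : R) :
  {for x, continuous (fun y : space R => (y, t))}.
Proof.
move=> B [[P Q] /= [Px Qt] PQ]; apply: filterS Px => y Py.
by apply: (PQ (y, t)); split=> //=; exact: nbhs_singleton.
Qed.

Lemma pair_continuous_r (x : space R) (t : R) :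
  {for t, continuous (fun s : R => (x, s))}.
Proof.
move=> B [[P Q] /= [Px Qt] PQ]; apply: filterS Qt => y Py.
by apply: (PQ (x, y)); split=> //=; exact: nbhs_singleton.
Qed.

Lemma Ck_slice_space (W : normedModType R) k (U : set (spacetime R))
    (g : spacetime R -> W) t :
  Ck k U g -> Ck k [set x | U (x, t)] (fun x => g (x, t)).
Proof.
elim: k g => [|k IH] g [cg hg].
  split=> // x Ux; exact: (@continuous_comp _ _ _ (fun y : space R => (y, t)) g x
    (@pair_continuous_l x t) (cg _ Ux)).
split=> [x Ux|v].
  exact: (@continuous_comp _ _ _ (fun y : space R => (y, t)) g x
    (@pair_continuous_l x t) (cg _ Ux)).
have [dg Dg] := hg (v, 0); split=> [x Ux|].
  exact/derivable_slice_space/dg.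
rewrite (_ : 'D_v _ = fun x => 'D_(v, 0) g (x, t)); first exact: (IH ('D_(v, 0) g) Dg).
by apply/funext => x; exact: derive_slice_space.
Qed.

End SliceDerivatives.

Section GaussGreen.
Variables (R : realType) (p : problem R).
Hypothesis hp : regular_problem p.

Local Notation T := (horizon p).
Local Notation K := (cyl p (closure (Omega p))).
Local Notation dom := (prb_domain hp).
Local Notation cts := (cts p).
Local Notation van := (van p).
Local Notation I := (`[0, T]%classic : set (measurableTypeR R)).

Let T0 : 0 < T. Proof. exact: prb_horizon. Qed.
Let mI : measurable I.
Proof. exact: measurable_itv. Qed.
Let mO := measurable_Omega hp.
Let mGs := measurable_Gs hp.
Let mGu := measurable_Gu hp.
Let mcyl (G : set (space R)) : measurable (G : set (mspace R)) ->
  measurable (cyl p G : set (mspacetime R)).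
Proof. exact: measurable_cyl. Qed.

Let G := Gs p `|` Gu p.
Let mG : measurable (G : set (mspace R)). Proof. exact: (measurableU _ _ mGs mGu). Qed.
Let Gb : G `<=` bdry (Omega p).
Proof. by move=> x [/(Gs_bdry hp)|/(Gu_bdry hp)]. Qed.

Lemma van_slice f t : van f -> I t ->
  exists M : R, forall x, closure (Omega p) x -> M < `|x| -> f (x, t) = 0.
Proof. by move=> [M Mf] tT; exists M => x Ox xM; apply: Mf. Qed.

Lemma boundary_slice_integrable f t j : cts f -> van f -> I t ->
  (sigma p).-integrable G (EFin \o (fun x => f (x, t) * normal p x 0 j)).
Proof.
move=> cf vf tT.
have [mf bf] : bcoef p G (fun z => f z * normal p z.1 0 j).
  by apply: bcoefM; [exact: bcoef_cts|exact: bcoef_normal].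
have [M Mf] := van_slice vf tT; have [N hN] := bf M.
apply: (@bounded_support_integrable R _ (mspace R) (sigma p) G (cube M) _ N) => //.
- exact: measurable_cube.
- exact: sigma_cube.
- apply: within_measurable_space => //.
  apply: withinM.
    by apply: (slice_within (p := p)) => // x /Gb/bdry_closure.
  exact: (within_entry (dom_normal_continuous dom)).
- by move=> x Gx xM; exact: (hN (x, t)).
- move=> x Gx xM; rewrite Mf ?mul0r//; first exact/bdry_closure/Gb.
  by rewrite ltNge; apply/negP => h; apply: xM.
Qed.

(** Gauss-Green on every time slice, integrated over time by Fubini on both
    sides. *)
Lemma gauss_green_cyl g j : Ck_near 1 K g -> van g ->
  \int[@leb4 R]_(z in cyl p (Omega p)) ddx j g z =
  \int[sigma_dt (sigma p)]_(z in cyl p (Gs p)) (g z * normal p z.1 0 j) +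
  \int[sigma_dt (sigma p)]_(z in cyl p (Gu p)) (g z * normal p z.1 0 j).
Proof.
move=> Cg vg.
have cg : cts g by exact: Ck_near_cts Cg.
have cdg : cts (ddx j g) by apply: (@Ck_near_cts _ _ 0); exact: Ck_near_derive.
have vdg : van (ddx j g) by exact: van_derive.
have iG : (sigma_dt (sigma p)).-integrable (cyl p G)
    (EFin \o (fun z => g z * normal p z.1 0 j)).
  apply: bdry_integrable => //.
    by apply: bcoefM; [exact: bcoef_cts|exact: bcoef_normal].
  by have [M Mf] := vg; exists M => z Gz zM; rewrite Mf ?mul0r//; exact: cyl_bdry_K Gz.
rewrite -Rintegral_setU; first last.
- apply/disj_setPS => -[x t] /= [[xs _] [xu _]].
  by have := dom_parts_disjoint dom; rewrite -subset0 => /(_ x); apply.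
- rewrite (_ : _ `|` _ = cyl p G)//.
  by apply/seteqP; split=> -[x t] /=; rewrite /cyl/= /G/=; tauto.
- exact: mcyl.
- exact: mcyl.
rewrite (_ : cyl p (Gs p) `|` cyl p (Gu p) = G `*` I); last first.
  by apply/seteqP; split=> -[x t] /=; rewrite /cyl/= /G/=; tauto.
have -> : \int[@leb4 R]_(z in cyl p (Omega p)) ddx j g z =
    \int[@lebesgue_measure R]_(t in I) \int[@leb3 R]_(x in Omega p) ddx j g (x, t).
  apply: (@Rintegral_prod21 _ _ (mspace R) (measurableTypeR R) R (@leb3 R) (@lebesgue_measure R)
    (Omega p) I (ddx j g) mO mI).
    exact: cyl_integrable.
  move=> t tT; apply: init_integrable => //; last exact: van_slice.
  by apply: (slice_within (p := p)).
rewrite [RHS](@Rintegral_prod21 _ _ (mspace R) (measurableTypeR R) R (sigma p) (@lebesgue_measure R)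
    G I (fun z => g z * normal p z.1 0 j) mG mI iG); last first.
  by move=> t tT; exact: boundary_slice_integrable.
apply: eq_Rintegral => t /set_mem tT.
rewrite -(dom_gauss_green dom (f := fun x => g (x, t))).
- by apply: eq_Rintegral => x _; rewrite derive_slice_space.
- have [U [oU KU CU]] := Cg; exists [set x | U (x, t)]; split.
  + by apply: (@open_comp _ _ (fun y : space R => (y, t))) => // x _; exact: pair_continuous_l.
  + by move=> x Ox; apply: KU.
  + exact: Ck_slice_space.
- exact: van_slice.
Qed.

(** Fubini in the other order reduces to the fundamental theorem of calculus along
    the time fibre through each point. *)
Lemma time_integral g : Ck_near 1 K g -> van g ->
  \int[@leb4 R]_(z in cyl p (Omega p)) ddt g z =
  \int[@leb3 R]_(x in Omega p) (g (x, T) - g (x, 0)).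
Proof.
move=> Cg vg.
have cdg : cts (ddt g) by apply: (@Ck_near_cts _ _ 0); exact: Ck_near_derive.
have vdg : van (ddt g) by exact: van_derive.
have cI x : Omega p x -> {within I, continuous (fun t => ddt g (x, t))}.
  move=> Ox; apply/subspace_continuousP => t tT.
  move/subspace_continuousP : cdg => cdg.
  have Kxt : K (x, t) by split => //=; exact: subset_closure.
  move=> B hB; have h := cdg (x, t) Kxt B hB.
  rewrite /fmap/= /within/= in h *.
  have : nbhs t [set s : R | K (x, s) -> B (ddt g (x, s))].
    by exact: (@pair_continuous_r _ x t _ h).
  by apply: filterS => y hy Gy; apply: hy; split => //; exact: subset_closure.
have -> : \int[@leb4 R]_(z in cyl p (Omega p)) ddt g z =
    \int[@leb3 R]_(x in Omega p) \int[@lebesgue_measure R]_(t in I) ddt g (x, t).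
  apply: (@Rintegral_prod12 _ _ (mspace R) (measurableTypeR R) R (@leb3 R) (@lebesgue_measure R)
    (Omega p) I (ddt g) mO mI).
    exact: cyl_integrable.
  move=> x Ox; apply: continuous_compact_integrable; first exact: segment_compact.
  exact: cI.
apply: eq_Rintegral => x /set_mem Ox.
have [U [oU KU CU]] := Cg.
have Ux t : I t -> U (x, t) by move=> tT; apply: KU; split => //=; exact: subset_closure.
have cx t : I t -> {for t, continuous (fun t => g (x, t))}.
  move=> tT; exact: (@continuous_comp _ _ _ (fun s : R => (x, s)) g t
    (@pair_continuous_r _ x t) (Ck_continuous CU (Ux t tT))).
rewrite /Rintegral (@continuous_FTC2 _ _ (fun t => g (x, t)) 0 T)//.
- exact: cI.
- split.
  + move=> t /subset_itv_oo_cc tT; apply: derivable_slice_time.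
    exact: (Ck_derivable CU (Ux _ tT)).
  + apply: cvg_at_right_filter; apply: cx; rewrite /= in_itv/= lexx; exact: ltW.
  + apply: cvg_at_left_filter; apply: cx; rewrite /= in_itv/= lexx andbT; exact: ltW.
- by move=> t _; rewrite derive1E derive_slice_time.
Qed.

End GaussGreen.

(** * Tensor algebra *)

Section Tensors.
Variable R : realType.
Implicit Types (M N E F X : ten R) (A B C : ten4 R) (u w : vec R).

Definition dotv u w : R := \sum_(i < 3) u 0 i * w 0 i.
Definition frob M N : R := \sum_(i < 3) \sum_(j < 3) M i j * N i j.

Lemma dotvC u w : dotv u w = dotv w u.
Proof. by apply: eq_bigr => i _; rewrite mulrC. Qed.

Lemma dotvDl u u' w : dotv (u + u') w = dotv u w + dotv u' w.
Proof. by rewrite -big_split; apply: eq_bigr => i _; rewrite mxE mulrDl. Qed.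

Lemma dotvZl a u w : dotv (a *: u) w = a * dotv u w.
Proof. by rewrite mulr_sumr; apply: eq_bigr => i _; rewrite mxE mulrA. Qed.

Lemma dotvNl u w : dotv (- u) w = - dotv u w.
Proof. by rewrite -scaleN1r dotvZl mulN1r. Qed.

Lemma dotvDr u w w' : dotv u (w + w') = dotv u w + dotv u w'.
Proof. by rewrite dotvC dotvDl !(dotvC u). Qed.

Lemma dotvZr a u w : dotv u (a *: w) = a * dotv u w.
Proof. by rewrite dotvC dotvZl dotvC. Qed.

Lemma dotvNr u w : dotv u (- w) = - dotv u w.
Proof. by rewrite dotvC dotvNl dotvC. Qed.

Lemma frobC M N : frob M N = frob N M.
Proof. by apply: eq_bigr => i _; apply: eq_bigr => j _; rewrite mulrC. Qed.

Lemma frobDl M M' N : frob (M + M') N = frob M N + frob M' N.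
Proof.
rewrite -big_split; apply: eq_bigr => i _; rewrite -big_split.
by apply: eq_bigr => j _; rewrite mxE mulrDl.
Qed.

Lemma frobZl a M N : frob (a *: M) N = a * frob M N.
Proof.
rewrite mulr_sumr; apply: eq_bigr => i _; rewrite mulr_sumr.
by apply: eq_bigr => j _; rewrite mxE mulrA.
Qed.

Lemma frobNl M N : frob (- M) N = - frob M N.
Proof. by rewrite -scaleN1r frobZl mulN1r. Qed.

Lemma frobDr M N N' : frob M (N + N') = frob M N + frob M N'.
Proof. by rewrite frobC frobDl !(frobC M). Qed.

Lemma frobZr a M N : frob M (a *: N) = a * frob M N.
Proof. by rewrite frobC frobZl frobC. Qed.

Lemma frobNr M N : frob M (- N) = - frob M N.
Proof. by rewrite frobC frobNl frobC. Qed.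

Lemma frobT M N : frob M^T N^T = frob M N.
Proof.
by rewrite /frob exchange_big; apply: eq_bigr => i _; apply: eq_bigr => j _; rewrite !mxE.
Qed.

Lemma frob_sym E M : E^T = E -> frob E (sym M) = frob E M.
Proof.
move=> sE; rewrite /sym frobZr frobDr -[frob E M^T]frobT trmxK sE.
by field.
Qed.

Lemma frob_skew E M : E^T = - E -> frob E (skew M) = frob E M.
Proof.
move=> sE; rewrite /skew frobZr frobDr frobNr -[frob E M^T]frobT trmxK sE frobNl.
by field.
Qed.

Lemma symT M : (sym M)^T = sym M.
Proof. by rewrite /sym linearZ/= linearD/= trmxK addrC. Qed.

Lemma skewT M : (skew M)^T = - skew M.
Proof. by rewrite /skew linearZ/= linearB/= trmxK -scalerN opprB. Qed.

Lemma sym_id M : M^T = M -> sym M = M.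
Proof. by move=> h; rewrite /sym h; apply/matrixP => i j; rewrite !mxE; field. Qed.

Lemma symD M N : sym (M + N) = sym M + sym N.
Proof. by rewrite /sym [(M + N)^T]linearD/= addrACA scalerDr. Qed.

Lemma symZ a M : sym (a *: M) = a *: sym M.
Proof. by rewrite /sym [(a *: M)^T]linearZ/= -scalerDr !scalerA mulrC. Qed.

Lemma skewD M N : skew (M + N) = skew M + skew N.
Proof. by rewrite /skew [(M + N)^T]linearD/= opprD addrACA scalerDr. Qed.

Lemma skewZ a M : skew (a *: M) = a *: skew M.
Proof. by rewrite /skew [(a *: M)^T]linearZ/= -scalerBr !scalerA mulrC. Qed.

Lemma dotv0l u : dotv 0 u = 0.
Proof. by apply: big1 => i _; rewrite mxE mul0r. Qed.

Lemma frob0l M : frob 0 M = 0.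
Proof. by apply: big1 => i _; apply: big1 => j _; rewrite mxE mul0r. Qed.

Lemma dotv_ge0 u : 0 <= dotv u u.
Proof. by apply: sumr_ge0 => i _; rewrite -expr2 sqr_ge0. Qed.

Lemma frob_ge0 M : 0 <= frob M M.
Proof. by do 2 (apply: sumr_ge0 => ? _); rewrite -expr2 sqr_ge0. Qed.

Lemma act4D A M N : act4 A (M + N) = act4 A M + act4 A N.
Proof.
apply/matrixP => i j; rewrite !mxE -big_split; apply: eq_bigr => k _.
by rewrite -big_split; apply: eq_bigr => l _; rewrite mxE mulrDr.
Qed.

Lemma act4Z A a M : act4 A (a *: M) = a *: act4 A M.
Proof.
apply/matrixP => i j; rewrite !mxE mulr_sumr; apply: eq_bigr => k _.
by rewrite mulr_sumr; apply: eq_bigr => l _; rewrite mxE mulrCA.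
Qed.

Lemma act4N A M : act4 A (- M) = - act4 A M.
Proof. by rewrite -scaleN1r act4Z scaleN1r. Qed.

Lemma act4_sum A I (r : seq I) (F : I -> ten R) :
  act4 A (\sum_(i <- r) F i) = \sum_(i <- r) act4 A (F i).
Proof.
elim/big_rec2: _ => [|i y x _ <-]; last by rewrite act4D.
by rewrite -(scale0r 0) act4Z !scale0r.
Qed.

Lemma exchange4 (F : 'I_3 -> 'I_3 -> 'I_3 -> 'I_3 -> R) :
  \sum_i \sum_j \sum_k \sum_l F i j k l = \sum_k \sum_l \sum_i \sum_j F i j k l.
Proof.
under eq_bigr do rewrite exchange_big.
rewrite exchange_big; apply: eq_bigr => k _ /=.
by under eq_bigr do rewrite exchange_big; rewrite exchange_big.
Qed.

Lemma frob_act4 A E F : frob E (act4 A F) =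
  \sum_i \sum_j \sum_k \sum_l E i j * A i j k l * F k l.
Proof.
apply: eq_bigr => i _; apply: eq_bigr => j _; rewrite mxE mulr_sumr.
by apply: eq_bigr => k _; rewrite mulr_sumr; apply: eq_bigr => l _; rewrite mulrA.
Qed.

Lemma frob_act4_tr A E F : frob (act4 (tr4 A) E) F = frob E (act4 A F).
Proof.
rewrite frobC !frob_act4 exchange4; do 4 (apply: eq_bigr => ? _).
by rewrite /tr4; ring.
Qed.

Lemma act4_major A E F : major_symmetric A ->
  frob (act4 A E) F = frob E (act4 A F).
Proof.
move=> sA; rewrite -frob_act4_tr; congr (frob _ F); apply/matrixP => i j.
by rewrite !mxE; apply: eq_bigr => k _; apply: eq_bigr => l _; rewrite /tr4 sA.
Qed.

Lemma act4_mul4 A B M : act4 (mul4 A B) M = act4 A (act4 B M).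
Proof.
apply/matrixP => i j; rewrite !mxE.
transitivity (\sum_(k < 3) \sum_(l < 3) \sum_(r < 3) \sum_(m < 3)
    A i j r m * (B r m k l * M k l)).
  apply: eq_bigr => k _; apply: eq_bigr => l _; rewrite /mul4 mulr_suml.
  by apply: eq_bigr => r _; rewrite mulr_suml; apply: eq_bigr => m _; rewrite mulrA.
rewrite exchange4; apply: eq_bigr => r _; apply: eq_bigr => m _.
rewrite mxE mulr_sumr; apply: eq_bigr => k _.
by rewrite mulr_sumr.
Qed.

Lemma act4_symT A M : minor_symmetric A -> (act4 A M)^T = act4 A M.
Proof.
move=> sA; apply/matrixP => i j; rewrite !mxE; apply: eq_bigr => k _.
by apply: eq_bigr => l _; rewrite (sA j i k l).1.
Qed.

Lemma act4_trT C M : minor_symmetric C -> (act4 (tr4 C) M)^T = act4 (tr4 C) M.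
Proof.
move=> sC; apply/matrixP => i j; rewrite !mxE; apply: eq_bigr => k _.
by apply: eq_bigr => l _; rewrite /tr4 (sC k l j i).2.
Qed.

Lemma matrix_delta_sum M : M = \sum_i \sum_j M i j *: delta_mx i j.
Proof. exact: matrix_sum_delta. Qed.

Section Inverse.
Variable A : ten4 R.
Hypothesis iA : invertible_on_sym A.

Lemma inv4_slice m n :
  let E := \matrix_(r < 3, s < 3) inv4 A r s m n in
  E^T = E /\ act4 A E = sym (delta_mx m n).
Proof.
have [E [hE _]] := iA (symT (delta_mx m n)).
have := @xgetI _ 0 [set E : ten R | E^T = E /\ act4 A E = sym (delta_mx m n)] E hE.
rewrite /= (_ : \matrix_(r, s) _ = xget 0 [set E : ten R |
  E^T = E /\ act4 A E = sym (delta_mx m n)])//.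
by apply/matrixP => r s; rewrite mxE.
Qed.

Lemma act4_inv4E X : act4 (inv4 A) X =
  \sum_m \sum_n X m n *: \matrix_(r < 3, s < 3) inv4 A r s m n.
Proof.
apply/matrixP => r s; rewrite !mxE summxE; apply: eq_bigr => m _.
by rewrite summxE; apply: eq_bigr => n _; rewrite !mxE mulrC.
Qed.

Lemma act4_inv4_sym X : (act4 (inv4 A) X)^T = act4 (inv4 A) X.
Proof.
rewrite act4_inv4E linear_sum; apply: eq_bigr => m _.
rewrite linear_sum; apply: eq_bigr => n _; rewrite linearZ/=.
by rewrite (inv4_slice m n).1.
Qed.

(** [inv4] is specified on the symmetrized basis tensors only; every symmetric
    tensor is a combination of those. *)
Lemma act4_inv4K X : X^T = X -> act4 A (act4 (inv4 A) X) = X.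
Proof.
move=> sX; rewrite act4_inv4E act4_sum.
rewrite -[RHS](sym_id sX) [in RHS](matrix_delta_sum X).
have symS I (r : seq I) (F : I -> ten R) :
    sym (\sum_(i <- r) F i) = \sum_(i <- r) sym (F i).
  elim/big_rec2: _ => [|i y x _ <-]; last by rewrite symD.
  by rewrite -(scale0r 0) symZ !scale0r.
rewrite symS; apply: eq_bigr => m _; rewrite act4_sum symS.
by apply: eq_bigr => n _; rewrite act4Z (inv4_slice m n).2 symZ.
Qed.

End Inverse.
End Tensors.

(** * The dual density: completing the square *)

Section Density.
Variables (R : realType) (p : problem R) (c : chosen R).
Implicit Types (z : spacetime R) (J : jet R) (U : primal_val R).

(** The loads that a jet of the dual fields exerts on the primal fields [u], [v],
    [E], [W]: the coefficients of each in the part of the bulk integrand that is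
    linear in [U].  They depend linearly on the jet, and the DtP map is the base
    state plus the loads divided by the Hessian of the potential. *)
Definition ldu J : vec R :=
  \row_(m < 3) (- gam J.2.1 m - \sum_(l < 3) mu (J.2.2 l) m l).
Definition ldv z J : vec R :=
  \row_(m < 3) - (gam J.1 m + rho p z.1 * lam J.2.1 m).
Definition dlam (g : gradient R) : ten R := \matrix_(i < 3, j < 3) lam (g.2 j) i.
Definition ldE z J : ten R := act4 (tr4 (moduli p z.1)) (dlam J.2) - sym J.1.2.
Definition ldW J : ten R := - skew J.1.2.

Definition pairing z U J : R :=
  dotv (pu U) (ldu J) + dotv (pv U) (ldv z J)
  + frob (pE U) (ldE z J) + frob (pW U) (ldW J).

(** The inverse of the Hessian of the potential, as a bilinear form in the loads. *)
Definition dform z J J' : R :=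
  dotv (ldu J) (ldu J') + (rfield c z.1)^-1 * dotv (ldv z J) (ldv z J')
  + frob (act4 (inv4 (Afield c z)) (ldE z J)) (ldE z J')
  + frob (ldW J) (ldW J').

(** Twice the potential with the DtP state as base state, which is twice what a
    state [U] loses against the maximizer. *)
Definition defect z U J : R :=
  let V := dtp p c z J in
  frob (pE U - pE V) (act4 (Afield c z) (pE U - pE V))
  + frob (pW U - pW V) (pW U - pW V) + dotv (pu U - pu V) (pu U - pu V)
  + rfield c z.1 * dotv (pv U - pv V) (pv U - pv V).

Lemma gamD (d d' : dual_val R) e i :
  gam (d + e *: d') i = gam d i + e * gam d' i.
Proof. by rewrite /gam -[(d + _).1.1]/(d.1.1 + e *: d'.1.1) !mxE. Qed.

Lemma lamD (d d' : dual_val R) e i :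
  lam (d + e *: d') i = lam d i + e * lam d' i.
Proof. by rewrite /lam -[(d + _).1.2]/(d.1.2 + e *: d'.1.2) !mxE. Qed.

Lemma muD (d d' : dual_val R) e k l :
  mu (d + e *: d') k l = mu d k l + e * mu d' k l.
Proof. by rewrite /mu -[(d + _).2]/(d.2 + e *: d'.2) !mxE. Qed.

Lemma gamZ s (d : dual_val R) i : gam (s *: d) i = s * gam d i.
Proof. by rewrite -[s *: d]add0r gamD {1}/gam mxE add0r. Qed.

Lemma lamZ s (d : dual_val R) i : lam (s *: d) i = s * lam d i.
Proof. by rewrite -[s *: d]add0r lamD {1}/lam mxE add0r. Qed.

Lemma muZ s (d : dual_val R) k l : mu (s *: d) k l = s * mu d k l.
Proof. by rewrite -[s *: d]add0r muD {1}/mu mxE add0r. Qed.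

Lemma jetD1 J e J' : (J + e *: J').1 = J.1 + e *: J'.1.
Proof. by case: J J' => [? ?] [? ?]. Qed.

Lemma jetDt J e J' : (J + e *: J').2.1 = J.2.1 + e *: J'.2.1.
Proof. by case: J J' => [? [? ?]] [? [? ?]]. Qed.

Lemma jetDx J e J' j : (J + e *: J').2.2 j = J.2.2 j + e *: J'.2.2 j.
Proof. by case: J J' => [? [? ?]] [? [? ?]]. Qed.

Lemma lduD J e J' : ldu (J + e *: J') = ldu J + e *: ldu J'.
Proof.
apply/rowP => m; rewrite !mxE jetDt gamD.
rewrite (eq_bigr (fun l => mu (J.2.2 l) m l + e * mu (J'.2.2 l) m l)); last first.
  by move=> l _; rewrite jetDx muD.
by rewrite big_split/= -mulr_sumr; ring.
Qed.

Lemma ldvD z J e J' : ldv z (J + e *: J') = ldv z J + e *: ldv z J'.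
Proof. by apply/rowP => m; rewrite !mxE jetDt jetD1 gamD lamD; ring. Qed.

Lemma dlamD J e J' : dlam (J + e *: J').2 = dlam J.2 + e *: dlam J'.2.
Proof. by apply/matrixP => i j; rewrite !mxE jetDx lamD. Qed.

Lemma ldED z J e J' : ldE z (J + e *: J') = ldE z J + e *: ldE z J'.
Proof.
rewrite /ldE dlamD jetD1 -[(J.1 + _).2]/(J.1.2 + e *: J'.1.2).
by rewrite act4D act4Z symD symZ opprD scalerBr addrACA.
Qed.

Lemma ldWD J e J' : ldW (J + e *: J') = ldW J + e *: ldW J'.
Proof.
rewrite /ldW jetD1 -[(J.1 + _).2]/(J.1.2 + e *: J'.1.2).
by rewrite skewD skewZ opprD scalerN.
Qed.

Lemma pairingD z U J e J' :
  pairing z U (J + e *: J') = pairing z U J + e * pairing z U J'.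
Proof.
rewrite /pairing lduD ldvD ldED ldWD !(dotvDr, frobDr, dotvZr, frobZr).
by ring.
Qed.

Lemma potentialE z U : potential c z U = 2^-1 *
  (frob (pE U - pE (base_state c z)) (act4 (Afield c z) (pE U - pE (base_state c z)))
  + frob (pW U - pW (base_state c z)) (pW U - pW (base_state c z))
  + dotv (pu U - pu (base_state c z)) (pu U - pu (base_state c z))
  + rfield c z.1 * dotv (pv U - pv (base_state c z)) (pv U - pv (base_state c z))).
Proof.
rewrite /potential frob_act4; congr (_ * (_ + _ + _ + _ * _)).
- do 4 (apply: eq_bigr => ? _); rewrite !mxE; reflexivity.
- by do 2 (apply: eq_bigr => ? _); rewrite !mxE expr2.
- by apply: eq_bigr => ? _; rewrite !mxE expr2.
- by apply: eq_bigr => ? _; rewrite !mxE expr2.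
Qed.

Lemma bulkE z U J : (pE U)^T = pE U -> (pW U)^T = - pW U ->
  bulk p c z U J = pairing z U J - potential c z U.
Proof.
case: J => D [Dt Dx] sE sW; rewrite /bulk /pairing; congr (_ - _).
rewrite /ldE frobDr frobNr /ldW frobNr frob_sym// frob_skew//.
have -> : \sum_(k < 3) \sum_(l < 3) mu D k l * (pE U k l + pW U k l) =
    frob (pE U) D.2 + frob (pW U) D.2.
  rewrite -big_split; apply: eq_bigr => k _; rewrite -big_split.
  by apply: eq_bigr => l _; rewrite /mu/=; ring.
have -> : \sum_(i < 3) \sum_(j < 3) \sum_(k < 3) \sum_(l < 3)
      pE U k l * moduli p z.1 i j k l * lam (Dx j) i =
    frob (pE U) (act4 (tr4 (moduli p z.1)) (dlam (Dt, Dx))).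
  rewrite exchange4 frob_act4; do 4 (apply: eq_bigr => ? _).
  by rewrite mxE.
have -> : dotv (pu U) (ldu (D, (Dt, Dx))) =
    \sum_(i < 3) - pu U 0 i * gam Dt i
    - \sum_(k < 3) \sum_(l < 3) pu U 0 k * mu (Dx l) k l.
  rewrite -sumrB; apply: eq_bigr => k _; rewrite mxE/= -mulr_sumr; ring.
have -> : dotv (pv U) (ldv z (D, (Dt, Dx))) =
    \sum_(i < 3) (- gam D i * pv U 0 i - pv U 0 i * (rho p z.1 * lam Dt i)).
  by apply: eq_bigr => k _; rewrite mxE/=; ring.
have -> : \sum_(i < 3) (- pu U 0 i * gam Dt i - gam D i * pv U 0 i
                - pv U 0 i * (rho p z.1 * lam Dt i)) =
   \sum_(i < 3) - pu U 0 i * gam Dt i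
   + \sum_(i < 3) (- gam D i * pv U 0 i - pv U 0 i * (rho p z.1 * lam Dt i)).
  by rewrite -big_split; apply: eq_bigr => k _/=; ring.
by ring.
Qed.

Lemma dtpE z J : dtp p c z J = Primal
  (pu (base_state c z) + ldu J)
  (pv (base_state c z) + (rfield c z.1)^-1 *: ldv z J)
  (pE (base_state c z) + act4 (inv4 (Afield c z)) (ldE z J))
  (pW (base_state c z) + ldW J).
Proof.
case: J => D [Dt Dx]; rewrite /dtp; congr Primal.
- by apply/rowP => m; rewrite !mxE /=; ring.
- by apply/rowP => m; rewrite !mxE /=; ring.
- congr (_ + act4 _ _); apply/matrixP => m n; rewrite !mxE; congr (_ - _).
  by apply: eq_bigr => i _; apply: eq_bigr => j _; rewrite mxE.
Qed.

Section Pointwise.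
Variable z : spacetime R.
Local Notation A := (Afield c z).
Local Notation r := (rfield c z.1).
Local Notation Ub := (base_state c z).
Hypotheses (sC : minor_symmetric (moduli p z.1)) (sA : minor_symmetric A)
  (mA : major_symmetric A) (iA : invertible_on_sym A) (r0 : r != 0)
  (sE : (pE Ub)^T = pE Ub) (sW : (pW Ub)^T = - pW Ub).

Lemma ldE_sym J : (ldE z J)^T = ldE z J.
Proof. by rewrite /ldE linearB/= act4_trT// symT. Qed.

Lemma dtp_sym J : (pE (dtp p c z J))^T = pE (dtp p c z J).
Proof. by rewrite dtpE/= linearD/= sE act4_inv4_sym. Qed.

Lemma dtp_skew J : (pW (dtp p c z J))^T = - pW (dtp p c z J).
Proof. by rewrite dtpE/= linearD/= sW /ldW linearN/= skewT opprD. Qed.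

Lemma dformC J J' : dform z J J' = dform z J' J.
Proof.
rewrite /dform dotvC (dotvC (ldv z J)) (frobC (ldW J)); congr (_ + _ + _ + _).
have {1}<- := act4_inv4K iA (ldE_sym J').
by rewrite -act4_major// act4_inv4K ?ldE_sym// frobC.
Qed.

Lemma dformDr J J1 e J2 :
  dform z J (J1 + e *: J2) = dform z J J1 + e * dform z J J2.
Proof.
rewrite /dform lduD ldvD ldED ldWD !(dotvDr, frobDr, dotvZr, frobZr).
by ring.
Qed.

Lemma pairing_dtp J J' :
  pairing z (dtp p c z J) J' = pairing z Ub J' + dform z J J'.
Proof.
rewrite dtpE /pairing /dform/= !(dotvDl, frobDl, dotvZl); ring.
Qed.

(** Completing the square: when [A] and [r] are positive the defect is nonnegative,
    and the DtP state is the maximizer of the bulk integrand with respect to [U]. *)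
Lemma bulk_defect U J : (pE U)^T = pE U -> (pW U)^T = - pW U ->
  bulk p c z U J = pairing z Ub J + 2^-1 * dform z J J - 2^-1 * defect z U J.
Proof.
move=> uE uW; rewrite bulkE// potentialE /defect dtpE/=.
set V := pE U - pE Ub; set X := ldE z J.
have -> : pE U - (pE Ub + act4 (inv4 A) X) = V - act4 (inv4 A) X.
  by rewrite opprD addrA.
set w := pW U - pW Ub.
have -> : pW U - (pW Ub + ldW J) = w - ldW J by rewrite opprD addrA.
set u := pu U - pu Ub.
have -> : pu U - (pu Ub + ldu J) = u - ldu J by rewrite opprD addrA.
set v := pv U - pv Ub.
have -> : pv U - (pv Ub + r^-1 *: ldv z J) = v - r^-1 *: ldv z J.
  by rewrite opprD addrA.
have -> : pairing z U J = pairing z Ub J + dotv u (ldu J) + dotv v (ldv z J)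
    + frob V X + frob w (ldW J).
  rewrite /pairing /u /v /V /w !(dotvDl, frobDl, dotvNl, frobNl) -/X; ring.
have sX : X^T = X by exact: ldE_sym.
rewrite /dform -/X; clearbody V X w u v.
move: (ldu J) (ldv z J) (ldW J) => lu lv lW.
rewrite act4D act4N (act4_inv4K iA sX).
rewrite !(dotvDl, frobDl, dotvNl, frobNl, dotvDr, frobDr, dotvNr, frobNr,
  dotvZl, dotvZr).
have -> : frob (act4 (inv4 A) X) (act4 A V) = frob V X.
  by rewrite -act4_major// (act4_inv4K iA sX) frobC.
rewrite (dotvC lu u) (dotvC lv v) (frobC lW w).
by field.
Qed.

Lemma dual_densityE J :
  dual_density p c z J = pairing z Ub J + 2^-1 * dform z J J.
Proof.
rewrite /dual_density bulk_defect; [|exact: dtp_sym|exact: dtp_skew].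
by rewrite /defect !subrr !dotv0l !frob0l !(mulr0, addr0) subr0.
Qed.

(** The density is quadratic in the jet, and its linear term at [J] pairs the test
    jet with the DtP state of [J]: the dependence of the maximizer on the jet
    does not contribute, as in the envelope theorem. *)
Lemma dual_densityD J e J' : dual_density p c z (J + e *: J') =
  dual_density p c z J + e * pairing z (dtp p c z J) J'
  + e ^+ 2 * (2^-1 * dform z J' J').
Proof.
rewrite !dual_densityE pairingD pairing_dtp dformDr.
rewrite dformC dformDr (dformC (J + e *: J') J') dformDr (dformC J' J).
by field.
Qed.

Lemma bulk_le U J : 0 < r -> posdef_on_sym A ->
  (pE U)^T = pE U -> (pW U)^T = - pW U ->
  bulk p c z U J <= dual_density p c z J.
Proof.
move=> rp pA uE uW; rewrite bulk_defect// dual_densityE gerBl mulr_ge0// /defect.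
rewrite !addr_ge0 ?mulr_ge0 ?dotv_ge0 ?frob_ge0 ?(ltW rp)//.
set E := _ - _; have sE' : E^T = E by rewrite linearB/= uE dtp_sym.
have [->|E0] := eqVneq E 0; last by rewrite frob_act4 ltW// pA.
by rewrite frob0l.
Qed.

Lemma dform_ge0 J : 0 < r -> posdef_on_sym A -> 0 <= dform z J J.
Proof.
move=> rp pA; rewrite /dform.
rewrite !addr_ge0 ?mulr_ge0 ?dotv_ge0 ?frob_ge0 ?invr_ge0 ?(ltW rp)//.
(* with E the strain produced by the load, the term is E : A E *)
rewrite -[X in frob _ X](act4_inv4K iA (ldE_sym J)).
set E := act4 _ _; have sE' : E^T = E by exact: act4_inv4_sym.
have [->|E0] := eqVneq E 0; last by rewrite frob_act4 ltW// pA.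
by rewrite frob0l.
Qed.

(** Only the gradient slots of the jet enter the principal part; with the value
    slot emptied, the loads are those combinations of first derivatives that the
    degenerate elliptic form squares. *)
Lemma dform_grad (g : gradient R) : dform z (0, g) (0, g) =
  \sum_(i < 3) (gam g.1 i + \sum_(j < 3) mu (g.2 j) i j) ^+ 2
     + rho p z.1 ^+ 2 / r * \sum_(i < 3) lam g.1 i ^+ 2
     + \sum_(i < 3) \sum_(j < 3) \sum_(k < 3) \sum_(l < 3)
         lam (g.2 j) i
         * mul4 (mul4 (moduli p z.1) (inv4 A)) (tr4 (moduli p z.1)) i j k l
         * lam (g.2 l) k.
Proof.
have s0 : sym (0 : ten R) = 0 by rewrite sym_id ?trmx0.
have k0 : skew (0 : ten R) = 0 by rewrite /skew trmx0 subrr scaler0.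
rewrite /dform /ldW/= k0 oppr0 frob0l addr0.
congr (_ + _ + _).
- by apply: eq_bigr => i _; rewrite mxE/= -opprD mulrNN expr2.
- rewrite /dotv !mulr_sumr; apply: eq_bigr => i _.
  by rewrite mxE/= /gam/= mxE add0r; ring.
rewrite /ldE/= s0 subr0 frobC frob_act4_tr -!act4_mul4 frob_act4.
do 4 (apply: eq_bigr => ? _); rewrite !mxE; congr (_ * _ * _).
Qed.

End Pointwise.
End Density.

(** * Regularity of the inverse of A *)

Section InverseRegularity.
Variable R : realType.
Implicit Types (A : ten4 R) (M X E : ten R).

(** With its minor symmetries, [act4 A] has the skew tensors in its kernel;
    completed by the identity there it is an endomorphism of all tensors whose
    9 x 9 matrix is invertible as soon as [A] is injective on symmetric tensors. *)
Definition ext4 A M : ten R := sym (act4 A (sym M)) + skew M.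

Lemma ext4_is_linear A : linear (ext4 A).
Proof.
move=> a M N; rewrite /ext4 ![a *: M + N]addrC symD symZ skewD skewZ.
rewrite act4D act4Z symD symZ [LHS]addrACA scalerDr.
by rewrite [in LHS]addrC.
Qed.

HB.instance Definition _ A :=
  GRing.isLinear.Build R (ten R) (ten R) *:%R (ext4 A) (ext4_is_linear A).

Definition ext4_mx A : 'M[R]_(3 * 3) := lin_mx (ext4 A).

Lemma sym_skewE M : M = sym M + skew M.
Proof. by apply/matrixP => i j; rewrite !mxE; field. Qed.

Lemma skew_sym M : M^T = M -> skew M = 0.
Proof. by move=> h; rewrite /skew h subrr scaler0. Qed.

Lemma skew_skew M : skew (skew M) = skew M.
Proof.
by rewrite /skew -/(skew M) skewT; apply/matrixP => i j; rewrite !mxE; field.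
Qed.

Lemma skew_ext4 A M : skew (ext4 A M) = skew M.
Proof. by rewrite /ext4 skewD skew_skew (skew_sym (symT _)) add0r. Qed.

Lemma ext4_symE A M : minor_symmetric A -> M^T = M -> ext4 A M = act4 A M.
Proof.
by move=> sA sM; rewrite /ext4 (sym_id sM) (skew_sym sM) addr0 (sym_id (act4_symT M sA)).
Qed.

Lemma ext4_mx_unit A : minor_symmetric A ->
  (forall E, E^T = E -> act4 A E = 0 -> E = 0) -> ext4_mx A \in unitmx.
Proof.
move=> sA inj; rewrite -row_free_unit; apply: inj_row_free => v.
rewrite -[v]vec_mxK mul_vec_lin => /(congr1 vec_mx); rewrite mxvecK linear0.
set M := vec_mx v; rewrite /= => FM.
have k0 : skew M = 0 by rewrite -(skew_ext4 A) FM skew_sym ?trmx0.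
have sM : M^T = M by rewrite (sym_skewE M) k0 addr0 symT.
by rewrite (inj M sM) ?linear0// -ext4_symE.
Qed.

Lemma invertible_inj A : invertible_on_sym A ->
  forall E, E^T = E -> act4 A E = 0 -> E = 0.
Proof.
move=> iA E sE AE; have [E' [_ uE]] := iA 0 (trmx0 _ _ _).
rewrite -(uE E (conj sE AE)); apply: uE; split; first exact: trmx0.
by apply/matrixP => i j; rewrite !mxE big1// => k _; rewrite big1// => l _; rewrite mxE mulr0.
Qed.

(** Cramer's rule for [inv4]: unlike the choice made by [inv4], it makes sense and
    is regular at points near [K] too. *)
Definition inv4_formula A : ten4 R := fun r s m n =>
  \sum_k mxvec (sym (delta_mx m n : ten R)) 0 k *
    ((\det (ext4_mx A))^-1 * \adj (ext4_mx A) k (mxvec_index r s)).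

Lemma inv4_formulaE A : minor_symmetric A -> invertible_on_sym A ->
  inv4_formula A = inv4 A.
Proof.
move=> sA iA; apply/funext => r; apply/funext => s; apply/funext => m.
apply/funext => n; have [sE AE] := inv4_slice iA m n.
set E := \matrix_(_, _) _ in sE AE; rewrite (_ : inv4 A r s m n = E r s); last first.
  by rewrite mxE.
have uA : ext4_mx A \in unitmx := ext4_mx_unit sA (invertible_inj iA).
have FE : mxvec E *m ext4_mx A = mxvec (sym (delta_mx m n)).
  by rewrite /ext4_mx mul_vec_lin/= ext4_symE// AE.
have vE : mxvec E = mxvec (sym (delta_mx m n)) *m invmx (ext4_mx A).
  by rewrite -FE mulmxK.
rewrite -(mxvecE E) vE mxE; apply: eq_bigr => k _; congr (_ * _).
by rewrite /invmx uA [RHS]mxE.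
Qed.

Lemma Ck_ext4_mx (V : normedModType R) k (U : set V) (A : V -> ten4 R) :
  open U -> (forall i j m n, Ck k U (fun z => A z i j m n)) ->
  forall a b, Ck k U (fun z => ext4_mx (A z) a b).
Proof.
move=> oU CA a b; case/mxvec_indexP: b => i j.
pose M := sym (vec_mx (delta_mx 0 a) : ten R).
have Cact i' j' : Ck k U (fun z => act4 (A z) M i' j').
  apply: (eq_Ck oU (f := fun z => \sum_m \sum_n A z i' j' m n * M m n)).
    by move=> z _; rewrite mxE.
  apply: Ck_sum => // m; apply: Ck_sum => // n; apply: CkM => //.
  exact: Ck_cst.
apply: (eq_Ck oU (f := fun z => 2^-1 * (act4 (A z) M i j + act4 (A z) M j i)
    + skew (vec_mx (delta_mx 0 a) : ten R) i j)).
  by move=> z _; rewrite /ext4_mx /lin_mx !mxE/= mxvecE /ext4 !mxE.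
apply: CkD => //; last exact: Ck_cst.
by apply: CkM => //; [exact: Ck_cst|exact: CkD].
Qed.

Lemma Ck_near_inv4 (V : normedModType R) k (K : set V) (A : V -> ten4 R) :
  (forall i j m n, Ck_near k K (fun z => A z i j m n)) ->
  (forall z, K z -> minor_symmetric (A z)) ->
  (forall z, K z -> invertible_on_sym (A z)) ->
  forall r s m n, Ck_near k K (fun z => inv4_formula (A z) r s m n).
Proof.
move=> CA sA iA r s m n.
have [U [oU KU CU]] := @Ck_near_common R V K ('I_3 * 'I_3 * 'I_3 * 'I_3)%type k
  (fun q z => A z q.1.1.1 q.1.1.2 q.1.2 q.2)
  (fun q => CA q.1.1.1 q.1.1.2 q.1.2 q.2).
have CN := Ck_ext4_mx oU (fun i j m n => CU (i, j, m, n)).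
apply: Ck_near_sum => q; apply: Ck_near_M; first exact: Ck_near_cst.
apply: Ck_near_M; last by exists U; split=> //; exact: Ck_adj.
apply: Ck_near_V; last by exists U; split=> //; exact: Ck_det.
move=> z Kz; have := ext4_mx_unit (sA z Kz) (invertible_inj (iA z Kz)).
by rewrite unitmxE unitfE.
Qed.

(** Positive definiteness gives injectivity on symmetric tensors, and surjectivity
    follows in finite dimension. *)
Lemma posdef_invertible A : minor_symmetric A -> posdef_on_sym A ->
  invertible_on_sym A.
Proof.
move=> sA pA M sM.
have inj E : E^T = E -> act4 A E = 0 -> E = 0.
  move=> sE AE; apply/eqP/negPn/negP => E0.
  by have := pA E sE E0; rewrite -frob_act4 AE frobC frob0l ltxx.
have uA := ext4_mx_unit sA inj.
pose E := vec_mx (mxvec M *m invmx (ext4_mx A)).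
have FE : ext4 A E = M.
  by apply: (can_inj mxvecK); rewrite -(mul_vec_lin (ext4 A)) vec_mxK mulmxKV.
have kE : skew E = 0 by rewrite -(skew_ext4 A) FE skew_sym.
have sE : E^T = E by rewrite (sym_skewE E) kE addr0 symT.
exists E; split; first by split; rewrite // -ext4_symE.
move=> E' [sE' AE']; apply/eqP; rewrite -subr_eq0; apply/eqP/inj.
  by rewrite linearB/= sE sE'.
by rewrite act4D act4N AE' -ext4_symE// FE subrr.
Qed.

End InverseRegularity.

(** * Regularity up to the boundary *)

Section Components.
Variable R : realType.

Lemma gam_is_linear i : linear (fun d : dual_val R => gam d i).
Proof. by move=> a d d'; rewrite /gam !mxE. Qed.
Lemma lam_is_linear i : linear (fun d : dual_val R => lam d i).
Proof. by move=> a d d'; rewrite /lam !mxE. Qed.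
Lemma mu_is_linear k l : linear (fun d : dual_val R => mu d k l).
Proof. by move=> a d d'; rewrite /mu !mxE. Qed.

(** Copies of the component maps that carry a linear structure, so that the
    regularity of dual fields passes to their components. *)
Definition gamL i (d : dual_val R) : R := gam d i.
Definition lamL i (d : dual_val R) : R := lam d i.
Definition muL k l (d : dual_val R) : R := mu d k l.

HB.instance Definition _ i :=
  GRing.isLinear.Build R (dual_val R) R *:%R (gamL i) (gam_is_linear i).
HB.instance Definition _ i :=
  GRing.isLinear.Build R (dual_val R) R *:%R (lamL i) (lam_is_linear i).
HB.instance Definition _ k l :=
  GRing.isLinear.Build R (dual_val R) R *:%R (muL k l) (mu_is_linear k l).

Lemma gamL_continuous i : continuous (gamL i).
Proof.
move=> d; apply: (@continuous_comp _ _ _ (fun d : dual_val R => d.1.1) (fun v : vec R => v 0 i)).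
  apply: (@continuous_comp _ _ _ (@fst _ _) (@fst _ _)); exact: fst_continuous.
exact: coord_continuous.
Qed.

Lemma lamL_continuous i : continuous (lamL i).
Proof.
move=> d; apply: (@continuous_comp _ _ _ (fun d : dual_val R => d.1.2) (fun v : vec R => v 0 i)).
  apply: (@continuous_comp _ _ _ (@fst _ _) (@snd _ _)).
    exact: fst_continuous.
  exact: snd_continuous.
exact: coord_continuous.
Qed.

Lemma muL_continuous k l : continuous (muL k l).
Proof.
move=> d; apply: (@continuous_comp _ _ _ (@snd _ _) (fun v : ten R => v k l)).
  exact: snd_continuous.
exact: coord_continuous.
Qed.

Lemma Ck_comp_fst (W : normedModType R) k (U : set (space R)) (f : space R -> W) :
  Ck k U f -> Ck k [set z : spacetime R | U z.1] (fun z => f z.1).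
Proof.
elim: k f => [|k IH] f [cf hf].
  split=> // z Uz; exact: (@continuous_comp _ _ _ (@fst (space R) R) f z
    (@fst_continuous R _ _ z) (cf _ Uz)).
split=> [z Uz|[v s]].
  exact: (@continuous_comp _ _ _ (@fst (space R) R) f z
    (@fst_continuous R _ _ z) (cf _ Uz)).
have [df Df] := hf v.
have E z : (fun h : R => h^-1 *: (((fun z : spacetime R => f z.1) \o shift z)
    (h *: (v, s)) - f z.1)) = (fun h : R => h^-1 *: ((f \o shift z.1) (h *: v) - f z.1)).
  by [].
split=> [z Uz|]; first by rewrite /derivable E; exact: df.
rewrite (_ : 'D_(v, s) _ = fun z => 'D_v f z.1); first exact: (IH ('D_v f) Df).
by apply/funext => z; rewrite /derive E.
Qed.

End Components.

Section Regularity.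
Variables (R : realType) (p : problem R).
Hypothesis hp : regular_problem p.

Local Notation K := (cyl p (closure (Omega p))).
Local Notation cts := (cts p).
Local Notation van := (van p).

(** [inv4], hence the DtP map, is under control on [K] only: regularity up to the
    boundary is asserted for some function with the same values on [K]. *)
Definition reg (f : spacetime R -> R) : Prop :=
  exists2 g, Ck_near 1 K g & forall z, K z -> f z = g z.

Lemma reg_cts f : reg f -> cts f.
Proof.
move=> [g Cg fg]; apply: (eq_cts (f := g)) (Ck_near_cts Cg).
by move=> z /fg.
Qed.

Lemma Ck_near_reg f : Ck_near 1 K f -> reg f.
Proof. by exists f. Qed.

Lemma eq_reg f g : (forall z, K z -> f z = g z) -> reg f -> reg g.
Proof. by move=> fg [h Ch fh]; exists h => // z Kz; rewrite -fg// fh. Qed.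

Lemma Ck_near_space k (f : space R -> R) : Ck_near k (closure (Omega p)) f ->
  Ck_near k K (fun z => f z.1).
Proof.
move=> [U [oU KU CU]]; exists [set z : spacetime R | U z.1]; split.
- by apply: (@open_comp _ _ (@fst (space R) R)) => // z _; exact: fst_continuous.
- by move=> z [/KU].
- exact: Ck_comp_fst.
Qed.

Lemma regD f g : reg f -> reg g -> reg (fun z => f z + g z).
Proof.
move=> [f' Cf Ef] [g' Cg Eg]; exists (fun z => f' z + g' z); first exact: Ck_near_D.
by move=> z Kz; rewrite Ef// Eg.
Qed.

Lemma regM f g : reg f -> reg g -> reg (fun z => f z * g z).
Proof.
move=> [f' Cf Ef] [g' Cg Eg]; exists (fun z => f' z * g' z); first exact: Ck_near_M.
by move=> z Kz; rewrite Ef// Eg.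
Qed.

Lemma reg_cst a : reg (fun=> a).
Proof. by apply: Ck_near_reg; exact: Ck_near_cst. Qed.

Lemma regN f : reg f -> reg (fun z => - f z).
Proof.
move=> rf; apply: (eq_reg (f := fun z => -1 * f z)); first by move=> z _; rewrite mulN1r.
by apply: regM => //; exact: reg_cst.
Qed.

Lemma reg_sum I (r : seq I) (f : I -> spacetime R -> R) :
  (forall i, reg (f i)) -> reg (fun z => \sum_(i <- r) f i z).
Proof.
move=> cf; rewrite (_ : (fun z => _) = \sum_(i <- r) f i); last first.
  by apply/funext => x; rewrite fct_sumE.
elim/big_rec: _ => [|i g _ cg]; first exact: reg_cst.
exact: regD.
Qed.

Section Jets.
Variable D : spacetime R -> dual_val R.
Hypothesis rD : regular_dual p D.
Variable L : {linear dual_val R -> R}.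
Hypothesis cL : continuous L.

Lemma comp_Ck2 : Ck_near 2 K (fun z => L (D z)).
Proof. by apply: Ck_near_lin => //; have [] := rD. Qed.

Lemma comp_reg : reg (fun z => L (D z)).
Proof. exact/Ck_near_reg/Ck_near_W/comp_Ck2. Qed.

Lemma comp_van : van (fun z => L (D z)).
Proof. by have [_ [M hM]] := rD; exists M => z Kz zM; rewrite hM// linear0. Qed.

Lemma comp_derive v z : K z -> L ('D_v D z) = 'D_v (fun y => L (D y)) z.
Proof.
move=> Kz; have [[U [oU KU CU]] _] := rD.
by have [_ ->] := is_derive_lin (v := v) cL (Ck_derivable CU (KU _ Kz)).
Qed.

Lemma comp_derive_reg v : reg (fun z => L ('D_v D z)).
Proof.
apply: (eq_reg (f := 'D_v (fun y => L (D y)))).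
  by move=> z Kz; rewrite comp_derive.
by apply/Ck_near_reg/Ck_near_derive/comp_Ck2.
Qed.

Lemma comp_derive_van v : van (fun z => L ('D_v D z)).
Proof.
apply: (eq_van (f := 'D_v (fun y => L (D y)))).
  by move=> z Kz; rewrite comp_derive.
by apply: van_derive => //; [exact/Ck_near_W/comp_Ck2|exact: comp_van].
Qed.

End Jets.

Lemma jet_ofD D dD e z : regular_dual p D -> regular_dual p dD -> K z ->
  jet_of (D + e *: dD) z = jet_of D z + e *: jet_of dD z.
Proof.
move=> [[U [oU KU CU]] _] [[V [oV KV CV]] _] Kz.
have dU v := Ck_derivable CU (v := v) (KU _ Kz).
have dV v := Ck_derivable CV (v := v) (KV _ Kz).
have E v : 'D_v (D + e *: dD) z = 'D_v D z + e *: 'D_v dD z.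
  have dZ : derivable (e *: dD) z v := @derivableZ _ _ _ dD e z v (dV v).
  by rewrite (deriveD (dU v) dZ) -(@deriveZ _ _ _ dD e z v (dV v)).
rewrite /jet_of /grad /ddt /ddx E; congr (_, (_, _)).
by apply/funext => j; rewrite E.
Qed.

End Regularity.

Section Entries.
Variable R : realType.

Definition rv_entry i (v : vec R) : R := v 0 i.
Definition mx_entry k l (M : ten R) : R := M k l.

Lemma rv_entry_is_linear i : linear (rv_entry i).
Proof. by move=> a u v; rewrite /rv_entry !mxE. Qed.
Lemma mx_entry_is_linear k l : linear (mx_entry k l).
Proof. by move=> a u v; rewrite /mx_entry !mxE. Qed.

HB.instance Definition _ i :=
  GRing.isLinear.Build R (vec R) R *:%R (rv_entry i) (rv_entry_is_linear i).
HB.instance Definition _ k l :=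
  GRing.isLinear.Build R (ten R) R *:%R (mx_entry k l) (mx_entry_is_linear k l).

End Entries.

Section Expansion.
Variables (R : realType) (p : problem R) (c : chosen R).
Hypotheses (hp : regular_problem p) (hc : regular_choice p c)
  (hn : nondegenerate_choice p c).

Local Notation K := (cyl p (closure (Omega p))).
Local Notation cts := (cts p).
Local Notation van := (van p).
Local Notation reg := (reg p).
Implicit Types (D dD : spacetime R -> dual_val R).

(** The fields built linearly from the dual fields; they form an ideal over the
    regular coefficients. *)
Definition tst (f : spacetime R -> R) : Prop := reg f /\ van f.

Lemma tstD f g : tst f -> tst g -> tst (fun z => f z + g z).
Proof. by move=> [rf vf] [rg vg]; split; [exact: regD|exact: vanD]. Qed.

Lemma tstMr f g : reg f -> tst g -> tst (fun z => f z * g z).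
Proof. by move=> rf [rg vg]; split; [exact: regM|exact: vanMr]. Qed.

Lemma tstZ a f : tst f -> tst (fun z => a * f z).
Proof. by apply: tstMr; exact: reg_cst. Qed.

Lemma tstN f : tst f -> tst (fun z => - f z).
Proof. by move=> [rf vf]; split; [exact: regN|exact: vanN]. Qed.

Lemma tst_sum I (r : seq I) (f : I -> spacetime R -> R) :
  (forall i, tst (f i)) -> tst (fun z => \sum_(i <- r) f i z).
Proof.
move=> tf; split; first by apply: reg_sum => i; have [] := tf i.
by apply: van_sum => i; have [] := tf i.
Qed.

Lemma eq_tst f g : (forall z, K z -> f z = g z) -> tst f -> tst g.
Proof. by move=> fg [rf vf]; split; [exact: eq_reg rf|exact: eq_van vf]. Qed.

Lemma eq_tst' f g : f =1 g -> tst f -> tst g.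
Proof. by move=> fg; apply: eq_tst => z _; exact: fg. Qed.

Lemma eq_reg' f g : f =1 g -> reg f -> reg g.
Proof. by move=> fg; apply: eq_reg => z _; exact: fg. Qed.

Lemma moduli_reg i j k l : reg (fun z => moduli p z.1 i j k l).
Proof. exact: (Ck_near_reg (Ck_near_space (prb_moduli hp i j k l))). Qed.

Lemma rho_reg : reg (fun z => rho p z.1).
Proof. exact: (Ck_near_reg (Ck_near_space (prb_rho hp))). Qed.

Lemma rfield_inv_reg : reg (fun z => (rfield c z.1)^-1).
Proof.
apply: Ck_near_reg; apply: Ck_near_V; last exact: (Ck_near_space (cho_r hc)).
by move=> z [/= Kz _]; exact: hn.1.
Qed.

Lemma inv4_reg i j k l : reg (fun z => inv4 (Afield c z) i j k l).
Proof.
exists (fun z => inv4_formula (Afield c z) i j k l).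
  by apply: Ck_near_inv4; [exact: cho_A hc|exact: cho_A_minor hc|exact: hn.2].
move=> z Kz; rewrite inv4_formulaE//; first exact: (cho_A_minor hc).
exact: hn.2.
Qed.

Definition regU (U : spacetime R -> primal_val R) : Prop :=
  [/\ forall i, reg (fun z => pu (U z) 0 i), forall i, reg (fun z => pv (U z) 0 i),
      forall i j, reg (fun z => pE (U z) i j) & forall i j, reg (fun z => pW (U z) i j)].

Lemma base_state_reg : regU (base_state c).
Proof.
split=> [i|i|i j|i j]; apply: Ck_near_reg.
- apply: (Ck_near_lin (L := rv_entry i)) (cho_u hc); exact: coord_continuous.
- apply: (Ck_near_lin (L := rv_entry i)) (cho_v hc); exact: coord_continuous.
- apply: (Ck_near_lin (L := mx_entry i j)) (cho_E hc); exact: coord_continuous.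
- apply: (Ck_near_lin (L := mx_entry i j)) (cho_W hc); exact: coord_continuous.
Qed.

Record tst_jet (J : spacetime R -> jet R) : Prop := TstJet {
  tst_gam : forall i, tst (fun z => gam (J z).1 i);
  tst_lam : forall i, tst (fun z => lam (J z).1 i);
  tst_mu : forall k l, tst (fun z => mu (J z).1 k l);
  tst_dt_gam : forall i, tst (fun z => gam (J z).2.1 i);
  tst_dt_lam : forall i, tst (fun z => lam (J z).2.1 i);
  tst_dx_lam : forall j i, tst (fun z => lam ((J z).2.2 j) i);
  tst_dx_mu : forall j k l, tst (fun z => mu ((J z).2.2 j) k l) }.

Lemma tst0 : tst (fun=> 0).
Proof. by split; [exact: reg_cst|exists 0]. Qed.

Section Components.
Variable D : spacetime R -> dual_val R.
Hypothesis rD : regular_dual p D.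

Lemma gam_tst i : tst (fun z => gam (D z) i).
Proof.
by split; [exact: (comp_reg rD (@gamL_continuous R i))|exact: (comp_van rD (gamL i : {linear dual_val R -> R}))].
Qed.

Lemma lam_tst i : tst (fun z => lam (D z) i).
Proof.
by split; [exact: (comp_reg rD (@lamL_continuous R i))|exact: (comp_van rD (lamL i : {linear dual_val R -> R}))].
Qed.

Lemma mu_tst k l : tst (fun z => mu (D z) k l).
Proof.
by split; [exact: (comp_reg rD (@muL_continuous R k l))|exact: (comp_van rD (muL k l : {linear dual_val R -> R}))].
Qed.

Lemma dgam_tst i v : tst (fun z => gam ('D_v D z) i).
Proof.
by split; [exact: (comp_derive_reg rD (@gamL_continuous R i))
  |exact: (comp_derive_van hp rD (@gamL_continuous R i))].
Qed.

Lemma dlam_tst i v : tst (fun z => lam ('D_v D z) i).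
Proof.
by split; [exact: (comp_derive_reg rD (@lamL_continuous R i))
  |exact: (comp_derive_van hp rD (@lamL_continuous R i))].
Qed.

Lemma dmu_tst k l v : tst (fun z => mu ('D_v D z) k l).
Proof.
by split; [exact: (comp_derive_reg rD (@muL_continuous R k l))
  |exact: (comp_derive_van hp rD (@muL_continuous R k l))].
Qed.

Lemma jet_of_tst : tst_jet (jet_of D).
Proof.
split=> *; [exact: gam_tst|exact: lam_tst|exact: mu_tst|exact: dgam_tst|
  exact: dlam_tst|exact: dlam_tst|exact: dmu_tst].
Qed.

Lemma grad_tst : tst_jet (fun z => (0, grad D z)).
Proof.
split=> *; [| | |exact: dgam_tst|exact: dlam_tst|exact: dlam_tst|exact: dmu_tst];
  by apply: (eq_tst' _ tst0) => z; rewrite /gam /lam /mu !mxE.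
Qed.

End Components.

Section Loads.
Variable J : spacetime R -> jet R.
Hypothesis tJ : tst_jet J.

Lemma ldu_tst m : tst (fun z => ldu (J z) 0 m).
Proof.
have t1 := tst_dt_gam tJ; have t2 := tst_dx_mu tJ.
apply: (eq_tst' (f := fun z => - gam (J z).2.1 m
    + - \sum_(l < 3) mu ((J z).2.2 l) m l)).
  by move=> z; rewrite mxE.
by apply: tstD; apply: tstN; [exact: t1|apply: tst_sum => l; exact: t2].
Qed.

Lemma ldv_tst m : tst (fun z => ldv p z (J z) 0 m).
Proof.
have t1 := tst_gam tJ; have t2 := tst_dt_lam tJ.
apply: (eq_tst' (f := fun z => - (gam (J z).1 m + rho p z.1 * lam (J z).2.1 m))).
  by move=> z; rewrite mxE.
by apply: tstN; apply: tstD => //; apply: tstMr => //; exact: rho_reg.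
Qed.

Lemma ldE_tst m n : tst (fun z => ldE p z (J z) m n).
Proof.
have t1 := tst_mu tJ; have t2 := tst_dx_lam tJ.
apply: (eq_tst' (f := fun z => \sum_(k < 3) \sum_(l < 3)
   moduli p z.1 k l m n * lam ((J z).2.2 l) k
   + - (2^-1 * (mu (J z).1 m n + mu (J z).1 n m)))).
  move=> z; rewrite !mxE; congr (_ - _).
  by apply: eq_bigr => k _; apply: eq_bigr => l _; rewrite mxE.
apply: tstD.
  apply: tst_sum => k; apply: tst_sum => l; apply: tstMr; first exact: moduli_reg.
  exact: t2.
by apply: tstN; apply: tstZ; apply: tstD; exact: t1.
Qed.

Lemma ldW_tst m n : tst (fun z => ldW (J z) m n).
Proof.
have t1 := tst_mu tJ.
apply: (eq_tst' (f := fun z => - (2^-1 * (mu (J z).1 m n + - mu (J z).1 n m)))).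
  by move=> z; rewrite !mxE.
by apply: tstN; apply: tstZ; apply: tstD; [|apply: tstN]; exact: t1.
Qed.

Lemma inv4_ldE_tst m n :
  tst (fun z => act4 (inv4 (Afield c z)) (ldE p z (J z)) m n).
Proof.
apply: (eq_tst' (f := fun z => \sum_(k < 3) \sum_(l < 3)
    inv4 (Afield c z) m n k l * ldE p z (J z) k l)).
  by move=> z; rewrite mxE.
apply: tst_sum => k; apply: tst_sum => l; apply: tstMr; first exact: inv4_reg.
exact: ldE_tst.
Qed.

Lemma pairing_tst U : regU U -> tst (fun z => pairing p z (U z) (J z)).
Proof.
move=> [ru rv rE rW]; rewrite /pairing; apply: tstD; first apply: tstD; first apply: tstD.
- by apply: tst_sum => i; apply: tstMr => //; exact: ldu_tst.
- by apply: tst_sum => i; apply: tstMr => //; exact: ldv_tst.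
- by do 2 (apply: tst_sum => ?); apply: tstMr => //; exact: ldE_tst.
- by do 2 (apply: tst_sum => ?); apply: tstMr => //; exact: ldW_tst.
Qed.

Lemma dform_tst : tst (fun z => dform p c z (J z) (J z)).
Proof.
rewrite /dform; apply: tstD; first apply: tstD; first apply: tstD.
- by apply: tst_sum => i; apply: tstMr; [have [] := ldu_tst i|exact: ldu_tst].
- apply: tstMr; first exact: rfield_inv_reg.
  by apply: tst_sum => i; apply: tstMr; [have [] := ldv_tst i|exact: ldv_tst].
- apply: tst_sum => i; apply: tst_sum => j; apply: tstMr; last exact: ldE_tst.
  by have [] := inv4_ldE_tst i j.
- apply: tst_sum => i; apply: tst_sum => j; apply: tstMr; last exact: ldW_tst.
  by have [] := ldW_tst i j.
Qed.

End Loads.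

Lemma dtp_reg D : regular_dual p D -> regU (dtp_field p c D).
Proof.
move=> rD; have tD := jet_of_tst rD.
have [ru rv rE rW] := base_state_reg.
split=> [i|i|i j|i j].
- apply: (eq_reg' (f := fun z => pu (base_state c z) 0 i + ldu (jet_of D z) 0 i)).
    by move=> z; rewrite /dtp_field dtpE/= [RHS]mxE.
  by apply: regD => //; have [] := ldu_tst tD i.
- apply: (eq_reg' (f := fun z => pv (base_state c z) 0 i
    + (rfield c z.1)^-1 * ldv p z (jet_of D z) 0 i)).
    by move=> z; rewrite /dtp_field dtpE/= [RHS]mxE; congr (_ + _); rewrite [RHS]mxE.
  apply: regD => //; apply: regM; first exact: rfield_inv_reg.
  by have [] := ldv_tst tD i.
- apply: (eq_reg' (f := fun z => pE (base_state c z) i j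
    + act4 (inv4 (Afield c z)) (ldE p z (jet_of D z)) i j)).
    by move=> z; rewrite /dtp_field dtpE/= [RHS]mxE.
  by apply: regD => //; have [] := inv4_ldE_tst tD i j.
- apply: (eq_reg' (f := fun z => pW (base_state c z) i j + ldW (jet_of D z) i j)).
    by move=> z; rewrite /dtp_field dtpE/= [RHS]mxE.
  by apply: regD => //; have [] := ldW_tst tD i j.
Qed.

Lemma tst_integrable f : tst f ->
  (@leb4 R).-integrable (cyl p (Omega p)) (EFin \o f).
Proof. by move=> [/reg_cts cf vf]; exact: cyl_integrable. Qed.

End Expansion.

(** * The dual functional is quadratic *)

Section Quadratic.
Variable R : realType.

Lemma is_derive_quadratic (a b q x : R) :
  is_derive x (1 : R) (fun e : R => a + e * b + e ^+ 2 * q) (b + 2 * x * q).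
Proof.
set F := fun e : R => _.
have H : (fun h : R => h^-1 *: ((F \o shift x) (h *: 1) - F x)) @ 0^' -->
    b + 2 * x * q.
  have c : (fun h : R => b + 2 * x * q + h * q) @ 0^' --> b + 2 * x * q.
    rewrite -[X in _ --> X]addr0 -[X in _ --> _ + X](mul0r q).
    have id0 : h @[h --> (0 : R)^'] --> (0 : R) by exact: nbhs_dnbhs.
    apply: cvgD; first exact: cvg_cst.
    by apply: cvgM => //; exact: cvg_cst.
  apply: cvg_trans c; apply: near_eq_cvg; near=> h.
  have h0 : h != 0 by near: h; exact: nbhs_dnbhs_neq.
  rewrite /F/= [h *: 1]mulr1 -[_ *: _]/(_ * _); apply: (mulfI h0).
  by rewrite mulVKf//; ring.
by apply: DeriveDef; [apply/cvg_ex; exists (b + 2 * x * q)|exact: cvg_lim H].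
Unshelve. all: by end_near. Qed.

Lemma derive1n2_quadratic (a b q : R) :
  derive1n 2 (fun e : R => a + e * b + e ^+ 2 * q) 0 = 2 * q.
Proof.
rewrite derive1nS derive1n1 (_ : derive1 (fun e : R => a + e * b + e ^+ 2 * q) =
    fun x => b + x * (2 * q) + x ^+ 2 * 0); last first.
  apply/funext => x; rewrite derive1E; have [_ ->] := is_derive_quadratic a b q x.
  by ring.
by rewrite derive1E; have [_ ->] := is_derive_quadratic b (2 * q) 0 0; ring.
Qed.

End Quadratic.

Section DualExpansion.
Variables (R : realType) (p : problem R) (c : chosen R).
Hypotheses (hp : regular_problem p) (hc : regular_choice p c)
  (hn : nondegenerate_choice p c).

Local Notation T := (horizon p).
Local Notation K := (cyl p (closure (Omega p))).
Local Notation cts := (cts p).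
Local Notation van := (van p).
Implicit Types (D dD : spacetime R -> dual_val R).

Let mO := measurable_Omega hp.
Let mcO : measurable (cyl p (Omega p) : set (mspacetime R)).
Proof. exact: measurable_cyl. Qed.
Let mcGs : measurable (cyl p (Gs p) : set (mspacetime R)).
Proof. by apply: measurable_cyl; exact: measurable_Gs. Qed.
Let mcGu : measurable (cyl p (Gu p) : set (mspacetime R)).
Proof. by apply: measurable_cyl; exact: measurable_Gu. Qed.

Lemma Rintegral_linear d (X : measurableType d) (m : {measure set X -> \bar R})
    (A : set X) (f g : X -> R) e : measurable A ->
  m.-integrable A (EFin \o f) -> m.-integrable A (EFin \o g) ->
  \int[m]_(x in A) (f x + e * g x) =
  \int[m]_(x in A) f x + e * \int[m]_(x in A) g x.
Proof.
move=> mA fi gi; rewrite RintegralD//; first by rewrite RintegralZl.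
by apply: (eq_integrable _ (fun x => e%:E * (g x)%:E)%E) => //; exact: integrableZl.
Qed.

Definition force_density D z : R := \sum_(i < 3) lam (D z) i * force p z 0 i.
Definition init_density D x : R :=
  \sum_(i < 3) (gam (D (x, 0)) i * disp_init p x 0 i
                + rho p x * lam (D (x, 0)) i * vel_init p x 0 i).
Definition traction_density D z : R := \sum_(i < 3) lam (D z) i * traction p z 0 i.
Definition disp_density D z : R := \sum_(k < 3) \sum_(l < 3)
  mu (D z) k l * disp_bdry p z 0 k * normal p z.1 0 l.

(** The data enter the dual functional through this linear form alone. *)
Definition data_form D : R :=
  - (\int[@leb4 R]_(z in cyl p (Omega p)) force_density D z)
  - \int[@leb3 R]_(x in Omega p) init_density D x
  - \int[sigma_dt (sigma p)]_(z in cyl p (Gs p)) traction_density D z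
  + \int[sigma_dt (sigma p)]_(z in cyl p (Gu p)) disp_density D z.

Lemma predualE U D : predual p c U D =
  \int[@leb4 R]_(z in cyl p (Omega p)) bulk p c z (U z) (jet_of D z) + data_form D.
Proof.
transitivity (\int[@leb4 R]_(z in cyl p (Omega p)) bulk p c z (U z) (jet_of D z)
  - \int[@leb4 R]_(z in cyl p (Omega p)) force_density D z
  - \int[@leb3 R]_(x in Omega p) init_density D x
  - \int[sigma_dt (sigma p)]_(z in cyl p (Gs p)) traction_density D z
  + \int[sigma_dt (sigma p)]_(z in cyl p (Gu p)) disp_density D z) => //.
by rewrite /data_form; ring.
Qed.

Section Integrability.
Variable D : spacetime R -> dual_val R.
Hypothesis rD : regular_dual p D.

Let gam_cts i : cts (fun z => gam (D z) i). Proof. by have [/reg_cts] := gam_tst rD i. Qed.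
Let lam_cts i : cts (fun z => lam (D z) i). Proof. by have [/reg_cts] := lam_tst rD i. Qed.
Let mu_cts k l : cts (fun z => mu (D z) k l). Proof. by have [/reg_cts] := mu_tst rD k l. Qed.

Lemma force_integrable :
  (@leb4 R).-integrable (cyl p (Omega p)) (EFin \o force_density D).
Proof.
apply: cyl_integrable => //.
  apply: cts_sum => i; apply: ctsM => //.
  exact: (within_entry (prb_force hp)).
by apply: van_sum => i; apply: vanMl; have [] := lam_tst rD i.
Qed.

Lemma init_density_integrable :
  (@leb3 R).-integrable (Omega p) (EFin \o init_density D).
Proof.
have I0 : `[0, T]%classic (0 : R) by rewrite /= in_itv/= lexx ltW ?(prb_horizon hp).
apply: init_integrable => //.
  have h f : cts f -> {within closure (Omega p), continuous (fun x => f (x, 0))}.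
    by move=> cf; apply: (slice_within (p := p)) => //.
  apply: within_sum => i; apply: withinD; apply: withinM.
  - exact: (h _ (@gam_cts i)).
  - exact: (within_entry (prb_disp_init hp)).
  - apply: withinM; last exact: (h _ (@lam_cts i)).
    exact: (h _ (reg_cts (rho_reg hp))).
  - exact: (within_entry (prb_vel_init hp)).
have [_ [M hM]] := rD; exists M => x Ox xM; apply: big1 => i _.
by rewrite hM// /gam /lam !mxE !mul0r mulr0 mul0r addr0.
Qed.

Lemma traction_integrable :
  (sigma_dt (sigma p)).-integrable (cyl p (Gs p)) (EFin \o traction_density D).
Proof.
apply: bdry_integrable => //; [exact: Gs_bdry|exact: measurable_Gs| |].
  apply: bcoef_sum => i; apply: bcoefM.
    exact: (bcoef_cts (Gs_bdry hp) (measurable_Gs hp) (@lam_cts i)).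
  apply: bcoef_data; [exact: measurable_Gs|exact: prb_traction|exact: prb_traction_bounded].
have [_ [M hM]] := rD; exists M => z Gz zM; apply: big1 => i _.
by rewrite hM ?/lam ?mxE ?mul0r//; exact: (cyl_bdry_K (Gs_bdry hp)).
Qed.

Lemma disp_integrable :
  (sigma_dt (sigma p)).-integrable (cyl p (Gu p)) (EFin \o disp_density D).
Proof.
apply: bdry_integrable => //; [exact: Gu_bdry|exact: measurable_Gu| |].
  apply: bcoef_sum => k; apply: bcoef_sum => l; apply: bcoefM; first apply: bcoefM.
  - exact: (bcoef_cts (Gu_bdry hp) (measurable_Gu hp) (@mu_cts k l)).
  - apply: bcoef_data; [exact: measurable_Gu|exact: prb_disp_bdry|exact: prb_disp_bdry_bounded].
  - exact: (bcoef_normal hp l (@subsetUr _ _ _) (measurable_Gu hp)).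
have [_ [M hM]] := rD; exists M => z Gz zM; apply: big1 => k _; apply: big1 => l _.
by rewrite hM ?/mu ?mxE ?mul0r//; exact: (cyl_bdry_K (Gu_bdry hp)).
Qed.

End Integrability.

Lemma data_formD D dD e : regular_dual p D -> regular_dual p dD ->
  data_form (D + e *: dD) = data_form D + e * data_form dD.
Proof.
move=> rD rdD; rewrite /data_form.
have -> : \int[@leb4 R]_(z in cyl p (Omega p)) force_density (D + e *: dD) z =
    \int[@leb4 R]_(z in cyl p (Omega p)) (force_density D z + e * force_density dD z).
  apply: eq_Rintegral => z _; rewrite /force_density mulr_sumr -big_split.
  by apply: eq_bigr => i _; rewrite lamD mulrDl mulrA.
have -> : \int[@leb3 R]_(x in Omega p) init_density (D + e *: dD) x =
    \int[@leb3 R]_(x in Omega p) (init_density D x + e * init_density dD x).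
  apply: eq_Rintegral => x _; rewrite /init_density mulr_sumr -big_split.
  by apply: eq_bigr => i _; rewrite lamD gamD /=; ring.
have -> : \int[sigma_dt (sigma p)]_(z in cyl p (Gs p)) traction_density (D + e *: dD) z =
    \int[sigma_dt (sigma p)]_(z in cyl p (Gs p))
      (traction_density D z + e * traction_density dD z).
  apply: eq_Rintegral => z _; rewrite /traction_density mulr_sumr -big_split.
  by apply: eq_bigr => i _; rewrite lamD mulrDl mulrA.
have -> : \int[sigma_dt (sigma p)]_(z in cyl p (Gu p)) disp_density (D + e *: dD) z =
    \int[sigma_dt (sigma p)]_(z in cyl p (Gu p))
      (disp_density D z + e * disp_density dD z).
  apply: eq_Rintegral => z _; rewrite /disp_density mulr_sumr -big_split.
  apply: eq_bigr => k _; rewrite mulr_sumr -big_split.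
  by apply: eq_bigr => l _; rewrite muD /=; ring.
rewrite (Rintegral_linear e mcO (force_integrable rD) (force_integrable rdD)).
rewrite (Rintegral_linear e mO (init_density_integrable rD) (init_density_integrable rdD)).
rewrite (Rintegral_linear e mcGs (traction_integrable rD) (traction_integrable rdD)).
rewrite (Rintegral_linear e mcGu (disp_integrable rD) (disp_integrable rdD)).
by ring.
Qed.

(** The coefficient of [e] in the expansion of the dual functional at [D + e dD]:
    the pre-dual functional without the potential, linear in the test field, with
    the DtP fields frozen. *)
Definition first_variation D dD : R :=
  \int[@leb4 R]_(z in cyl p (Omega p))
     pairing p z (dtp_field p c D z) (jet_of dD z) + data_form dD.

Definition second_variation dD : R :=
  \int[@leb4 R]_(z in cyl p (Omega p))
     (2^-1 * dform p c z (jet_of dD z) (jet_of dD z)).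

Lemma dual_densityE_K z J : K z ->
  dual_density p c z J = pairing p z (base_state c z) J + 2^-1 * dform p c z J J.
Proof.
move=> Kz; apply: dual_densityE.
- by apply: (prb_moduli_sym hp); case: Kz.
- exact: (cho_A_major hc).
- exact: hn.2.
- by apply: hn.1; case: Kz.
- exact: (cho_E_sym hc).
- exact: (cho_W_skew hc).
Qed.

Lemma dual_densityD_K z J e J' : K z -> dual_density p c z (J + e *: J') =
  dual_density p c z J + e * pairing p z (dtp p c z J) J'
  + e ^+ 2 * (2^-1 * dform p c z J' J').
Proof.
move=> Kz; apply: dual_densityD.
- by apply: (prb_moduli_sym hp); case: Kz.
- exact: (cho_A_major hc).
- exact: hn.2.
- by apply: hn.1; case: Kz.
- exact: (cho_E_sym hc).
- exact: (cho_W_skew hc).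
Qed.

Lemma density_tst D : regular_dual p D ->
  tst p (fun z => dual_density p c z (jet_of D z)).
Proof.
move=> rD; apply: (eq_tst (f := fun z => pairing p z (base_state c z) (jet_of D z)
   + 2^-1 * dform p c z (jet_of D z) (jet_of D z))).
  by move=> z Kz; rewrite dual_densityE_K.
apply: tstD; first exact: (pairing_tst hp (jet_of_tst hp rD) (base_state_reg hc)).
exact/tstZ/(dform_tst hp hc hn (jet_of_tst hp rD)).
Qed.

(** The dual functional is a quadratic polynomial along every line of dual fields;
    stationarity and convexity are read off its coefficients. *)
Lemma dual_functional_expansion D dD e : regular_dual p D -> regular_dual p dD ->
  dual_functional p c (D + e *: dD) = dual_functional p c D
    + e * first_variation D dD + e ^+ 2 * second_variation dD.
Proof.
move=> rD rdD; rewrite /dual_functional !predualE data_formD//.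
rewrite /first_variation /second_variation.
move: (data_form D) (data_form dD) => d0 d1.
have E : \int[@leb4 R]_(z in cyl p (Omega p))
    bulk p c z (dtp_field p c (D + e *: dD) z) (jet_of (D + e *: dD) z) =
  \int[@leb4 R]_(z in cyl p (Omega p)) (dual_density p c z (jet_of D z)
     + e * (pairing p z (dtp_field p c D z) (jet_of dD z)
     + e * (2^-1 * dform p c z (jet_of dD z) (jet_of dD z)))).
  apply: eq_Rintegral => z /set_mem /cyl_Omega_K Kz.
  rewrite -[LHS]/(dual_density p c z (jet_of (D + e *: dD) z)).
  rewrite (jet_ofD e rD rdD Kz) (dual_densityD_K _ _ _ Kz) /dtp_field.
  move: (dual_density _ _ _ _) (pairing _ _ _ _) (dform _ _ _ _ _) => a b q.
  by ring.
apply: (eq_trans (congr1 (fun x => x + _) E)).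
have t0 := density_tst rD.
have t1 := pairing_tst hp (jet_of_tst hp rdD) (dtp_reg hp hc hn rD).
have t2 := tstZ 2^-1 (dform_tst hp hc hn (jet_of_tst hp rdD)).
have i0 := tst_integrable hp t0; have i1 := tst_integrable hp t1.
have i2 := tst_integrable hp t2.
have i12 := tst_integrable hp (tstD t1 (tstZ e t2)).
rewrite (Rintegral_linear e mcO i0 i12) (Rintegral_linear e mcO i1 i2).
move: (\int[_]_(_ in _) pairing _ _ _ _) (\int[_]_(_ in _) (_ * _)) => x1 x2.
have -> : \int[@leb4 R]_(z in cyl p (Omega p)) bulk p c z (dtp_field p c D z) (jet_of D z)
  = \int[@leb4 R]_(z in cyl p (Omega p)) dual_density p c z (jet_of D z) by [].
by ring.
Qed.

Lemma stationaryP D : dual_fields p D ->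
  stationary p (dual_functional p c) D <->
  forall dD, dual_fields p dD -> first_variation D dD = 0.
Proof.
move=> [rD _ _ _].
have H dD : dual_fields p dD -> is_derive (0 : R) (1 : R)
    (fun e : R => dual_functional p c (D + e *: dD)) (first_variation D dD).
  move=> [rdD _ _ _].
  have Eq : (fun e : R => dual_functional p c (D + e *: dD)) =
      (fun e : R => dual_functional p c D + e * first_variation D dD
         + e ^+ 2 * second_variation dD).
    by apply/funext => e; exact: dual_functional_expansion.
  rewrite Eq; apply: (is_derive_eq (is_derive_quadratic _ _ _ _)).
  by rewrite mulr0 mul0r addr0.
split=> h dD hdD; last by have := H dD hdD; rewrite (h dD hdD).
by have [_ <-] := H dD hdD; have [_ ->] := h dD hdD.
Qed.

Lemma second_variation_ge0 dD : positive_choice p c -> 0 <= second_variation dD.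
Proof.
move=> [rp Ap]; apply: Rintegral_ge0 => z /cyl_Omega_K Kz.
rewrite mulr_ge0// dform_ge0//.
- by apply: (prb_moduli_sym hp); case: Kz.
- exact: hn.2.
- by apply: rp; case: Kz.
- exact: Ap.
Qed.

End DualExpansion.

(** * Supremum, convexity and degenerate ellipticity *)

Section Maximality.
Variables (R : realType) (p : problem R).
Hypothesis hp : regular_problem p.

Local Notation K := (cyl p (closure (Omega p))).
Implicit Types (D dD : spacetime R -> dual_val R).

Lemma regular_dualD D dD e : regular_dual p D -> regular_dual p dD ->
  regular_dual p (D + e *: dD).
Proof.
move=> [CD [M hM]] [CdD [N hN]]; split.
  apply: (Ck_near_D CD).
  apply: (Ck_near_lin (L := ( *:%R e) : {linear dual_val R -> dual_val R}) _ CdD).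
  exact: scaler_continuous.
exists (Num.max M N) => z Kz; rewrite gt_max => /andP[h k].
by rewrite -[LHS]/(D z + e *: dD z) hM// hN// scaler0 addr0.
Qed.

Lemma dual_fieldsD D dD e : dual_fields p D -> dual_fields p dD ->
  dual_fields p (D + e *: dD).
Proof.
move=> [rD D1 D2 D3] [rdD dD1 dD2 dD3]; split.
- exact: regular_dualD.
- move=> x i Ox; rewrite gamD lamD.
  have [-> ->] := D1 x i Ox; have [-> ->] := dD1 x i Ox.
  by rewrite mulr0 addr0.
- by move=> z i Gz; rewrite lamD D2// dD2// mulr0 addr0.
- move=> z k Gz; rewrite (eq_bigr (fun l => mu (D z) k l * normal p z.1 0 l
      + e * (mu (dD z) k l * normal p z.1 0 l))).
    by rewrite big_split/= -mulr_sumr D3// dD3// mulr0 addr0.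
  by move=> l _; rewrite muD mulrDl mulrA.
Qed.

Lemma convex_combE (V : lmodType R) (t : {i01 R}) (x y : convex_lmodType V) :
  conv t x y = (y : V) + t%:num *: ((x : V) + (-1) *: (y : V)).
Proof.
rewrite -[LHS]/(t%:num *: (x : V) + (1 - t%:num) *: (y : V)).
by rewrite scalerBl scale1r scalerDr scaleN1r scalerN addrCA.
Qed.

Lemma dual_fields_convex : convex_set (dual_fields p).
Proof.
move=> D D' t; rewrite !inE => hD hD'; rewrite convex_combE.
by apply: dual_fieldsD => //; exact: dual_fieldsD.
Qed.

Variable c : chosen R.
Hypotheses (hc : regular_choice p c).

Lemma positive_nondegenerate : positive_choice p c -> nondegenerate_choice p c.
Proof.
move=> [rp Ap]; split=> [x Ox|z Kz]; first by rewrite gt_eqF// rp.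
by apply: posdef_invertible; [exact: (cho_A_minor hc)|exact: Ap].
Qed.

Hypothesis pc : positive_choice p c.
Let hn := positive_nondegenerate pc.

(** Along a segment the functional is a quadratic polynomial with nonnegative
    leading coefficient [q]; the convexity gap is [t (1 - t) q]. *)
Lemma dual_functional_convex :
  convex_function (dual_fields p) (dual_functional p c).
Proof.
move=> t D D'; rewrite !inE => hD hD'; rewrite convex_combE.
have [rD _ _ _] := hD; have [rD' _ _ _] := hD'.
pose X := (D : spacetime R -> dual_val R) + (-1) *: (D' : spacetime R -> dual_val R).
have rX : regular_dual p X by exact: regular_dualD.
have E e := dual_functional_expansion hp hc hn e rD' rX.
have DE : (D : spacetime R -> dual_val R) = D' + 1 *: X.
  by rewrite /X scale1r scaleN1r addrCA subrr addr0.
rewrite -/X E.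
have -> : conv t (dual_functional p c D : R^o) (dual_functional p c D' : R^o) =
   t%:num * dual_functional p c D + (1 - t%:num) * dual_functional p c D' by [].
rewrite DE E.
have q0 := second_variation_ge0 hp hn X pc.
have t0 : 0 <= t%:num by [].
have t1 : t%:num <= 1 by [].
set a := dual_functional p c D'; set b := first_variation _ _ _ _.
set q := second_variation _ _ _ in q0 *.
have : 0 <= t%:num * (1 - t%:num) * q by rewrite !mulr_ge0// subr_ge0.
nra.
Qed.

Lemma dtp_primal_fields D : regular_dual p D ->
  primal_fields p c D (dtp_field p c D).
Proof.
move=> rD; have [ru rv rE rW] := dtp_reg hp hc hn rD.
have mreg f : reg p f -> measurable_fun (cyl p (Omega p) : set (mspacetime R)) f.
  move=> /reg_cts cf; apply: within_measurable_spacetime.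
    by apply: measurable_cyl; exact: measurable_Omega.
  by apply: continuous_subspaceW cf; exact: cyl_Omega_K.
split.
- move=> z /cyl_Omega_K Kz; split.
    by apply: dtp_sym; [exact: hn.2|exact: (cho_E_sym hc)].
  by apply: dtp_skew; exact: (cho_W_skew hc).
- by move=> i; split; apply: mreg.
- by move=> i j; split; apply: mreg.
- exact: (tst_integrable hp (density_tst hp hc hn rD)).
Qed.

Lemma predual_le U D : regular_dual p D -> primal_fields p c D U ->
  predual p c U D <= dual_functional p c D.
Proof.
move=> rD [sU _ _ iU]; rewrite /dual_functional !predualE lerD2r.
have mO : measurable (cyl p (Omega p) : set (mspacetime R)).
  by apply: measurable_cyl; exact: measurable_Omega.
apply: le_Rintegral => //.
  exact: (tst_integrable hp (density_tst hp hc hn rD)).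
move=> z Oz; have Kz := cyl_Omega_K Oz; have [sE sW] := sU z Oz.
apply: bulk_le => //.
- by apply: (prb_moduli_sym hp); case: Kz.
- exact: (cho_A_major hc).
- exact: hn.2.
- by apply: hn.1; case: Kz.
- exact: (cho_E_sym hc).
- exact: (cho_W_skew hc).
- by apply: pc.1; case: Kz.
- exact: pc.2.
Qed.

(** The DtP fields are admissible and maximize the integrand pointwise, so that the
    supremum is attained there. *)
Lemma dual_functional_sup D : regular_dual p D ->
  (dual_functional p c D)%:E =
  ereal_sup [set (predual p c U D)%:E | U in primal_fields p c D].
Proof.
move=> rD; apply/eqP; rewrite eq_le; apply/andP; split.
  by apply: ereal_sup_ubound; exists (dtp_field p c D) => //; exact: dtp_primal_fields.
by apply: ge_ereal_sup => _ [U hU <-]; rewrite lee_fin; exact: predual_le.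
Qed.

(** The second derivative of a quadratic density is constant: only its
    quadratic form on the gradient slots is left. *)
Lemma principal_formE D dD z : K z -> principal_form p c z (jet_of D z) (grad dD z) =
  2^-1 * dform p c z (0, grad dD z) (0, grad dD z).
Proof.
move=> Kz; rewrite /principal_form.
pose a := dual_density p c z (jet_of D z).
pose b := pairing p z (dtp p c z (jet_of D z)) (0, grad dD z).
rewrite (_ : (fun e : R => _) = (fun e : R => a + e * b
    + e ^+ 2 * (2^-1 * dform p c z (0, grad dD z) (0, grad dD z)))).
  by rewrite derive1n2_quadratic; field.
apply/funext => e; rewrite /a /b -(dual_densityD_K hp hc hn _ _ _ Kz).
rewrite -[jet_of D z + _]/((jet_of D z).1 + e *: 0, (jet_of D z).2 + e *: grad dD z).
by rewrite scaler0 addr0.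
Qed.

Lemma elliptic_formE dD : regular_dual p dD -> elliptic_form p c dD =
  \int[@leb4 R]_(z in cyl p (Omega p))
    (2^-1 * dform p c z (0, grad dD z) (0, grad dD z)).
Proof.
move=> rdD; have td := dform_tst hp hc hn (grad_tst hp rdD).
rewrite RintegralZl; first last.
- exact: (tst_integrable hp td).
- by apply: measurable_cyl; exact: measurable_Omega.
rewrite /elliptic_form; congr (_ * _); apply: eq_Rintegral => z _.
by rewrite dform_grad.
Qed.

Lemma elliptic_form_ge0 dD : regular_dual p dD -> 0 <= elliptic_form p c dD.
Proof.
move=> rdD; rewrite elliptic_formE//; apply: Rintegral_ge0 => z /cyl_Omega_K Kz.
rewrite mulr_ge0// dform_ge0//.
- by apply: (prb_moduli_sym hp); case: Kz.
- exact: hn.2.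
- by apply: pc.1; case: Kz.
- exact: pc.2.
Qed.

Lemma principal_form_integral D dD : regular_dual p dD ->
  \int[@leb4 R]_(z in cyl p (Omega p))
     principal_form p c z (jet_of D z) (grad dD z) = elliptic_form p c dD.
Proof.
move=> rdD; rewrite elliptic_formE//; apply: eq_Rintegral => z /set_mem /cyl_Omega_K Kz.
exact: principal_formE.
Qed.

End Maximality.

(** * The first variation as a pairing with residuals *)

Section WeakForm.
Variables (R : realType) (p : problem R) (c : chosen R).
Hypotheses (hp : regular_problem p) (hc : regular_choice p c)
  (hn : nondegenerate_choice p c).

Local Notation T := (horizon p).
Local Notation K := (cyl p (closure (Omega p))).
Local Notation cts := (cts p).
Local Notation van := (van p).
Local Notation reg := (reg p).

Let mO := measurable_Omega hp.
Let mcO : measurable (cyl p (Omega p) : set (mspacetime R)).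
Proof. exact: measurable_cyl. Qed.
Let mcGs : measurable (cyl p (Gs p) : set (mspacetime R)).
Proof. by apply: measurable_cyl; exact: measurable_Gs. Qed.
Let mcGu : measurable (cyl p (Gu p) : set (mspacetime R)).
Proof. by apply: measurable_cyl; exact: measurable_Gu. Qed.

Lemma Ck_near_derivable k (f : spacetime R -> R) v z : Ck_near k.+1 K f -> K z ->
  derivable f z v.
Proof. by move=> [U [oU KU CU]] Kz; exact: (Ck_derivable CU (KU _ Kz)). Qed.

Lemma derive_M (f g : spacetime R -> R) v z : Ck_near 1 K f -> Ck_near 1 K g ->
  K z -> 'D_v (fun y => f y * g y) z = f z * 'D_v g z + g z * 'D_v f z.
Proof.
move=> Cf Cg Kz; have df := Ck_near_derivable (v := v) Cf Kz.
exact: (deriveM df (Ck_near_derivable (v := v) Cg Kz)).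
Qed.

Lemma derive_D (f g : spacetime R -> R) v z : Ck_near 1 K f -> Ck_near 1 K g ->
  K z -> 'D_v (fun y => f y + g y) z = 'D_v f z + 'D_v g z.
Proof.
move=> Cf Cg Kz; have df := Ck_near_derivable (v := v) Cf Kz.
exact: (deriveD df (Ck_near_derivable (v := v) Cg Kz)).
Qed.

Lemma derive_N (f : spacetime R -> R) v z : Ck_near 1 K f ->
  K z -> 'D_v (fun y => - f y) z = - 'D_v f z.
Proof. by move=> Cf Kz; exact: (deriveN (Ck_near_derivable (v := v) Cf Kz)). Qed.

Lemma derive_S (f : 'I_3 -> spacetime R -> R) v z :
  (forall i, Ck_near 1 K (f i)) -> K z ->
  'D_v (fun y => \sum_i f i y) z = \sum_i 'D_v (f i) z.
Proof.
move=> Cf Kz; rewrite -derive_sum; last first.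
  by move=> i; exact: (Ck_near_derivable (Cf i) Kz).
by congr ('D_v _ z); apply/funext => y; rewrite fct_sumE.
Qed.

Lemma derive_comp_fst (f : space R -> R) v s z :
  'D_(v, s) (fun y : spacetime R => f y.1) z = 'D_v f z.1.
Proof. by []. Qed.

(** The algebra of the integration by parts at one point: a pairing with first
    derivatives of the test field is a space-time divergence plus a pairing of
    the residuals with its value.  The arguments stand for values, for time
    derivatives (suffix [t]) and for space derivatives (suffix [x]). *)
Lemma flux_identity (u v g gt l lt ut vt : 'I_3 -> R) (rh : R)
    (S lx ux m e w : 'I_3 -> 'I_3 -> R) (Sx mx : 'I_3 -> 'I_3 -> R) :
  \sum_i u i * (- gt i - \sum_j mx i j) + \sum_i v i * - (g i + rh * lt i)
  + \sum_i \sum_j S i j * lx i j - \sum_k \sum_j m k j * (e k j + w k j) =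
  \sum_i - (u i * gt i + g i * ut i + (rh * v i * lt i + l i * (rh * vt i)))
  + \sum_j (\sum_i (S i j * lx i j + l i * Sx i j)
            - \sum_k (u k * mx k j + m k j * ux k j))
  + (\sum_i (g i * (ut i - v i) + l i * (rh * vt i - \sum_j Sx i j))
     + \sum_k \sum_j m k j * (ux k j - e k j - w k j)).
Proof. by rewrite !big_ord_recl !big_ord0; ring. Qed.

Definition stress (U : primal_val R) (z : spacetime R) i j : R :=
  \sum_(k < 3) \sum_(l < 3) moduli p z.1 i j k l * pE U k l.

Lemma pairingE (z : spacetime R) (U : primal_val R) J :
  (pE U)^T = pE U -> (pW U)^T = - pW U ->
  pairing p z U J =
  \sum_i pu U 0 i * (- gam J.2.1 i - \sum_j mu (J.2.2 j) i j)
  + \sum_i pv U 0 i * - (gam J.1 i + rho p z.1 * lam J.2.1 i)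
  + \sum_i \sum_j stress U z i j * lam (J.2.2 j) i
  - \sum_k \sum_j mu J.1 k j * (pE U k j + pW U k j).
Proof.
move=> sE sW; rewrite /pairing /ldE /ldW frobDr !frobNr frob_sym// frob_skew//.
have -> : frob (pE U) (act4 (tr4 (moduli p z.1)) (dlam J.2)) =
    \sum_i \sum_j stress U z i j * lam (J.2.2 j) i.
  rewrite frobC frob_act4_tr frobC; apply: eq_bigr => i _; apply: eq_bigr => j _.
  by rewrite /stress !mxE.
have -> : \sum_(k < 3) \sum_(j < 3) mu J.1 k j * (pE U k j + pW U k j) =
    frob (pE U) J.1.2 + frob (pW U) J.1.2.
  rewrite -big_split; apply: eq_bigr => k _; rewrite -big_split.
  by apply: eq_bigr => l _; rewrite /mu/=; ring.
have -> : dotv (pu U) (ldu J) =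
   \sum_i pu U 0 i * (- gam J.2.1 i - \sum_j mu (J.2.2 j) i j).
  by apply: eq_bigr => i _; rewrite mxE.
have -> : dotv (pv U) (ldv p z J) =
   \sum_i pv U 0 i * - (gam J.1 i + rho p z.1 * lam J.2.1 i).
  by apply: eq_bigr => i _; rewrite mxE.
by ring.
Qed.

Lemma Rintegral_sum d (X : measurableType d) (m : {measure set X -> \bar R})
    (A : set X) I (r : seq I) (f : I -> X -> R) : measurable A ->
  (forall i, m.-integrable A (EFin \o f i)) ->
  m.-integrable A (EFin \o (fun x => \sum_(i <- r) f i x)) /\
  \int[m]_(x in A) (\sum_(i <- r) f i x) = \sum_(i <- r) \int[m]_(x in A) f i x.
Proof.
move=> mA fi; elim: r => [|i r [IH1 IH2]].
  have E : (fun x : X => \sum_(i <- [::]) f i x) = cst 0.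
    by apply/funext => x; rewrite big_nil.
  by rewrite E big_nil; split; [exact: integrable0|rewrite Rintegral_cst// mul0r].
have E : (fun x : X => \sum_(j <- i :: r) f j x) =
    (fun x => f i x + \sum_(j <- r) f j x).
  by apply/funext => x; rewrite big_cons.
rewrite E big_cons; split; last by rewrite -IH2; exact: RintegralD.
exact: (integrableD mA (fi i) IH1).
Qed.

Section FirstVariation.
Variable D : spacetime R -> dual_val R.
Hypothesis rD : regular_dual p D.
Local Notation U := (dtp_field p c D).

Variables (ue ve : 'I_3 -> spacetime R -> R) (Se : 'I_3 -> 'I_3 -> spacetime R -> R).
Hypotheses (Cu : forall i, Ck_near 1 K (ue i)) (Cv : forall i, Ck_near 1 K (ve i))
  (CS : forall i j, Ck_near 1 K (Se i j)).
Hypotheses (Eu : forall i z, K z -> pu (U z) 0 i = ue i z)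
  (Ev : forall i z, K z -> pv (U z) 0 i = ve i z)
  (ES : forall i j z, K z -> stress (U z) z i j = Se i j z).

(** The residuals of the initial-boundary value problem at the DtP fields; all
    derivatives fall on [ue], [ve] and [Se], the C^1 functions that represent
    displacement, velocity and stress near [K]. *)
Definition res_velocity i z := ddt (ue i) z - pv (U z) 0 i.
Definition res_momentum i z := rho p z.1 * ddt (ve i) z
  - \sum_(j < 3) ddx j (Se i j) z - force p z 0 i.
Definition res_kinematic k l z :=
  ddx l (ue k) z - pE (U z) k l - pW (U z) k l.
Definition res_disp0 i x := pu (U (x, 0)) 0 i - disp_init p x 0 i.
Definition res_vel0 i x := rho p x * (pv (U (x, 0)) 0 i - vel_init p x 0 i).
Definition res_traction i z :=
  \sum_(j < 3) stress (U z) z i j * normal p z.1 0 j - traction p z 0 i.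
Definition res_disp k l z :=
  (disp_bdry p z 0 k - pu (U z) 0 k) * normal p z.1 0 l.

(** Each residual is dual to one multiplier: [gam] to the velocity equation and the
    initial displacement, [lam] to momentum, traction and initial velocity,
    [mu] to the kinematic equation and the boundary displacement. *)
Definition bulk_res (d : dual_val R) z :=
  \sum_i (gam d i * res_velocity i z + lam d i * res_momentum i z)
  + \sum_k \sum_l mu d k l * res_kinematic k l z.
Definition init_res (d : dual_val R) x :=
  \sum_i (gam d i * res_disp0 i x + lam d i * res_vel0 i x).
Definition traction_res (d : dual_val R) z := \sum_i lam d i * res_traction i z.
Definition disp_res (d : dual_val R) z := \sum_k \sum_l mu d k l * res_disp k l z.

Lemma res_velocity_cts i : cts (res_velocity i).
Proof.
apply: ctsB; first exact: (Ck_near_cts (Ck_near_derive _ (Cu i))).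
by have [_ rv _ _] := dtp_reg hp hc hn rD; exact: reg_cts (rv i).
Qed.

Lemma res_momentum_cts i : cts (res_momentum i).
Proof.
apply: ctsB; last exact: (within_entry (prb_force hp)).
apply: ctsB.
  apply: ctsM; first exact: reg_cts (rho_reg hp).
  exact: (Ck_near_cts (Ck_near_derive _ (Cv i))).
by apply: cts_sum => j; exact: (Ck_near_cts (Ck_near_derive _ (CS i j))).
Qed.

Lemma res_kinematic_cts k l : cts (res_kinematic k l).
Proof.
have [_ _ rE rW] := dtp_reg hp hc hn rD.
apply: ctsB; last exact: reg_cts (rW k l).
apply: ctsB; last exact: reg_cts (rE k l).
exact: (Ck_near_cts (Ck_near_derive _ (Cu k))).
Qed.

Section Test.
Variable dD : spacetime R -> dual_val R.
Hypothesis hdD : dual_fields p dD.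

Let rdD : regular_dual p dD. Proof. by have [] := hdD. Qed.

(** The time and space components of the space-time flux in [flux_identity]. *)
Definition flux_t z := \sum_i - (ue i z * gam (dD z) i
  + (rho p z.1 * ve i z) * lam (dD z) i).
Definition flux_x j z := \sum_i Se i j z * lam (dD z) i
  + - \sum_k ue k z * mu (dD z) k j.

Let Cgam i : Ck_near 1 K (fun z => gam (dD z) i).
Proof. exact: (Ck_near_W (comp_Ck2 rdD (@gamL_continuous R i))). Qed.
Let Clam i : Ck_near 1 K (fun z => lam (dD z) i).
Proof. exact: (Ck_near_W (comp_Ck2 rdD (@lamL_continuous R i))). Qed.
Let Cmu k l : Ck_near 1 K (fun z => mu (dD z) k l).
Proof. exact: (Ck_near_W (comp_Ck2 rdD (@muL_continuous R k l))). Qed.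
Let Crho : Ck_near 1 K (fun z : spacetime R => rho p z.1).
Proof. exact: (Ck_near_space (prb_rho hp)). Qed.
Let Crv i : Ck_near 1 K (fun z => rho p z.1 * ve i z).
Proof. exact: (Ck_near_M Crho (Cv i)). Qed.

Let Dgam i v z : K z -> 'D_v (fun y => gam (dD y) i) z = gam ('D_v dD z) i.
Proof. by move=> Kz; rewrite -(comp_derive rdD (@gamL_continuous R i)). Qed.
Let Dlam i v z : K z -> 'D_v (fun y => lam (dD y) i) z = lam ('D_v dD z) i.
Proof. by move=> Kz; rewrite -(comp_derive rdD (@lamL_continuous R i)). Qed.
Let Dmu k l v z : K z -> 'D_v (fun y => mu (dD y) k l) z = mu ('D_v dD z) k l.
Proof. by move=> Kz; rewrite -(comp_derive rdD (@muL_continuous R k l)). Qed.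

Let Cug i : Ck_near 1 K (fun z => ue i z * gam (dD z) i).
Proof. exact: (Ck_near_M (Cu i) (Cgam i)). Qed.
Let Crvl i : Ck_near 1 K (fun z => (rho p z.1 * ve i z) * lam (dD z) i).
Proof. exact: (Ck_near_M (Crv i) (Clam i)). Qed.
Let CSl i j : Ck_near 1 K (fun z => Se i j z * lam (dD z) i).
Proof. exact: (Ck_near_M (CS i j) (Clam i)). Qed.
Let Cum k j : Ck_near 1 K (fun z => ue k z * mu (dD z) k j).
Proof. exact: (Ck_near_M (Cu k) (Cmu k j)). Qed.
Let Ct i : Ck_near 1 K (fun z => ue i z * gam (dD z) i
  + (rho p z.1 * ve i z) * lam (dD z) i).
Proof. exact: (Ck_near_D (Cug i) (Crvl i)). Qed.
Let CSS j : Ck_near 1 K (fun z => \sum_i Se i j z * lam (dD z) i).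
Proof. exact: (Ck_near_sum (fun i => CSl i j)). Qed.
Let Cuu j : Ck_near 1 K (fun z => \sum_k ue k z * mu (dD z) k j).
Proof. exact: (Ck_near_sum (fun k => Cum k j)). Qed.

Lemma Ck_flux_t : Ck_near 1 K flux_t.
Proof. exact: (Ck_near_sum (fun i => Ck_near_N (Ct i))). Qed.

Lemma Ck_flux_x j : Ck_near 1 K (flux_x j).
Proof. exact: (Ck_near_D (CSS j) (Ck_near_N (Cuu j))). Qed.

Lemma van_flux_t : van flux_t.
Proof.
apply: van_sum => i; apply: vanN; apply: vanD; apply: vanMr.
  by have [] := gam_tst rdD i.
by have [] := lam_tst rdD i.
Qed.

Lemma van_flux_x j : van (flux_x j).
Proof.
apply: vanD; first by apply: van_sum => i; apply: vanMr; have [] := lam_tst rdD i.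
by apply: vanN; apply: van_sum => i; apply: vanMr; have [] := mu_tst rdD i j.
Qed.

Lemma ddt_flux_t z : K z -> ddt flux_t z =
  \sum_i - (ue i z * gam (ddt dD z) i + gam (dD z) i * ddt (ue i) z
    + (rho p z.1 * ve i z * lam (ddt dD z) i
       + lam (dD z) i * (rho p z.1 * ddt (ve i) z))).
Proof.
move=> Kz; rewrite /ddt (derive_S _ (fun i => Ck_near_N (Ct i)) Kz).
apply: eq_bigr => i _; rewrite (derive_N _ (Ct i) Kz); congr (- _).
rewrite (derive_D _ (Cug i) (Crvl i) Kz) (derive_M _ (Cu i) (Cgam i) Kz) Dgam//.
congr (_ + _); rewrite (derive_M _ (Crv i) (Clam i) Kz) Dlam//.
congr (_ + _ * _); rewrite (derive_M _ Crho (Cv i) Kz) derive_comp_fst derive0.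
by rewrite mulr0 addr0.
Qed.

Lemma ddx_flux_x j z : K z -> ddx j (flux_x j) z =
  \sum_i (Se i j z * lam (ddx j dD z) i + lam (dD z) i * ddx j (Se i j) z)
  - \sum_k (ue k z * mu (ddx j dD z) k j + mu (dD z) k j * ddx j (ue k) z).
Proof.
move=> Kz; rewrite /ddx (derive_D _ (CSS j) (Ck_near_N (Cuu j)) Kz).
rewrite (derive_N _ (Cuu j) Kz); congr (_ - _).
  rewrite (derive_S _ (fun i => CSl i j) Kz); apply: eq_bigr => i _.
  by rewrite (derive_M _ (CS i j) (Clam i) Kz) Dlam.
rewrite (derive_S _ (fun k => Cum k j) Kz); apply: eq_bigr => k _.
by rewrite (derive_M _ (Cu k) (Cmu k j) Kz) Dmu.
Qed.

Lemma pairing_flux z : K z -> pairing p z (U z) (jet_of dD z) =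
  ddt flux_t z + \sum_j ddx j (flux_x j) z
  + (bulk_res (dD z) z + force_density p dD z).
Proof.
move=> Kz; rewrite pairingE; first last.
- by apply: dtp_skew; exact: (cho_W_skew hc).
- by apply: dtp_sym; [exact: hn.2|exact: (cho_E_sym hc)].
rewrite ddt_flux_t// (eq_bigr _ (fun j _ => ddx_flux_x j Kz)).
have := flux_identity (fun i => ue i z) (fun i => ve i z) (fun i => gam (dD z) i)
  (fun i => gam (ddt dD z) i) (fun i => lam (dD z) i) (fun i => lam (ddt dD z) i)
  (fun i => ddt (ue i) z) (fun i => ddt (ve i) z) (rho p z.1) (fun i j => Se i j z)
  (fun i j => lam (ddx j dD z) i) (fun k j => ddx j (ue k) z) (fun k j => mu (dD z) k j)
  (fun k j => pE (U z) k j) (fun k j => pW (U z) k j)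
  (fun i j => ddx j (Se i j) z) (fun k j => mu (ddx j dD z) k j).
move=> H; apply: (eq_trans _ (eq_trans H _)).
- congr (_ + _ + _ - _).
  + by apply: eq_bigr => i _; rewrite Eu.
  + by apply: eq_bigr => i _; rewrite Ev.
  + by apply: eq_bigr => i _; apply: eq_bigr => j _; rewrite ES.
- suff <- : \sum_i (gam (dD z) i * (ddt (ue i) z - ve i z) + lam (dD z) i *
        (rho p z.1 * ddt (ve i) z - \sum_j ddx j (Se i j) z))
      + \sum_k \sum_j mu (dD z) k j * (ddx j (ue k) z - pE (U z) k j - pW (U z) k j)
      = bulk_res (dD z) z + force_density p dD z by [].
  rewrite /bulk_res /force_density [RHS]addrAC -[X in _ = X + _]big_split; congr (_ + _).
  apply: eq_bigr => i _; rewrite /res_velocity /res_momentum Ev//=.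
  by ring.
Qed.

Lemma lam_Gu z i : cyl p (Gu p) z -> lam (dD z) i = 0.
Proof.
move=> Gz; have [_ _ h _] := hdD.
apply: (within_closure_eq0 (K := cyl p (Gu p)) (S := ocyl p (Gu p))
  (f := fun z => lam (dD z) i)) => //.
- apply: (continuous_subspaceW (cyl_bdry_K (Gu_bdry hp))).
  by have [/reg_cts] := lam_tst rdD i.
- exact: ocyl_cyl.
- exact: closure_ocyl.
- by move=> y; exact: h.
Qed.

Lemma mu_normal_Gs z k : cyl p (Gs p) z ->
  \sum_l mu (dD z) k l * normal p z.1 0 l = 0.
Proof.
move=> Gz; have [_ _ _ h] := hdD.
apply: (within_closure_eq0 (K := cyl p (Gs p)) (S := ocyl p (Gs p))
  (f := fun z => \sum_l mu (dD z) k l * normal p z.1 0 l)) => //.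
- apply: within_sum => l; apply: withinM.
    apply: (continuous_subspaceW (cyl_bdry_K (Gs_bdry hp))).
    by have [/reg_cts] := mu_tst rdD k l.
  exact: (normal_within hp (@subsetUl _ _ _)).
- exact: ocyl_cyl.
- exact: closure_ocyl.
- by move=> y; exact: h.
Qed.

(** On the two parts of the boundary, the condition imposed on the test field kills
    the flux that is not prescribed there. *)
Lemma flux_Gs z : cyl p (Gs p) z -> \sum_j flux_x j z * normal p z.1 0 j =
  traction_res (dD z) z + traction_density p dD z.
Proof.
move=> Gz; have Kz := cyl_bdry_K (Gs_bdry hp) Gz.
have -> : \sum_j flux_x j z * normal p z.1 0 j =
    \sum_i lam (dD z) i * (\sum_j Se i j z * normal p z.1 0 j)
    - \sum_k ue k z * (\sum_j mu (dD z) k j * normal p z.1 0 j).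
  rewrite /flux_x; under eq_bigr do rewrite mulrBl !mulr_suml.
  rewrite sumrB [X in X - _]exchange_big [X in _ - X]exchange_big /=.
  congr (_ - _); apply: eq_bigr => i _; rewrite mulr_sumr; apply: eq_bigr => j _; ring.
rewrite [X in _ - X]big1 ?subr0; last by move=> k _; rewrite mu_normal_Gs// mulr0.
rewrite /traction_res /traction_density -big_split; apply: eq_bigr => i _ /=.
rewrite /res_traction mulrBr subrK; congr (_ * _); apply: eq_bigr => j _.
by rewrite ES.
Qed.

Lemma flux_Gu z : cyl p (Gu p) z -> \sum_j flux_x j z * normal p z.1 0 j =
  disp_res (dD z) z - disp_density p dD z.
Proof.
move=> Gz; have Kz := cyl_bdry_K (Gu_bdry hp) Gz.
rewrite /disp_res /disp_density -sumrB.
under [RHS]eq_bigr do rewrite -sumrB.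
rewrite [RHS]exchange_big; apply: eq_bigr => j _ /=; rewrite /flux_x.
rewrite big1 ?add0r; last by move=> i _; rewrite lam_Gu// mulr0.
rewrite mulNr mulr_suml -sumrN; apply: eq_bigr => k _.
by rewrite /res_disp Eu//; ring.
Qed.

Lemma flux_init x : Omega p x -> flux_t (x, T) - flux_t (x, 0) =
  init_res (dD (x, 0)) x + init_density p dD x.
Proof.
move=> Ox; have [_ h _ _] := hdD.
have K0 : K (x, 0).
  split; first exact: subset_closure.
  by rewrite /= in_itv/= lexx ltW ?(prb_horizon hp).
rewrite /flux_t [X in X - _]big1 ?sub0r; last first.
  by move=> i _; have [-> ->] := h x i Ox; rewrite !mulr0 addr0 oppr0.
rewrite /init_res /init_density -big_split -sumrN; apply: eq_bigr => i _ /=.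
by rewrite /res_disp0 /res_vel0 Eu// Ev//; ring.
Qed.

Lemma bulk_res_integrable :
  (@leb4 R).-integrable (cyl p (Omega p)) (EFin \o (fun z => bulk_res (dD z) z)).
Proof.
have cv i := @res_velocity_cts i; have cm i := @res_momentum_cts i.
have ck i j := @res_kinematic_cts i j.
have g i := gam_tst rdD i; have l i := lam_tst rdD i; have m i j := mu_tst rdD i j.
apply: cyl_integrable => //.
  apply: ctsD.
    apply: cts_sum => i; apply: ctsD; apply: ctsM => //.
      by have [/reg_cts] := g i.
    by have [/reg_cts] := l i.
  apply: cts_sum => i; apply: cts_sum => j; apply: ctsM => //.
  by have [/reg_cts] := m i j.
apply: vanD.
  by apply: van_sum => i; apply: vanD; apply: vanMl; [have [] := g i|have [] := l i].
by apply: van_sum => i; apply: van_sum => j; apply: vanMl; have [] := m i j.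
Qed.

(** Integration by parts moves all derivatives to the DtP fields.  The fluxes
    through the boundary, the initial and the final section combine with the data
    into the residuals of the boundary and initial conditions. *)
Lemma first_variationE : first_variation p c D dD =
  \int[@leb4 R]_(z in cyl p (Omega p)) bulk_res (dD z) z
  + \int[@leb3 R]_(x in Omega p) init_res (dD (x, 0)) x
  + \int[sigma_dt (sigma p)]_(z in cyl p (Gs p)) traction_res (dD z) z
  + \int[sigma_dt (sigma p)]_(z in cyl p (Gu p)) disp_res (dD z) z.
Proof.
rewrite /first_variation /data_form.
have ct : cts (ddt flux_t) := Ck_near_cts (Ck_near_derive _ Ck_flux_t).
have vt : van (ddt flux_t) := van_derive hp _ Ck_flux_t van_flux_t.
have it := cyl_integrable hp ct vt.
have ix j : (@leb4 R).-integrable (cyl p (Omega p)) (EFin \o ddx j (flux_x j)).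
  apply: (cyl_integrable hp (Ck_near_cts (Ck_near_derive _ (Ck_flux_x j)))).
  exact: (van_derive hp _ (Ck_flux_x j) (van_flux_x j)).
have [isx Esx] := Rintegral_sum (index_enum 'I_3) mcO ix.
have iF := force_integrable hp rdD; have iB := bulk_res_integrable.
have -> : \int[@leb4 R]_(z in cyl p (Omega p)) pairing p z (U z) (jet_of dD z) =
    \int[@leb4 R]_(z in cyl p (Omega p)) ddt flux_t z
    + \sum_j \int[@leb4 R]_(z in cyl p (Omega p)) ddx j (flux_x j) z
    + (\int[@leb4 R]_(z in cyl p (Omega p)) bulk_res (dD z) z
       + \int[@leb4 R]_(z in cyl p (Omega p)) force_density p dD z).
  rewrite -Esx -(RintegralD mcO it isx) -(RintegralD mcO iB iF) -RintegralD//.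
  - by apply: eq_Rintegral => z /set_mem /cyl_Omega_K; exact: pairing_flux.
  - exact: (integrableD mcO it isx).
  - exact: (integrableD mcO iB iF).
rewrite (time_integral hp Ck_flux_t van_flux_t).
rewrite (eq_bigr _ (fun j _ => gauss_green_cyl hp j (Ck_flux_x j) (van_flux_x j))).
rewrite big_split/=.
have I0 t : `[0, T]%classic t -> (@leb3 R).-integrable (Omega p)
    (EFin \o (fun x => flux_t (x, t))).
  move=> tT; apply: init_integrable => //; last exact: (van_slice van_flux_t).
  by apply: (slice_within (p := p)) => //; exact: Ck_near_cts Ck_flux_t.
have IT0 : (@leb3 R).-integrable (Omega p)
    (EFin \o (fun x => flux_t (x, T) - flux_t (x, 0))).
  have T0 : 0 <= T by exact: ltW (prb_horizon hp).
  have IT : `[0, T]%classic T by rewrite /= in_itv/= lexx andbT.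
  have I00 : `[0, T]%classic 0 by rewrite /= in_itv/= lexx.
  exact: (integrableB mO (I0 T IT) (I0 0 I00)).
have Einit : \int[@leb3 R]_(x in Omega p) init_res (dD (x, 0)) x =
    \int[@leb3 R]_(x in Omega p) (flux_t (x, T) - flux_t (x, 0))
    - \int[@leb3 R]_(x in Omega p) init_density p dD x.
  rewrite -(RintegralB mO IT0 (init_density_integrable hp rdD)).
  by apply: eq_Rintegral => x /set_mem Ox; rewrite flux_init// addrK.
have ibd G j : G `<=` Gs p `|` Gu p -> G `<=` bdry (Omega p) ->
    measurable (G : set (mspace R)) ->
    (sigma_dt (sigma p)).-integrable (cyl p G)
      (EFin \o (fun z => flux_x j z * normal p z.1 0 j)).
  move=> GG Gb mG; apply: bdry_integrable => //.
    apply: bcoefM; last exact: bcoef_normal.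
    exact: (bcoef_cts Gb mG (Ck_near_cts (Ck_flux_x j))).
  have [M hM] := van_flux_x j; exists M => z Gz zM.
  by rewrite hM ?mul0r//; exact: (cyl_bdry_K Gb).
have iGs j := ibd (Gs p) j (@subsetUl _ _ _) (Gs_bdry hp) (measurable_Gs hp).
have iGu j := ibd (Gu p) j (@subsetUr _ _ _) (Gu_bdry hp) (measurable_Gu hp).
have [isGs EGs] := Rintegral_sum (index_enum 'I_3) mcGs iGs.
have [isGu EGu] := Rintegral_sum (index_enum 'I_3) mcGu iGu.
have Etr : \int[sigma_dt (sigma p)]_(z in cyl p (Gs p)) traction_res (dD z) z =
    \sum_j \int[sigma_dt (sigma p)]_(z in cyl p (Gs p)) (flux_x j z * normal p z.1 0 j)
    - \int[sigma_dt (sigma p)]_(z in cyl p (Gs p)) traction_density p dD z.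
  rewrite -EGs -(RintegralB mcGs isGs (traction_integrable hp rdD)).
  by apply: eq_Rintegral => z /set_mem Gz; rewrite flux_Gs// addrK.
have Edi : \int[sigma_dt (sigma p)]_(z in cyl p (Gu p)) disp_res (dD z) z =
    \sum_j \int[sigma_dt (sigma p)]_(z in cyl p (Gu p)) (flux_x j z * normal p z.1 0 j)
    + \int[sigma_dt (sigma p)]_(z in cyl p (Gu p)) disp_density p dD z.
  rewrite -EGu -(RintegralD mcGu isGu (disp_integrable hp rdD)).
  by apply: eq_Rintegral => z /set_mem Gz; rewrite flux_Gu// subrK.
rewrite Einit Etr Edi.
move: (\int[_]_(_ in _) init_density _ _ _) => a1.
by ring.
Qed.

End Test.
End FirstVariation.
End WeakForm.

(** * Localization by bumps *)

Section Localization.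
Variable R : realType.

Lemma boxS (z0 : spacetime R) d d' : d <= d' -> box z0 d `<=` box z0 d'.
Proof. by move=> dd z bz c; exact: lt_le_trans (bz c) dd. Qed.

(** The integrand is nonnegative, and positive on a set of positive measure.  The
    embedding [e] of the domain of integration in space-time covers the cylinder,
    its lateral boundary and its initial section at once. *)
Lemma positive_bump_integral d (X : measurableType d) (m : {measure set X -> \bar R})
    (A : set X) (f : X -> R) (e : X -> spacetime R) z0 (r : R) : 0 < r ->
  measurable A -> measurable (e @^-1` box z0 r) ->
  (forall x, A x -> box z0 r (e x) -> 0 < f x) ->
  (0 < m (A `&` e @^-1` box z0 r))%E ->
  m.-integrable A (EFin \o (fun x => f x * bump z0 r (e x))) ->
  \int[m]_(x in A) (f x * bump z0 r (e x)) != 0.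
Proof.
move=> r0 mA mB fpos mpos fi; apply/eqP => f0.
have nonneg x : A x -> (0 <= (f x * bump z0 r (e x))%:E)%E.
  move=> Ax; rewrite lee_fin; have [bx|nbx] := pselect (box z0 r (e x)).
    by rewrite mulr_ge0// ?bump_ge0// ltW// fpos.
  by rewrite bump_eq0 ?mulr0// ltW.
have : (\int[m]_(x in A) `|(f x * bump z0 r (e x))%:E| = 0)%E.
  rewrite -[RHS]/(0%:E) -f0 /Rintegral fineK; last exact: (integrable_fin_num mA fi).
  by apply: eq_integral => x /set_mem Ax; rewrite gee0_abs// nonneg.
move=> /(ae_eq_integral_abs _ mA (measurable_int _ fi)) [N [mN N0 AN]].
have : (m (A `&` e @^-1` box z0 r) <= m N)%E.
  apply: le_measure; rewrite ?inE//; first exact: measurableI.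
  move=> x [Ax bx]; apply: AN => /= /(_ Ax) [] /eqP.
  by rewrite mulf_eq0 !gt_eqF// ?bump_gt0// fpos.
by rewrite N0 leNgt mpos.
Qed.

(** The fundamental lemma of the calculus of variations at a point: a nonzero value
    would fix the sign of [f] on a small box. *)
Lemma bump_orthogonal_eq0 d (X : measurableType d) (m : {measure set X -> \bar R})
    (A : set X) (f : X -> R) (e : X -> spacetime R) (x0 : X) (r0 : R) : 0 < r0 ->
  measurable A -> (forall r, 0 < r -> measurable (e @^-1` box (e x0) r)) ->
  (forall B, nbhs (f x0) B -> exists2 r, 0 < r &
     forall x, A x -> box (e x0) r (e x) -> B (f x)) ->
  (forall r, 0 < r -> r <= r0 -> (0 < m (A `&` e @^-1` box (e x0) r))%E) ->
  (forall r, 0 < r -> r <= r0 ->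
     m.-integrable A (EFin \o (fun x => f x * bump (e x0) r (e x)))) ->
  (forall r, 0 < r -> r <= r0 ->
     \int[m]_(x in A) (f x * bump (e x0) r (e x)) = 0) ->
  f x0 = 0.
Proof.
move=> r00 mA mB cf mpos fi f0; apply/eqP/negPn/negP => fx0.
have [fp|fn|/esym/eqP] := ltgtP 0 (f x0); last by rewrite (negPf fx0).
- have [r1 r10 h] := cf [set y | 0 < y] (open_nbhs_nbhs (conj (@open_gt _ 0) fp)).
  pose r := Num.min r0 r1; have r_0 : 0 < r by rewrite lt_min r00.
  have rr0 : r <= r0 by rewrite ge_min lexx.
  have/eqP := f0 r r_0 rr0; apply/negP.
  apply: positive_bump_integral => //; [exact: mB| |exact: mpos|exact: fi].
  by move=> x Ax bx; apply: h => //; apply: boxS bx; rewrite ge_min lexx orbT.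
- have [r1 r10 h] := cf [set y | y < 0] (open_nbhs_nbhs (conj (@open_lt _ 0) fn)).
  pose r := Num.min r0 r1; have r_0 : 0 < r by rewrite lt_min r00.
  have rr0 : r <= r0 by rewrite ge_min lexx.
  have E : (fun x => - f x * bump (e x0) r (e x)) =
      (fun x => -1 * (f x * bump (e x0) r (e x))).
    by apply/funext => x; rewrite mulN1r mulNr.
  have : \int[m]_(x in A) (- f x * bump (e x0) r (e x)) != 0.
    apply: positive_bump_integral => //; [exact: mB| |exact: mpos|].
      move=> x Ax bx; rewrite oppr_gt0; apply: h => //.
      by apply: boxS bx; rewrite ge_min lexx orbT.
    by rewrite E; exact: (integrableZl mA (-1) (fi r r_0 rr0)).
  rewrite E RintegralZl//; last exact: fi.
  by rewrite f0// mulr0 eqxx.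
Qed.

Definition bump_field (z0 : spacetime R) r (d : dual_val R) : spacetime R -> dual_val R :=
  fun z => bump z0 r z *: d.

Definition scalev (d : dual_val R) (s : R) : dual_val R := s *: d.
Lemma scalev_is_linear d : linear (scalev d).
Proof. by move=> a s t; rewrite /scalev scalerDl scalerA. Qed.
HB.instance Definition _ d :=
  GRing.isLinear.Build R R (dual_val R) *:%R (scalev d) (scalev_is_linear d).

Lemma Ck_bump_field z0 r d (U : set (spacetime R)) : open U ->
  Ck 2 U (bump_field z0 r d).
Proof.
move=> oU; apply: (Ck_lin (L := scalev d) oU _ (Ck_bump z0 r oU)).
exact: scalel_continuous.
Qed.

Lemma box_bounded (z0 : spacetime R) r z : box z0 r z -> `|z.1| <= `|z0.1| + r.
Proof.
rewrite boxE => -[[[b0 b1] b2] _].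
have : ball z0.1 r z.1 by split; [split|].
rewrite -ball_normE /= => h.
by rewrite -lerBlDl (le_trans (lerB_dist _ _))// distrC ltW.
Qed.

Variable p : problem R.
Hypothesis hp : regular_problem p.

(** A localized test field is admissible when it stops before the final time and,
    on each part of the boundary, either does not reach it or has no multiplier
    that is constrained there. *)
Lemma bump_dual_fields z0 r d : 0 < r -> z0.2 + r <= horizon p ->
  ((forall i, lam d i = 0) \/ (forall z, ocyl p (Gu p) z -> ~ box z0 r z)) ->
  ((forall k l, mu d k l = 0) \/ (forall z, ocyl p (Gs p) z -> ~ box z0 r z)) ->
  dual_fields p (bump_field z0 r d).
Proof.
move=> r0 zT hu hs.
split.
- split.
    by exists setT; split; [exact: openT|by []|exact: Ck_bump_field openT].
  exists (`|z0.1| + r) => z _ zM; rewrite /bump_field bump_eq0 ?scale0r ?ltW//.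
  by move=> /box_bounded; rewrite leNgt zM.
- move=> x i Ox; rewrite /bump_field bump_eq0 ?ltW//.
    by rewrite gamZ lamZ !mul0r.
  rewrite boxE => -[_]; rewrite /ball/= distrC => h.
  by have := le_lt_trans (ler_norm _) h; rewrite ltrBlDl ltNge zT.
- move=> z i Gz; rewrite /bump_field lamZ.
  by case: hu => [->|/(_ z Gz) nb]; [rewrite mulr0|rewrite bump_eq0 ?mul0r// ltW].
- move=> z k Gz; apply: big1 => l _; rewrite /bump_field muZ.
  by case: hs => [->|/(_ z Gz) nb]; [rewrite mulr0 mul0r|rewrite bump_eq0 ?mul0r// ltW].
Qed.

Lemma leb_ball (t r : R) : 0 < r -> (0 < @lebesgue_measure R (ball t r))%E.
Proof.
by move=> r0; rewrite lebesgue_measure_ball ?ltW// lte_fin mulrn_wgt0.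
Qed.

Definition sbox (z0 : spacetime R) r : set (space R) := [set x | box z0 r (x, z0.2)].

Lemma sboxE z0 r : 0 < r -> sbox z0 r =
  ((ball z0.1.1.1 r `*` ball z0.1.1.2 r) `*` ball z0.1.2 r).
Proof.
move=> r0; rewrite /sbox; apply/seteqP; split=> x /=; rewrite boxE.
  by case.
by move=> h; split=> //; exact: ballxx.
Qed.

Lemma box_sbox z0 r : 0 < r -> box z0 r = sbox z0 r `*` ball z0.2 r.
Proof. by move=> r0; rewrite sboxE// boxE. Qed.

Lemma measurable_sbox z0 r : 0 < r -> measurable (sbox z0 r : set (mspace R)).
Proof.
move=> r0; rewrite sboxE//; apply: measurableX; last exact: measurable_ball.
by apply: measurableX; exact: measurable_ball.
Qed.

Lemma open_box (z0 : spacetime R) r : open (box z0 r).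
Proof.
have c1 : continuous (fun z : spacetime R => z.1) by exact: fst_continuous.
have c11 : continuous (fun z : spacetime R => z.1.1).
  by move=> z; apply: (continuous_comp (c1 z)); exact: fst_continuous.
have oc (f : spacetime R -> R) a : continuous f -> open (f @^-1` ball a r).
  by move=> cf; apply: open_comp (ball_open a r) => z _; exact: cf.
rewrite boxE; apply: openI; first apply: openI; first apply: openI.
- by apply: oc => z; apply: (continuous_comp (c11 z)); exact: fst_continuous.
- by apply: oc => z; apply: (continuous_comp (c11 z)); exact: snd_continuous.
- by apply: oc => z; apply: (continuous_comp (c1 z)); exact: snd_continuous.
- by apply: oc; exact: snd_continuous.
Qed.

Lemma open_sbox z0 r : open (sbox z0 r).
Proof.
apply: (@open_comp _ _ (fun x : space R => (x, z0.2)) (box z0 r)); last exact: open_box.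
by move=> x _; exact: pair_continuous_l.
Qed.

Lemma leb3_sbox z0 r : 0 < r -> (0 < @leb3 R (sbox z0 r))%E.
Proof.
move=> r0; have mb t : measurable (ball t r : set (measurableTypeR R)).
  exact: measurable_ball.
have I2 a b : (0 < @leb2 R (ball a r `*` ball b r))%E.
  by rewrite /leb2 product_measure1E// mule_gt0 ?leb_ball.
rewrite sboxE// /leb3 product_measure1E//; last exact: measurableX.
by apply: mule_gt0; [exact: I2|exact: leb_ball].
Qed.

Lemma leb4_box z0 r : 0 < r -> (0 < @leb4 R (box z0 r))%E.
Proof.
move=> r0; rewrite box_sbox// /leb4 product_measure1E//.
- by apply: mule_gt0; [exact: leb3_sbox|exact: leb_ball].
- exact: measurable_sbox.
- exact: measurable_ball.
Qed.

(** The box cuts the lateral boundary in a product of an open piece of the boundary,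
    which has positive area, and an interval. *)
Lemma sigma_dt_box (G V : set (space R)) z0 r : 0 < r -> open V ->
  G = V `&` bdry (Omega p) -> G z0.1 -> box z0 r `<=` V `*` `]0, horizon p[%classic ->
  (0 < sigma_dt (sigma p) (cyl p G `&` box z0 r))%E.
Proof.
move=> r0 oV GV Gz bV.
have -> : cyl p G `&` box z0 r = (G `&` sbox z0 r) `*` ball z0.2 r.
  rewrite (box_sbox _ r0); apply/seteqP; split=> -[x t] /=.
    by move=> [[/= ? ?] [? ?]].
  move=> [[Gx bx] bt]; split=> //; split=> //=.
  have : box z0 r (x, t) by rewrite box_sbox.
  by move=> /bV[_ /=]; exact: subset_itv_oo_cc.
have mG : measurable (G `&` sbox z0 r : set (mspace R)).
  apply: measurableI; last exact: measurable_sbox.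
  by rewrite GV; apply: measurableI; [exact: open_measurable_space|exact: measurable_bdry].
rewrite /sigma_dt product_measure1E//; last exact: measurable_ball.
apply: mule_gt0; last exact: leb_ball.
have -> : G `&` sbox z0 r = (V `&` sbox z0 r) `&` bdry (Omega p).
  by rewrite GV setIAC.
apply: (dom_area_pos (prb_domain hp)).
  by apply: openI => //; exact: open_sbox.
exists z0.1; rewrite GV in Gz; case: Gz => Vz Bz; split=> //; split=> //.
rewrite sboxE//; split; [split|]; exact: ballxx.
Qed.

End Localization.

(** * Vanishing of the residuals *)

Section Stationarity.
Variables (R : realType) (p : problem R) (c : chosen R).
Hypotheses (hp : regular_problem p) (hc : regular_choice p c)
  (hn : nondegenerate_choice p c).

Local Notation T := (horizon p).
Local Notation K := (cyl p (closure (Omega p))).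
Local Notation cts := (cts p).
Local Notation van := (van p).
Local Notation dom := (prb_domain hp).

Let T0 : 0 < T. Proof. exact: prb_horizon. Qed.
Let mO := measurable_Omega hp.
Let mcO : measurable (cyl p (Omega p) : set (mspacetime R)).
Proof. exact: measurable_cyl. Qed.

Variable D : spacetime R -> dual_val R.
Hypothesis hD : dual_fields p D.
Let rD : regular_dual p D. Proof. by have [] := hD. Qed.
Local Notation U := (dtp_field p c D).

Variables (ue ve : 'I_3 -> spacetime R -> R) (Se : 'I_3 -> 'I_3 -> spacetime R -> R).
Hypotheses (Cu : forall i, Ck_near 1 K (ue i)) (Cv : forall i, Ck_near 1 K (ve i))
  (CS : forall i j, Ck_near 1 K (Se i j)).
Hypotheses (Eu : forall i z, K z -> pu (U z) 0 i = ue i z)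
  (Ev : forall i z, K z -> pv (U z) 0 i = ve i z)
  (ES : forall i j z, K z -> stress p (U z) z i j = Se i j z).

Local Notation bres := (bulk_res p c D ue ve Se).
Local Notation ires := (init_res p c D).
Local Notation tres := (traction_res p c D).
Local Notation dres := (disp_res p c D).

Lemma bulk_resZ s d z : bres (s *: d) z = s * bres d z.
Proof.
rewrite /bulk_res mulrDr !mulr_sumr; congr (_ + _); apply: eq_bigr => i _.
  by rewrite gamZ lamZ; ring.
by rewrite mulr_sumr; apply: eq_bigr => j _; rewrite muZ mulrA.
Qed.

Lemma init_resZ s d x : ires (s *: d) x = s * ires d x.
Proof.
by rewrite /init_res mulr_sumr; apply: eq_bigr => i _; rewrite gamZ lamZ; ring.
Qed.

Lemma traction_resZ s d z : tres (s *: d) z = s * tres d z.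
Proof.
by rewrite /traction_res mulr_sumr; apply: eq_bigr => i _; rewrite lamZ mulrA.
Qed.

Lemma disp_resZ s d z : dres (s *: d) z = s * dres d z.
Proof.
rewrite /disp_res mulr_sumr; apply: eq_bigr => i _.
by rewrite mulr_sumr; apply: eq_bigr => j _; rewrite muZ mulrA.
Qed.

Lemma bulk_res_cts d : cts (bres d).
Proof.
apply: ctsD; apply: cts_sum => i.
  apply: ctsD; apply: ctsM; try exact: cts_cst.
    exact: (res_velocity_cts hp hc hn rD Cu).
  exact: (res_momentum_cts hp Cv CS).
apply: cts_sum => j; apply: ctsM; first exact: cts_cst.
exact: (res_kinematic_cts hp hc hn rD Cu).
Qed.

Let dtpr := dtp_reg hp hc hn rD.

Lemma init_res_within d : {within closure (Omega p), continuous (ires d)}.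
Proof.
have [ru rv _ _] := dtpr.
have h f : cts f -> {within closure (Omega p), continuous (fun x => f (x, 0))}.
  by move=> cf; apply: (slice_within (p := p)) => //; rewrite /= in_itv/= lexx ltW.
apply: within_sum => i; apply: withinD; (apply: withinM; first exact: within_cst).
  apply: withinB; last exact: (within_entry (prb_disp_init hp)).
  exact: (h (fun z => pu (U z) 0 i) (reg_cts (ru i))).
apply: withinM; first exact: (h _ (reg_cts (rho_reg hp))).
apply: withinB; last exact: (within_entry (prb_vel_init hp)).
exact: (h (fun z => pv (U z) 0 i) (reg_cts (rv i))).
Qed.

Lemma stress_reg i j : reg p (fun z => stress p (U z) z i j).
Proof.
have [_ _ rE _] := dtpr.
apply: reg_sum => k; apply: reg_sum => l; apply: regM; first exact: moduli_reg.
exact: rE.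
Qed.

Lemma traction_res_within d : {within cyl p (Gs p), continuous (tres d)}.
Proof.
apply: within_sum => i; apply: withinM; first exact: within_cst.
apply: withinB; last exact: (within_entry (prb_traction hp)).
apply: within_sum => j; apply: withinM.
  apply: (continuous_subspaceW (cyl_bdry_K (Gs_bdry hp))).
  exact: (reg_cts (stress_reg i j)).
exact: (normal_within hp (@subsetUl _ _ _)).
Qed.

Lemma disp_res_within d : {within cyl p (Gu p), continuous (dres d)}.
Proof.
have [ru _ _ _] := dtpr.
apply: within_sum => i; apply: within_sum => j; apply: withinM; first exact: within_cst.
apply: withinM; last exact: (normal_within hp (@subsetUr _ _ _)).
apply: withinB; first exact: (within_entry (prb_disp_bdry hp)).
apply: (continuous_subspaceW (cyl_bdry_K (Gu_bdry hp))).
exact: (reg_cts (ru i)).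
Qed.

Lemma traction_res_bcoef d : bcoef p (Gs p) (tres d).
Proof.
have mG := measurable_Gs hp; have Gb := Gs_bdry hp.
have -> : tres d = fun z => \sum_i lam d i *
   (\sum_j stress p (U z) z i j * normal p z.1 0 j + -1 * traction p z 0 i).
  by apply/funext => z; apply: eq_bigr => i _; rewrite mulN1r.
apply: bcoef_sum => i; apply: bcoefM; first exact: bcoef_cst.
apply: bcoefD; last first.
  apply: bcoefM; first exact: bcoef_cst.
  exact: (bcoef_data i mG (prb_traction hp) (prb_traction_bounded hp)).
apply: bcoef_sum => j; apply: bcoefM.
  exact: (bcoef_cts Gb mG (reg_cts (stress_reg i j))).
exact: (bcoef_normal hp j (@subsetUl _ _ _) mG).
Qed.

Lemma disp_res_bcoef d : bcoef p (Gu p) (dres d).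
Proof.
have mG := measurable_Gu hp; have Gb := Gu_bdry hp; have [ru _ _ _] := dtpr.
have -> : dres d = fun z => \sum_k \sum_l mu d k l *
   ((disp_bdry p z 0 k + -1 * pu (U z) 0 k) * normal p z.1 0 l).
  apply/funext => z; apply: eq_bigr => i _; apply: eq_bigr => j _.
  by rewrite mulN1r.
apply: bcoef_sum => k; apply: bcoef_sum => l; apply: bcoefM; first exact: bcoef_cst.
apply: bcoefM; last exact: (bcoef_normal hp l (@subsetUr _ _ _) mG).
apply: bcoefD.
  exact: (bcoef_data k mG (prb_disp_bdry hp) (prb_disp_bdry_bounded hp)).
apply: bcoefM; first exact: bcoef_cst.
exact: (bcoef_cts Gb mG (reg_cts (ru k))).
Qed.

Lemma bump_cts (z0 : spacetime R) r : cts (bump z0 r).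
Proof.
apply: (@Ck_near_cts _ _ 2); exists setT.
by split; [exact: openT|by []|exact: Ck_bump openT].
Qed.

Lemma bump_far (z0 : spacetime R) r z : 0 < r -> `|z0.1| + r < `|z.1| -> bump z0 r z = 0.
Proof.
move=> r0 zM; rewrite bump_eq0 ?ltW//.
by move=> /box_bounded; rewrite leNgt zM.
Qed.

Lemma Rintegral_eq0 d (X : measurableType d) (m : {measure set X -> \bar R})
    (A : set X) (f : X -> R) : (forall x, A x -> f x = 0) -> \int[m]_(x in A) f x = 0.
Proof. by move=> f0; rewrite /Rintegral integral0_eq// => x Ax; rewrite f0. Qed.

Lemma within_box (A : set (spacetime R)) (f : spacetime R -> R) z0 :
  {within A, continuous f} -> A z0 -> forall B, nbhs (f z0) B ->
  exists2 r, 0 < r & forall z, A z -> box z0 r z -> B (f z).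
Proof.
move=> /subspace_continuousP cf Az B hB; have := cf z0 Az B hB.
rewrite /fmap/= /within/= => /nbhs_box[r r0 h]; exists r => // z Az' bz.
exact: h.
Qed.

Lemma Omega_bdry x : Omega p x -> bdry (Omega p) x -> False.
Proof. by move=> Ox [_]; apply; rewrite (interior_id _).1//; exact: dom_open dom. Qed.

(** Bumps supported inside the cylinder isolate the equations.  Once the bulk
    residual is zero, bumps at the initial time isolate the initial conditions,
    and with those gone bumps at one part of the lateral boundary isolate its
    boundary condition. *)
Section Vanishing.
Hypothesis hst : forall dD, dual_fields p dD -> first_variation p c D dD = 0.

Let fv z0 r d : dual_fields p (bump_field z0 r d) ->
  \int[@leb4 R]_(z in cyl p (Omega p)) (bres d z * bump z0 r z)
  + \int[@leb3 R]_(x in Omega p) (ires d x * bump z0 r (x, 0))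
  + \int[sigma_dt (sigma p)]_(z in cyl p (Gs p)) (tres d z * bump z0 r z)
  + \int[sigma_dt (sigma p)]_(z in cyl p (Gu p)) (dres d z * bump z0 r z) = 0.
Proof.
move=> h; rewrite -[RHS](hst h) (first_variationE hp hc hn rD Cu Cv CS Eu Ev ES h).
congr (_ + _ + _ + _); apply: eq_Rintegral => z _; rewrite /bump_field.
- by rewrite bulk_resZ mulrC.
- by rewrite init_resZ mulrC.
- by rewrite traction_resZ mulrC.
- by rewrite disp_resZ mulrC.
Qed.

Lemma bulk_res_eq0_ocyl d z0 : ocyl p (Omega p) z0 -> bres d z0 = 0.
Proof.
move=> oz; have [r0 r00 br0] := nbhs_box (open_nbhs_nbhs (conj (open_ocyl hp) oz)).
have far G r z : r <= r0 -> G `<=` bdry (Omega p) -> cyl p G z -> ~ box z0 r z.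
  move=> rr0 Gb [Gz _] /(boxS rr0)/br0[Oz _].
  exact: (Omega_bdry Oz (Gb _ Gz)).
apply: (@bump_orthogonal_eq0 R _ (mspacetime R) (@leb4 R) (cyl p (Omega p))
  (bres d) id z0 r0) => //.
- by move=> r _; apply: measurable_box.
- apply: within_box; last exact: ocyl_cyl.
  exact: (continuous_subspaceW (@cyl_Omega_K R p) (@bulk_res_cts d)).
- move=> r rp rr0; rewrite (_ : _ `&` _ = box z0 r) ?leb4_box//.
  by apply/seteqP; split=> [z []//|z bz]; split=> //; apply/ocyl_cyl/br0/(boxS rr0).
- move=> r rp rr0; apply: cyl_integrable => //.
    by apply: ctsM; [exact: bulk_res_cts|exact: bump_cts].
  by exists (`|z0.1| + r) => z _ zM; rewrite bump_far// mulr0.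
move=> r rp rr0.
have rT : z0.2 + r <= T.
  rewrite leNgt; apply/negP => h.
  have : box z0 r (z0.1, T).
    rewrite boxE; split; first by split; [split|]; exact: ballxx.
    have [_ /=] := oz; rewrite in_itv/= => /andP[_ zT].
    by rewrite /ball/= distrC ger0_norm ?subr_ge0 ?ltW// ltrBlDl.
  by move=> /(boxS rr0)/br0[_ /=]; rewrite in_itv/= ltxx andbF.
have hd : dual_fields p (bump_field z0 r d).
  apply: bump_dual_fields => //; right=> z /ocyl_cyl; apply: (far _ r) => //.
    exact: Gu_bdry.
  exact: Gs_bdry.
have Zi : \int[@leb3 R]_(x in Omega p) (ires d x * bump z0 r (x, 0)) = 0.
  apply: Rintegral_eq0 => x Ox; rewrite bump_eq0 ?mulr0 ?ltW// => /(boxS rr0)/br0[_ /=].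
  by rewrite in_itv/= ltxx.
have Zt : \int[sigma_dt (sigma p)]_(z in cyl p (Gs p)) (tres d z * bump z0 r z) = 0.
  by apply: Rintegral_eq0 => z /(far _ _ _ rr0 (Gs_bdry hp)) nb; rewrite bump_eq0 ?mulr0 ?ltW.
have Zd : \int[sigma_dt (sigma p)]_(z in cyl p (Gu p)) (dres d z * bump z0 r z) = 0.
  by apply: Rintegral_eq0 => z /(far _ _ _ rr0 (Gu_bdry hp)) nb; rewrite bump_eq0 ?mulr0 ?ltW.
by have := fv hd; rewrite Zi Zt Zd !addr0.
Qed.

Lemma bulk_res_eq0 d z : K z -> bres d z = 0.
Proof.
move=> Kz; apply: (cts_eq0 hp (P := setT) openT (@bulk_res_cts d)) => // y oy _.
exact: bulk_res_eq0_ocyl.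
Qed.

Let bulk_int0 z0 r d :
  \int[@leb4 R]_(z in cyl p (Omega p)) (bres d z * bump z0 r z) = 0.
Proof.
by apply: Rintegral_eq0 => z /cyl_Omega_K Kz; rewrite bulk_res_eq0// mul0r.
Qed.

Lemma init_res_eq0 d x0 : Omega p x0 -> ires d x0 = 0.
Proof.
move=> Ox.
have nO : nbhs (x0, 0 : R) (fst @^-1` Omega p).
  exact: (@fst_continuous R _ _ (x0, 0) _ (open_nbhs_nbhs (conj (dom_open dom) Ox))).
have [r1 r10 br1] := nbhs_box nO.
pose r0 := Num.min r1 T.
have r00 : 0 < r0 by rewrite lt_min r10.
have far G r z : r <= r0 -> G `<=` bdry (Omega p) -> cyl p G z -> ~ box (x0, 0) r z.
  rewrite le_min => /andP[rr1 _] Gb [Gz _] /(boxS rr1)/br1 Oz.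
  exact: (Omega_bdry Oz (Gb _ Gz)).
apply: (@bump_orthogonal_eq0 R _ (mspace R) (@leb3 R) (Omega p)
  (ires d) (fun x => (x, 0)) x0 r0) => //.
- by move=> r rp; exact: (measurable_sbox (x0, 0) rp).
- move=> B hB; have /subspace_continuousP := @init_res_within d.
  move=> /(_ x0 (subset_closure Ox) B hB); rewrite /fmap/= /within/= => h.
  have h' : nbhs (x0, 0 : R) (fst @^-1` [set x : space R | closure (Omega p) x -> B (ires d x)]).
    exact: (@fst_continuous R _ _ (x0, 0) _ h).
  have [r rp br] := nbhs_box h'; exists r => // x Ox' bx.
  by apply: (br (x, 0) bx); exact: subset_closure.
- move=> r rp rr0; rewrite (_ : _ `&` _ = sbox (x0, 0) r) ?leb3_sbox//.
  apply/seteqP; split=> [z []//|x bx]; split=> //.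
  by apply: (br1 (x, 0)); apply: (boxS _ bx); move: rr0; rewrite le_min => /andP[].
- move=> r rp rr0; apply: init_integrable => //.
    apply: withinM; first exact: init_res_within.
    apply: (slice_within (p := p) (f := bump (x0, 0) r)) => //.
      by rewrite /= in_itv/= lexx ltW.
    exact: bump_cts.
  by exists (`|x0| + r) => x _ xM; rewrite bump_far// mulr0.
move=> r rp rr0.
have hd : dual_fields p (bump_field (x0, 0) r d).
  apply: bump_dual_fields => //.
  - by rewrite add0r; move: rr0; rewrite le_min => /andP[].
  - by right=> z /ocyl_cyl; apply: (far _ r) => //; exact: Gu_bdry.
  - by right=> z /ocyl_cyl; apply: (far _ r) => //; exact: Gs_bdry.
have Zt : \int[sigma_dt (sigma p)]_(z in cyl p (Gs p)) (tres d z * bump (x0, 0) r z) = 0.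
  by apply: Rintegral_eq0 => z /(far _ _ _ rr0 (Gs_bdry hp)) nb; rewrite bump_eq0 ?mulr0 ?ltW.
have Zd : \int[sigma_dt (sigma p)]_(z in cyl p (Gu p)) (dres d z * bump (x0, 0) r z) = 0.
  by apply: Rintegral_eq0 => z /(far _ _ _ rr0 (Gu_bdry hp)) nb; rewrite bump_eq0 ?mulr0 ?ltW.
by have := fv hd; rewrite bulk_int0 add0r Zt Zd !addr0.
Qed.

Let init_int0 z0 r d :
  \int[@leb3 R]_(x in Omega p) (ires d x * bump z0 r (x, 0)) = 0.
Proof. by apply: Rintegral_eq0 => x Ox; rewrite init_res_eq0// mul0r. Qed.

(** [G] is the trace of the open set [V], and a box inside [V] cannot meet a part
    of the boundary disjoint from [G]. *)
Lemma boundary_box (G G' V : set (space R)) z0 : open V ->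
  G = V `&` bdry (Omega p) -> G `&` G' = set0 -> G' `<=` bdry (Omega p) ->
  ocyl p G z0 -> exists2 r0, 0 < r0 & forall r, 0 < r -> r <= r0 ->
  [/\ box z0 r `<=` V `*` `]0, T[%classic, z0.2 + r <= T &
      forall z, cyl p G' z -> ~ box z0 r z].
Proof.
move=> oV GV GG' Gb' [Gz tT].
have nN : nbhs z0 (V `*` `]0, T[%classic).
  exists (V, `]0, T[%classic) => //=; split.
    by apply: open_nbhs_nbhs; split=> //; rewrite GV in Gz; case: Gz.
  by apply: open_nbhs_nbhs; split=> //; exact: interval_open.
have [r0 r00 br] := nbhs_box nN; exists r0 => // r rp rr0.
have brV : box z0 r `<=` V `*` `]0, T[%classic by move=> z /(boxS rr0)/br.
split=> //.
  rewrite leNgt; apply/negP => h.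
  have : box z0 r (z0.1, T).
    rewrite boxE; split; first by split; [split|]; exact: ballxx.
    move: tT; rewrite /= in_itv/= => /andP[_ zT].
    by rewrite /ball/= distrC ger0_norm ?subr_ge0 ?ltW// ltrBlDl.
  by move=> /brV[_ /=]; rewrite in_itv/= ltxx andbF.
move=> z [Gz' _] /brV[Vz _].
have : (G `&` G') z.1 by split=> //; rewrite GV; split=> //; exact: Gb'.
by rewrite GG'.
Qed.

(** The multiplier [mu] is constrained on this part of the boundary, so only
    localized test fields without it are admissible. *)
Lemma traction_res_eq0 d z0 : (forall k l, mu d k l = 0) ->
  ocyl p (Gs p) z0 -> tres d z0 = 0.
Proof.
move=> d0 oz; have [V [oV GV]] := dom_Gs_open dom.
have [r0 r00 hr] := boundary_box oV GV (dom_parts_disjoint dom) (Gu_bdry hp) oz.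
apply: (@bump_orthogonal_eq0 R _ (mspacetime R) (sigma_dt (sigma p)) (cyl p (Gs p))
  (tres d) id z0 r0) => //.
- by apply: measurable_cyl; exact: measurable_Gs.
- by move=> r _; apply: measurable_box.
- by apply: within_box; [exact: traction_res_within|exact: ocyl_cyl].
- move=> r rp rr0; have [bV _ _] := hr r rp rr0.
  by apply: (sigma_dt_box hp rp oV GV _ bV); case: oz.
- move=> r rp rr0; apply: bdry_integrable => //.
  + exact: Gs_bdry.
  + exact: measurable_Gs.
  + apply: bcoefM; first exact: traction_res_bcoef.
    by apply: (bcoef_cts (Gs_bdry hp) (measurable_Gs hp)); exact: bump_cts.
  + by exists (`|z0.1| + r) => z _ zM; rewrite bump_far// mulr0.
move=> r rp rr0; have [bV rT far] := hr r rp rr0.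
have hd : dual_fields p (bump_field z0 r d).
  by apply: bump_dual_fields => //; [right=> z /ocyl_cyl; exact: far|left].
have Zd : \int[sigma_dt (sigma p)]_(z in cyl p (Gu p)) (dres d z * bump z0 r z) = 0.
  by apply: Rintegral_eq0 => z /far nb; rewrite bump_eq0 ?mulr0 ?ltW.
by have := fv hd; rewrite bulk_int0 init_int0 Zd !add0r addr0.
Qed.

(** Here it is [lam] that is constrained. *)
Lemma disp_res_eq0 d z0 : (forall i, lam d i = 0) ->
  ocyl p (Gu p) z0 -> dres d z0 = 0.
Proof.
move=> d0 oz; have [V [oV GV]] := dom_Gu_open dom.
have disj : Gu p `&` Gs p = set0 by rewrite setIC (dom_parts_disjoint dom).
have [r0 r00 hr] := boundary_box oV GV disj (Gs_bdry hp) oz.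
apply: (@bump_orthogonal_eq0 R _ (mspacetime R) (sigma_dt (sigma p)) (cyl p (Gu p))
  (dres d) id z0 r0) => //.
- by apply: measurable_cyl; exact: measurable_Gu.
- by move=> r _; apply: measurable_box.
- by apply: within_box; [exact: disp_res_within|exact: ocyl_cyl].
- move=> r rp rr0; have [bV _ _] := hr r rp rr0.
  by apply: (sigma_dt_box hp rp oV GV _ bV); case: oz.
- move=> r rp rr0; apply: bdry_integrable => //.
  + exact: Gu_bdry.
  + exact: measurable_Gu.
  + apply: bcoefM; first exact: disp_res_bcoef.
    by apply: (bcoef_cts (Gu_bdry hp) (measurable_Gu hp)); exact: bump_cts.
  + by exists (`|z0.1| + r) => z _ zM; rewrite bump_far// mulr0.
move=> r rp rr0; have [bV rT far] := hr r rp rr0.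
have hd : dual_fields p (bump_field z0 r d).
  by apply: bump_dual_fields => //; [left|right=> z /ocyl_cyl; exact: far].
have Zt : \int[sigma_dt (sigma p)]_(z in cyl p (Gs p)) (tres d z * bump z0 r z) = 0.
  by apply: Rintegral_eq0 => z /far nb; rewrite bump_eq0 ?mulr0 ?ltW.
by have := fv hd; rewrite bulk_int0 init_int0 Zt !add0r.
Qed.

End Vanishing.
End Stationarity.

(** * The Euler-Lagrange system *)

Section EulerLagrange.
Variables (R : realType) (p : problem R) (c : chosen R).
Hypotheses (hp : regular_problem p) (hc : regular_choice p c)
  (hn : nondegenerate_choice p c).

Local Notation K := (cyl p (closure (Omega p))).
Local Notation cts := (cts p).
Local Notation dom := (prb_domain hp).

Variable D : spacetime R -> dual_val R.
Hypothesis hD : dual_fields p D.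
Let rD : regular_dual p D. Proof. by have [] := hD. Qed.
Local Notation U := (dtp_field p c D).

Lemma sum_delta (i : 'I_3) (F : 'I_3 -> R) : \sum_j (i == j)%:R * F j = F i.
Proof.
rewrite (bigD1 i)//= eqxx mul1r big1 ?addr0// => j ji.
by rewrite eq_sym (negPf ji) mul0r.
Qed.

Section Residuals.
Variables (ue ve : 'I_3 -> spacetime R -> R) (Se : 'I_3 -> 'I_3 -> spacetime R -> R).
Hypotheses (Cu : forall i, Ck_near 1 K (ue i)) (Cv : forall i, Ck_near 1 K (ve i))
  (CS : forall i j, Ck_near 1 K (Se i j)).
Hypotheses (Eu : forall i z, K z -> pu (U z) 0 i = ue i z)
  (Ev : forall i z, K z -> pv (U z) 0 i = ve i z)
  (ES : forall i j z, K z -> stress p (U z) z i j = Se i j z).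

Local Notation bres := (bulk_res p c D ue ve Se).
Local Notation tres := (traction_res p c D).
Local Notation dres := (disp_res p c D).

Let eq_interior (f g : spacetime R -> R) v z : (forall y, K y -> f y = g y) ->
  ocyl p (Omega p) z -> 'D_v f z = 'D_v g z.
Proof.
move=> fg oz; apply: near_eq_derive.
apply: filterS (open_nbhs_nbhs (conj (open_ocyl hp) oz)) => y oy.
exact/fg/cyl_Omega_K/ocyl_cyl.
Qed.

Lemma res_velocityE i z : ocyl p (Omega p) z -> res_velocity p c D ue i z =
  ddt (fun y => pu (U y) 0 i) z - pv (U z) 0 i.
Proof.
by move=> oz; rewrite /res_velocity /ddt (eq_interior _ (fun y Ky => Eu i Ky) oz).
Qed.

Lemma res_momentumE i z : ocyl p (Omega p) z -> res_momentum p ve Se i z =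
  rho p z.1 * ddt (fun y => pv (U y) 0 i) z
    - \sum_(j < 3) ddx j (fun y =>
        \sum_(k < 3) \sum_(l < 3) moduli p y.1 i j k l * pE (U y) k l) z
    - force p z 0 i.
Proof.
move=> oz; rewrite /res_momentum /ddt (eq_interior _ (fun y Ky => Ev i Ky) oz).
congr (_ - _ - _); apply: eq_bigr => j _.
by rewrite /ddx -(eq_interior _ (fun y Ky => ES i j Ky) oz).
Qed.

Lemma res_kinematicE k l z : ocyl p (Omega p) z -> res_kinematic p c D ue k l z =
  ddx l (fun y => pu (U y) 0 k) z - pE (U z) k l - pW (U z) k l.
Proof.
by move=> oz; rewrite /res_kinematic /ddx (eq_interior _ (fun y Ky => Eu k Ky) oz).
Qed.

Lemma res_tractionE i z : res_traction p c D i z =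
  \sum_(j < 3) \sum_(k < 3) \sum_(l < 3)
      moduli p z.1 i j k l * pE (U z) k l * normal p z.1 0 j
  - traction p z 0 i.
Proof.
rewrite /res_traction; congr (_ - _); apply: eq_bigr => j _.
rewrite /stress mulr_suml; apply: eq_bigr => k _.
by rewrite mulr_suml.
Qed.

(** The natural form of the Euler-Lagrange system: the residual of the initial
    velocity carries the density as a factor. *)
Definition solves_weighted : Prop :=
  elastodynamics_but_initial_velocity p U /\
  (forall x i, Omega p x ->
     rho p x * (pv (U (x, 0)) 0 i - vel_init p x 0 i) = 0).

Let dg i : dual_val R := (delta_mx 0 i, 0, 0).
Let dl i : dual_val R := (0, delta_mx 0 i, 0).
Let dm k l : dual_val R := (0, 0, delta_mx k l).

(** Unit values [dg], [dl], [dm] of one multiplier single out one residual. *)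
Lemma stationary_solves : stationary p (dual_functional p c) D -> solves_weighted.
Proof.
move=> /(stationaryP hp hc hn hD) hst.
have B d z := bulk_res_eq0_ocyl hp hc hn hD Cu Cv CS Eu Ev ES hst d (z0 := z).
have I d x := init_res_eq0 hp hc hn hD Cu Cv CS Eu Ev ES hst d (x0 := x).
have t0 d z := @traction_res_eq0 _ _ _ hp hc hn _ hD _ _ _ Cu Cv CS Eu Ev ES hst d z.
have d0 d z := @disp_res_eq0 _ _ _ hp hc hn _ hD _ _ _ Cu Cv CS Eu Ev ES hst d z.
have m0 d : (forall k l, mu d k l = 0) -> forall F,
    \sum_(k < 3) \sum_(l < 3) mu d k l * F k l = 0 :> R.
  by move=> h F; apply: big1 => k _; apply: big1 => l _; rewrite h mul0r.
have muK k l F : \sum_k' \sum_l' mu (dm k l) k' l' * F k' l' = F k l :> R.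
  rewrite -(sum_delta k (fun k' => F k' l)); apply: eq_bigr => k' _.
  rewrite -(sum_delta l (F k')) mulr_sumr; apply: eq_bigr => l' _.
  by rewrite /mu/= mxE mulrA -natrM mulnb [k' == k]eq_sym [l' == l]eq_sym.
have glK (a b : 'I_3 -> R) (F G : 'I_3 -> R) :
    \sum_j (a j * F j + b j * G j) = \sum_j a j * F j + \sum_j b j * G j.
  by rewrite big_split.
have gK i (F : 'I_3 -> R) : \sum_j gam (dg i) j * F j = F i.
  by rewrite -(sum_delta i F); apply: eq_bigr => j _; rewrite /gam/= mxE eqxx/= eq_sym.
have lK i (F : 'I_3 -> R) : \sum_j lam (dl i) j * F j = F i.
  by rewrite -(sum_delta i F); apply: eq_bigr => j _; rewrite /lam/= mxE eqxx/= eq_sym.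
have g0 i k l (F : 'I_3 -> R) : (\sum_j gam (dl i) j * F j = 0) *
   (\sum_j gam (dm k l) j * F j = 0) * (\sum_j lam (dg i) j * F j = 0) *
   (\sum_j lam (dm k l) j * F j = 0).
  by do !split; apply: big1 => j _; rewrite /gam /lam/= mxE mul0r.
split; last first.
  move=> x i Ox; have := I (dl i) x Ox.
  by rewrite /init_res glK lK (g0 i i i) add0r.
split.
- move=> z i oz; rewrite -res_velocityE// -[RHS](B (dg i) z oz) /bulk_res glK gK.
  by rewrite (g0 i i i) m0 ?addr0// => k l; rewrite /mu/= mxE.
- move=> z i oz; rewrite -res_momentumE// -[RHS](B (dl i) z oz) /bulk_res glK lK.
  by rewrite (g0 i i i) m0 ?addr0 ?add0r// => k l; rewrite /mu/= mxE.
- move=> z k l oz; rewrite -res_kinematicE// -[RHS](B (dm k l) z oz) /bulk_res glK muK.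
  by rewrite !(g0 k k l) !add0r.
- move=> z k oz.
  (* the discrepancy times each component of the normal vanishes; the normal is a
     unit vector *)
  have h l : (disp_bdry p z 0 k - pu (U z) 0 k) * normal p z.1 0 l = 0.
    rewrite -[LHS]/(res_disp p c D k l z) -(muK k l (fun k l => res_disp p c D k l z)).
    by apply: d0 => // i; rewrite /lam/= mxE.
  have [Gz _] := oz.
  have n1 := dom_normal_unit dom (or_intror Gz).
  apply/eqP; rewrite eq_sym -subr_eq0 -[_ - _]mulr1 -n1 mulr_sumr big1// => l _.
  by rewrite expr2 mulrA h mul0r.
- move=> z i oz; apply/eqP; rewrite -subr_eq0 -res_tractionE.
  rewrite -(lK i (fun i => res_traction p c D i z)); apply/eqP.
  by apply: t0 => // k l; rewrite /mu/= mxE.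
- move=> x i Ox; apply/eqP; rewrite -subr_eq0; apply/eqP.
  by have := I (dg i) x Ox; rewrite /init_res glK gK (g0 i i i) addr0.
- move=> z /ocyl_cyl/cyl_Omega_K Kz; apply: dtp_sym; [exact: hn.2|].
  exact: (cho_E_sym hc).
- move=> z /ocyl_cyl/cyl_Omega_K Kz; apply: dtp_skew.
  exact: (cho_W_skew hc).
Qed.

Lemma solves_stationary : solves_weighted -> stationary p (dual_functional p c) D.
Proof.
move=> [[e1 e2 e3 e4 e5 e6 _ _] e7]; apply/(stationaryP hp hc hn hD) => dD hdD.
rewrite (first_variationE hp hc hn rD Cu Cv CS Eu Ev ES hdD).
have Z1 d z : K z -> bres d z = 0.
  move=> Kz; have cb := @bulk_res_cts _ _ _ hp hc hn _ hD _ _ _ Cu Cv CS d.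
  apply: (cts_eq0 hp (P := setT) openT cb) => // y oy _.
  rewrite /bulk_res big1 ?add0r; last first.
    by move=> i _; rewrite res_velocityE// res_momentumE// e1// e2// !mulr0 addr0.
  by apply: big1 => k _; apply: big1 => l _; rewrite res_kinematicE// e3// mulr0.
have Z3 d z : cyl p (Gs p) z -> tres d z = 0.
  move=> Gz; apply: (within_closure_eq0 (S := ocyl p (Gs p))
    (@traction_res_within _ _ _ hp hc hn _ hD d) Gz); first exact: ocyl_cyl.
    exact: closure_ocyl.
  by move=> y oy; apply: big1 => i _; rewrite res_tractionE e5// subrr mulr0.
have Z4 d z : cyl p (Gu p) z -> dres d z = 0.
  move=> Gz; apply: (within_closure_eq0 (S := ocyl p (Gu p))
    (@disp_res_within _ _ _ hp hc hn _ hD d) Gz); first exact: ocyl_cyl.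
    exact: closure_ocyl.
  move=> y oy; apply: big1 => k _; apply: big1 => l _.
  by rewrite /res_disp e4// subrr mul0r mulr0.
rewrite (_ : \int[_]_(z in _) bulk_res _ _ _ _ _ _ _ _ = 0); last first.
  by apply: Rintegral_eq0 => z /cyl_Omega_K; exact: Z1.
rewrite (_ : \int[_]_(z in _) init_res _ _ _ _ _ = 0); last first.
  apply: Rintegral_eq0 => x Ox; apply: big1 => i _.
  by rewrite /res_disp0 /res_vel0 e6// e7// subrr !mulr0 addr0.
rewrite (_ : \int[_]_(z in _) traction_res _ _ _ _ _ = 0); last first.
  by apply: Rintegral_eq0 => z; exact: Z3.
rewrite (_ : \int[_]_(z in _) disp_res _ _ _ _ _ = 0) ?addr0//.
by apply: Rintegral_eq0 => z; exact: Z4.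
Qed.

End Residuals.

(** The representatives of the DtP fields near [K] are auxiliary: on the open
    cylinder their derivatives are those of the fields themselves. *)
Theorem stationary_iff :
  stationary p (dual_functional p c) D <-> solves_weighted.
Proof.
have [ru rv _ _] := dtp_reg hp hc hn rD.
have pick (f : 'I_3 -> spacetime R -> R) : (forall i, reg p (f i)) ->
    exists g, forall i, Ck_near 1 K (g i) /\ forall z, K z -> f i z = g i z.
  move=> rf.
  have /choice[g hg] i : exists g, Ck_near 1 K g /\ forall z, K z -> f i z = g z.
    by have [g Cg fg] := rf i; exists g.
  by exists g.
have [ue hu] := pick _ ru; have [ve hv] := pick _ rv.
have /choice[Se hS] i : exists g : 'I_3 -> spacetime R -> R, forall j,
    Ck_near 1 K (g j) /\ forall z, K z -> stress p (U z) z i j = g j z.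
  by apply: (pick (fun j z => stress p (U z) z i j)) => j; exact: stress_reg.
have Cu i := (hu i).1; have Cv i := (hv i).1; have CS i j := (hS i j).1.
have Eu i := (hu i).2; have Ev i := (hv i).2; have ES i j := (hS i j).2.
split; first exact: (stationary_solves Cu Cv CS Eu Ev ES).
exact: (solves_stationary Cu Cv CS Eu Ev ES).
Qed.

(** Where the density is not zero it can be divided out; by continuity of the
    velocity this determines the initial velocity on the closure of that set. *)
Lemma weighted_velocity : Omega p `<=` closure [set x | Omega p x /\ rho p x != 0] ->
  solves_weighted <-> elastodynamics p U.
Proof.
move=> dense; split=> -[h h'].
  split=> // x i Ox; apply/eqP; rewrite -subr_eq0; apply/eqP.
  have cw : {within closure (Omega p), continuous
      (fun x => pv (U (x, 0)) 0 i - vel_init p x 0 i)}.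
    have [_ rv _ _] := dtp_reg hp hc hn rD.
    apply: withinB; last exact: (within_entry (prb_vel_init hp)).
    apply: (slice_within (p := p) (f := fun z => pv (U z) 0 i)) => //.
      by rewrite /= in_itv/= lexx ltW ?(prb_horizon hp).
    exact: reg_cts (rv i).
  apply: (within_closure_eq0 (S := [set x | Omega p x /\ rho p x != 0]) cw).
  - exact: subset_closure.
  - by move=> y [/subset_closure].
  - exact: dense.
  - move=> y [Oy ry]; have /eqP := h' y i Oy.
    by rewrite mulf_eq0 (negPf ry)/= => /eqP.
by split=> // x i Ox; rewrite h'// subrr mulr0.
Qed.

End EulerLagrange.

Theorem mainTheorem1 (R : realType) (p : problem R) (hp : regular_problem p) :
  (forall c : chosen R, regular_choice p c -> nondegenerate_choice p c ->
     forall D : spacetime R -> dual_val R, dual_fields p D ->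
       (stationary p (dual_functional p c) D <->
          elastodynamics_but_initial_velocity p (dtp_field p c D) /\
          (forall x i, Omega p x ->
             rho p x * (pv (dtp_field p c D (x, 0)) 0 i - vel_init p x 0 i)
             = 0)) /\
       (Omega p `<=` closure [set x | Omega p x /\ rho p x != 0] ->
          (stationary p (dual_functional p c) D <->
             elastodynamics p (dtp_field p c D)))) /\
  (forall c : chosen R, regular_choice p c -> positive_choice p c ->
     (forall D : spacetime R -> dual_val R, dual_fields p D ->
        (dual_functional p c D)%:E =
        ereal_sup [set (predual p c U D)%:E | U in primal_fields p c D]) /\
     convex_set (dual_fields p) /\
     convex_function (dual_fields p) (dual_functional p c)) /\
  (forall c : chosen R, regular_choice p c -> positive_choice p c ->
     forall D dD : spacetime R -> dual_val R,
       regular_dual p D -> regular_dual p dD ->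
       \int[@leb4 R]_(z in cyl p (Omega p))
          principal_form p c z (jet_of D z) (grad dD z) = elliptic_form p c dD
       /\ 0 <= elliptic_form p c dD).
Proof.
split; [|split] => c hc.
- move=> hn D hD; have S := stationary_iff hp hc hn hD.
  split=> // dense; apply: (iff_trans S).
  exact: (weighted_velocity hp hc hn hD dense).
- move=> pc; split; [|split].
  + by move=> D [rD _ _ _]; exact: (dual_functional_sup hp hc pc rD).
  + exact: dual_fields_convex.
  + exact: (dual_functional_convex hp hc pc).
- move=> pc D dD _ rdD; split.
    exact: (principal_form_integral hp hc pc D rdD).
  exact: (elliptic_form_ge0 hp hc pc rdD).
Qed.
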